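(* Let $\beta,\gamma\in B_6$ be the positive permutation braids whose permutations are the $6$-cycles $(1\,6\,5\,3\,2\,4)$ and $(1\,5\,2\,6\,4\,3)$ respectively. Then the closures of $\beta$ and $\gamma$ are isotopic knots in $S^3$, but $\beta$ and $\gamma$ are not conjugate in $B_6$.
   Context: $B_n$ is Artin's braid group on $n$ strings, with generators $\sigma_1,\dots,\sigma_{n-1}$ and relations $\sigma_i\sigma_j=\sigma_j\sigma_i$ for $|i-j|\ge 2$ and $\sigma_i\sigma_{i+1}\sigma_i=\sigma_{i+1}\sigma_i\sigma_{i+1}$ for $1\le i\le n-2$. A positive braid is an element of $B_n$ which can be written as a word in positive powers of the generators $\sigma_i$, without inverses. A positive permutation braid is a positive braid in which no pair of strings crosses more than once. The permutation of a braid $\beta$ is $\pi=\varphi(\beta)\in S_n$, where $\varphi:B_n\to S_n$ is the homomorphism with $\varphi(\sigma_i)=(i\;\,i{+}1)$; here $\pi(j)$ is the endpoint of the string of $\beta$ which begins at $j$. The map $\varphi$ restricts to a bijection from the set $S_n^+$ of positive permutation braids in $B_n$ onto $S_n$, so each permutation determines a unique positive permutation braid. Permutations are written in cycle notation: $(a_1\,a_2\cdots a_m)$ sends $a_1\mapsto a_2\mapsto\cdots\mapsto a_m\mapsto a_1$. The closure of a braid is the link in $S^3$ obtained by identifying the initial points of the strings with the corresponding end points. *)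

(* Defs.v *)
From HB Require Import structures.
From mathcomp Require Import all_boot all_order all_fingroup all_algebra.
From mathcomp Require Import generic_quotient zify.
From mathcomp Require Import all_classical all_reals all_analysis.
Set Implicit Arguments.
Unset Strict Implicit.
Unset Printing Implicit Defensive.
Import Order.TTheory GRing.Theory Num.Theory.
Import numFieldNormedType.Exports.
Local Open Scope quotient_scope.
Local Open Scope classical_set_scope.
Local Open Scope ring_scope.

(* Strings and positions are 0-based: [j : 'I_n] is the string or position
   [j + 1] of the usual numbering, and [i : 'I_n.-1] stands for the generator
   [sigma_(i + 1)], which exchanges the positions [lpos i] and [rpos i]. *)

Fact rpos_subproof (n : nat) (i : 'I_n.-1) : (i.+1 < n)%N.
Proof. by case: n i => [|n] [i]. Qed.

Definition lpos (n : nat) (i : 'I_n.-1) : 'I_n :=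
  Ordinal (ltnW (rpos_subproof i)).
Definition rpos (n : nat) (i : 'I_n.-1) : 'I_n := Ordinal (rpos_subproof i).

(* The letter [(i, true)] is sigma_(i+1) and [(i, false)] is its inverse. *)
Notation bletter n := ('I_n.-1 * bool)%type.
Notation bword n := (seq (bletter n)).

Definition bletter_inv (n : nat) (a : bletter n) : bletter n := (a.1, ~~ a.2).
Definition bword_inv (n : nat) (w : bword n) : bword n :=
  rev (map (@bletter_inv n) w).

Inductive braid_eq (n : nat) : bword n -> bword n -> Prop :=
| braid_eq_refl u : braid_eq u u
| braid_eq_sym u v : braid_eq u v -> braid_eq v u
| braid_eq_trans u v w : braid_eq u v -> braid_eq v w -> braid_eq u w
| braid_eq_cat u u' v v' :
    braid_eq u u' -> braid_eq v v' -> braid_eq (u ++ v) (u' ++ v')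
| braid_eq_inv a : braid_eq [:: a; bletter_inv a] [::]
| braid_eq_comm (i j : 'I_n.-1) : (i.+2 <= j)%N ->
    braid_eq [:: (i, true); (j, true)] [:: (j, true); (i, true)]
| braid_eq_braid (i j : 'I_n.-1) : j = i.+1 :> nat ->
    braid_eq [:: (i, true); (j, true); (i, true)]
             [:: (j, true); (i, true); (j, true)].

Definition braid_eqb (n : nat) : rel (bword n) := fun u v => `[< braid_eq u v >].

Lemma braid_eqb_refl n : reflexive (@braid_eqb n).
Proof. by move=> u; apply/asboolP/braid_eq_refl. Qed.

Lemma braid_eqb_sym n : symmetric (@braid_eqb n).
Proof. by move=> u v; apply/asboolP/asboolP; apply: braid_eq_sym. Qed.

Lemma braid_eqb_trans n : transitive (@braid_eqb n).
Proof.
by move=> v u w /asboolP uv /asboolP vw; apply/asboolP; apply: braid_eq_trans vw.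
Qed.

Definition braid_equiv (n : nat) : equiv_rel (bword n) :=
  EquivRel (@braid_eqb n) (@braid_eqb_refl n) (@braid_eqb_sym n)
    (@braid_eqb_trans n).

Definition braid (n : nat) : Type := {eq_quot (braid_equiv n)}.
HB.instance Definition _ n := Choice.on (braid n).
HB.instance Definition _ n := EqQuotient.on (braid n).

Definition braid_of (n : nat) (w : bword n) : braid n := \pi_(braid n)%qT w.

Lemma braid_ofP n (u v : bword n) : braid_of u = braid_of v <-> braid_eq u v.
Proof.
split=> [/eqquotP/asboolP//|uv]; exact/eqquotP/asboolP.
Qed.

Lemma braid_of_repr n (b : braid n) : braid_of (repr b) = b.
Proof. exact: reprK. Qed.

Lemma repr_braid_of n (w : bword n) : braid_eq (repr (braid_of w)) w.
Proof. by apply/braid_ofP; rewrite braid_of_repr. Qed.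

Lemma bletter_invK n : involutive (@bletter_inv n).
Proof. by case=> i b; rewrite /bletter_inv /= negbK. Qed.

Lemma bword_inv_cons n a (w : bword n) :
  bword_inv (a :: w) = bword_inv w ++ [:: bletter_inv a].
Proof. by rewrite /bword_inv /= rev_cons cats1. Qed.

Lemma bword_inv_cat n (u v : bword n) :
  bword_inv (u ++ v) = bword_inv v ++ bword_inv u.
Proof. by rewrite /bword_inv map_cat rev_cat. Qed.

Lemma bword_invK n : involutive (@bword_inv n).
Proof.
by move=> w; rewrite /bword_inv map_rev revK -map_comp map_id_in // => a _;
   exact: bletter_invK.
Qed.

Lemma braid_eq_mulwV n (w : bword n) : braid_eq (w ++ bword_inv w) [::].
Proof.
elim: w => [|a w IH]; first exact: braid_eq_refl.
rewrite bword_inv_cons; apply: braid_eq_trans (braid_eq_inv a).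
have h := braid_eq_cat IH (braid_eq_refl [:: bletter_inv a]).
have := braid_eq_cat (braid_eq_refl [:: a]) h.
by rewrite /= catA.
Qed.

Lemma braid_eq_mulVw n (w : bword n) : braid_eq (bword_inv w ++ w) [::].
Proof. by rewrite -{2}[w]bword_invK; apply: braid_eq_mulwV. Qed.

Lemma braid_eq_invw n (u v : bword n) :
  braid_eq u v -> braid_eq (bword_inv u) (bword_inv v).
Proof.
move=> uv.
apply: (@braid_eq_trans _ _ (bword_inv u ++ (v ++ bword_inv v))).
  rewrite -{1}[bword_inv u]cats0; apply: braid_eq_cat (braid_eq_refl _) _.
  exact: braid_eq_sym (braid_eq_mulwV v).
rewrite catA -{2}[bword_inv v]cat0s; apply: braid_eq_cat (braid_eq_refl _).
apply: braid_eq_trans (braid_eq_mulVw u).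
by apply: braid_eq_cat (braid_eq_refl _) (braid_eq_sym uv).
Qed.

Definition braid_mul (n : nat) (a b : braid n) : braid n :=
  braid_of (repr a ++ repr b).
Definition braid_one (n : nat) : braid n := braid_of [::].
Definition braid_inv (n : nat) (a : braid n) : braid n :=
  braid_of (bword_inv (repr a)).

Lemma braid_mul_of n (u v : bword n) :
  braid_mul (braid_of u) (braid_of v) = braid_of (u ++ v).
Proof. by apply/braid_ofP; apply: braid_eq_cat; apply: repr_braid_of. Qed.

Lemma braid_inv_of n (u : bword n) :
  braid_inv (braid_of u) = braid_of (bword_inv u).
Proof. by apply/braid_ofP/braid_eq_invw/repr_braid_of. Qed.

Lemma braid_mulA n : associative (@braid_mul n).
Proof.
move=> a b c; rewrite -[a]braid_of_repr -[b]braid_of_repr -[c]braid_of_repr.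
by rewrite !braid_mul_of catA.
Qed.

Lemma braid_mul1 n : left_id (@braid_one n) (@braid_mul n).
Proof. by move=> a; rewrite -[a]braid_of_repr braid_mul_of. Qed.

Lemma braid_mulr1 n : right_id (@braid_one n) (@braid_mul n).
Proof. by move=> a; rewrite -[a]braid_of_repr braid_mul_of cats0. Qed.

Lemma braid_mulV n : left_inverse (@braid_one n) (@braid_inv n) (@braid_mul n).
Proof.
move=> a; rewrite -[a]braid_of_repr braid_inv_of braid_mul_of.
exact/braid_ofP/braid_eq_mulVw.
Qed.

Lemma braid_mulrV n : right_inverse (@braid_one n) (@braid_inv n) (@braid_mul n).
Proof.
move=> a; rewrite -[a]braid_of_repr braid_inv_of braid_mul_of.
exact/braid_ofP/braid_eq_mulwV.
Qed.

HB.instance Definition _ n := isGroup.Build (braid n)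
  (@braid_mulA n) (@braid_mul1 n) (@braid_mulr1 n) (@braid_mulV n)
  (@braid_mulrV n).

Definition braid_conjugate (n : nat) (a b : braid n) : Prop :=
  exists x : braid n, b = (a ^ x)%g.

(* As [(s * t) x = t (s x)] in ['S_n] and words are read from left to right,
   [bword_perm w j] is the endpoint of the string of [w] beginning at [j]. *)
Definition bword_perm (n : nat) (w : bword n) : 'S_n :=
  (\prod_(a <- w) tperm (lpos a.1) (rpos a.1))%g.

Lemma bword_perm_cat n (u v : bword n) :
  bword_perm (u ++ v) = (bword_perm u * bword_perm v)%g.
Proof. exact: big_cat. Qed.

Lemma bword_perm_eq n (u v : bword n) :
  braid_eq u v -> bword_perm u = bword_perm v.
Proof.
elim=> {u v} [//|//|u v w _ -> _ ->//|u u' v v' _ e _ e'|a|i j ij|i j ij].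
- by rewrite !bword_perm_cat e e'.
- by rewrite /bword_perm !big_cons big_nil /= mulg1 tperm2.
- rewrite /bword_perm !big_cons big_nil /= !mulg1 conjgC tpermJ !tpermD //;
    rewrite -val_eqE /=; lia.
- have e : lpos j = rpos i by apply: val_inj; rewrite /= ij.
  have d12 : lpos i != rpos i by rewrite -val_eqE /= neq_ltn leqnn.
  have d23 : rpos i != rpos j by rewrite -val_eqE /= ij neq_ltn leqnn.
  have d13 : lpos i != rpos j by rewrite -val_eqE /= ij neq_ltn leqnSn.
  rewrite /bword_perm !big_cons big_nil /= !mulg1 e.
  have h (s t : 'S_n) : (s * (t * s) = t ^ s^-1 * (s * s))%g.
    by rewrite conjgE invgK !mulgA mulgKV.
  by rewrite !h !tperm2 !mulg1 !tpermV !tpermJ tpermR tpermL !tpermD // eq_sym.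
Qed.

Definition braid_perm (n : nat) (b : braid n) : 'S_n := bword_perm (repr b).

Lemma braid_perm_of n (w : bword n) : braid_perm (braid_of w) = bword_perm w.
Proof. exact/bword_perm_eq/repr_braid_of. Qed.

Lemma braid_permM n :
  {morph @braid_perm n : a b / (a * b)%g >-> (a * b)%g}.
Proof. by move=> a b; rewrite braid_perm_of bword_perm_cat. Qed.

HB.instance Definition _ n :=
  isMultiplicative.Build (braid n) 'S_n (@braid_perm n) (@braid_permM n).

(* The cycle [(a_1 a_2 ... a_m)] of ['S_n.+1], with the [a_k] numbered from 1. *)
Definition cycle_fun (n : nat) (s : seq nat) : 'I_n.+1 -> 'I_n.+1 :=
  next [seq inord a.-1 | a <- s].

Definition posword (n : nat) (w : seq 'I_n.-1) : bword n :=
  [seq (i, true) | i <- w].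

(* Number of crossings in the positive word [w] between the strings beginning
   at the positions [a] and [b]. *)
Fixpoint crossings (n : nat) (w : seq 'I_n.-1) (a b : 'I_n) : nat :=
  if w is i :: w' then
    (([set a; b] == [set lpos i; rpos i])%SET
     + crossings w' (tperm (lpos i) (rpos i) a) (tperm (lpos i) (rpos i) b))%N
  else 0%N.

Definition positive_permutation_braid (n : nat) (b : braid n) : Prop :=
  exists2 w : seq 'I_n.-1, b = braid_of (posword w) &
    forall x y : 'I_n, x != y -> (crossings w x y <= 1)%N.

(* C is encoded as [R * R], and S^3 is the unit sphere of C^2. *)

Section Links.
Context (R : realType).
Local Notation C2 := ((R * R) * (R * R))%type.

Definition sphere1 : set (R * R) := [set z | z.1 ^+ 2 + z.2 ^+ 2 = 1].

Definition sphere3 : set C2 :=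
  [set z | z.1.1 ^+ 2 + z.1.2 ^+ 2 + (z.2.1 ^+ 2 + z.2.2 ^+ 2) = 1].

Definition homeo_on (T U : topologicalType) (A : set T) (B : set U)
    (f : T -> U) : Prop :=
  exists g : U -> T,
    [/\ {within A, continuous f}, {within B, continuous g},
        {homo f : x / A x >-> B x}, {homo g : y / B y >-> A y} &
        {in A, cancel f g} /\ {in B, cancel g f}].

Definition is_knot (K : set C2) : Prop :=
  K `<=` sphere3 /\ exists f : R * R -> C2, homeo_on sphere1 K f.

(* Ambient isotopy of S^3, carrying [K] to [L] as unoriented links. *)
Definition isotopic (K L : set C2) : Prop :=
  exists H : R -> C2 -> C2,
    [/\ {within `[0, 1]%classic `*` sphere3,
           continuous (fun p : R * C2 => H p.1 p.2)},
        forall t, t \in `[0, 1] -> homeo_on sphere3 sphere3 (H t),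
        {in sphere3, H 0 =1 id} &
        H 1 @` K = L].

(* The word [w] is realized over the times [0, size w], the k-th letter (from
   0) being performed during [k, k + 1].  For a letter of index i the
   strings at the (0-based) positions i and i + 1 exchange by half a turn of
   the plane about their midpoint, counterclockwise for a generator and
   clockwise for an inverse. *)
Definition letter_path (n : nat) (a : bletter n) (j : 'I_n) (t : R) : R * R :=
  let c : R := (a.1 : nat)%:R + 2^-1 in
  let e : R := if a.2 then 1 else -1 in
  if j == lpos a.1 then
    (c - 2^-1 * cos (pi * t), - (e * 2^-1 * sin (pi * t)))
  else if j == rpos a.1 then
    (c + 2^-1 * cos (pi * t), e * 2^-1 * sin (pi * t))
  else ((j : nat)%:R, 0).

(* The position at time [t] of the string of [w] beginning at [j]; it is
   constant from the time [size w] on. *)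
Fixpoint string_path (n : nat) (w : bword n) (j : 'I_n) (t : R) : R * R :=
  if w is a :: w' then
    if t <= 1 then letter_path a j t
    else string_path w' (tperm (lpos a.1) (rpos a.1) j) (t - 1)
  else ((j : nat)%:R, 0).

(* The homeomorphism of C x S^1 onto the complement in S^3 of the axis
   [C x {0}]: [(p, q) |-> (p, q) / sqrt (1 + |p|^2)]. *)
Definition torus_emb (p q : R * R) : C2 :=
  let r := Num.sqrt (1 + (p.1 ^+ 2 + p.2 ^+ 2)) in
  ((p.1 / r, p.2 / r), (q.1 / r, q.2 / r)).

(* The times run over [0, size w + 1], wrapped once around S^1; during the last
   unit of time every string is constant, so the word may be empty. *)
Definition closure_bword (n : nat) (w : bword n) : set C2 :=
  [set z | exists (j : 'I_n) (t : R),
     t \in `[0, (size w).+1%:R] /\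
     let theta := 2 * pi * t / (size w).+1%:R in
     z = torus_emb (string_path w j t) (cos theta, sin theta)].

(* [L] is a closure of [b]: a link defined by [b] up to isotopy only, with one
   representative for each word for [b]. *)
Definition is_closure (n : nat) (b : braid n) (L : set C2) : Prop :=
  exists2 w : bword n, b = braid_of w & L = closure_bword w.

End Links.

(* Main.v *)
(** A loop of displacement fields on C, small and with small Lipschitz constant, gives
    a family of maps (z1, z2) |-> (z1 + D(z1, z2), z2) homogeneous of degree one
    under positive dilations, whose radial normalization is an isotopy of S^3.
    Taking D to be a sum of tent functions carried by the strings shows that a
    homotopy of a closed braid through disjoint strings is an ambient isotopy, so
    the closure depends on the conjugacy class only: rotations of words and the
    braid relations are realized by explicit homotopies.
    For Markov stabilization, the last string is swung out to a large radius,
    where the extra crossing becomes one turn of a helix around the axis of the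
    closed braid.  After exchanging the two coordinates of C^2 the helix is a
    single strand running in a disc, and it can be straightened.

    A positive permutation braid is determined by its permutation, so beta and
    gamma are explicit words.  Both are conjugate to stabilizations of 5-string
    braids, and those are conjugate to each other.  On the other hand each Fox
    3-colouring of the strings fixed by beta^2 is constant, whereas gamma^2 fixes
    a nonconstant one. *)

Require Import Defs.
From mathcomp Require Import all_boot all_order all_fingroup all_algebra.
From mathcomp Require Import zify ring lra.
From mathcomp Require Import all_classical all_reals all_analysis.
Set Implicit Arguments.
Unset Strict Implicit.
Unset Printing Implicit Defensive.
Import Order.TTheory GRing.Theory Num.Theory.
Import numFieldNormedType.Exports.
Local Open Scope classical_set_scope.
Local Open Scope ring_scope.

(** Three obstacles shape the proof. An ambient isotopy has to be defined on all of S^3, but the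
    polar angle of z2 is undefined on the circle z2 = 0. Displacements of degree one vanish there
    and, commuting with dilations, descend to the sphere. No time-dependent field is integrated: a
    push moves points along straight segments and is known to be invertible only when it is short,
    so nearby stages of a homotopy are compared and [0, 1] is covered by connectedness. Homotopies
    of closed braids keep the number of strings. The strand theorem is therefore stated for a part
    of a link lying over a set of angles, the rest being fixed; after the exchange of coordinates it
    applies to one arc of a link that need not be braided around the new axis. Finally, the
    colourings fixed by a braid itself are the 3-colourings of its closure, equally many for
    isotopic closures, so they cannot separate [beta] from [gamma]. Those fixed by the square are
    again a conjugacy invariant, but they belong to the closure of another braid. *)

Section Continuity.
Context {R : realType} {T : topologicalType}.
Implicit Types (f g : T -> R) (x : T).

Lemma cat_cst {U : topologicalType} (c : U) x : continuous_at x (fun _ : T => c).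
Proof. exact: cst_continuous. Qed.
Lemma cat_id x : continuous_at x (fun y : T => y).
Proof. exact: cvg_id. Qed.
Lemma catD f g x : continuous_at x f -> continuous_at x g ->
  continuous_at x (fun y => f y + g y).
Proof. by move=> *; apply: (@continuousD R R^o). Qed.
Lemma catN f x : continuous_at x f -> continuous_at x (fun y => - f y).
Proof. by move=> *; apply: (@continuousN R R^o). Qed.
Lemma catM f g x : continuous_at x f -> continuous_at x g ->
  continuous_at x (fun y => f y * g y).
Proof. by move=> *; apply: continuousM. Qed.
Lemma catX f n x : continuous_at x f -> continuous_at x (fun y => f y ^+ n).
Proof.
move=> cf; elim: n => [|n IH]; first exact: cat_cst.
rewrite (_ : (fun y => f y ^+ n.+1) = (fun y => f y * f y ^+ n)); first exact: catM.
by apply/funext => y; rewrite exprS.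
Qed.
Lemma catV f x : f x != 0 -> continuous_at x f -> continuous_at x (fun y => (f y)^-1).
Proof. by move=> *; apply: continuousV. Qed.
Lemma catcomp {U V : topologicalType} (h : T -> U) (k : U -> V) x :
  continuous_at (h x) k -> continuous_at x h -> continuous_at x (fun y => k (h y)).
Proof. by move=> *; apply: continuous_comp. Qed.
Lemma cat_max f g x : continuous_at x f -> continuous_at x g ->
  continuous_at x (fun y => Num.max (f y) (g y)).
Proof. by move=> *; apply: continuous_max. Qed.
Lemma cat_min f g x : continuous_at x f -> continuous_at x g ->
  continuous_at x (fun y => Num.min (f y) (g y)).
Proof. by move=> *; apply: continuous_min. Qed.
Lemma cat_norm f x : continuous_at x f -> continuous_at x (fun y => `|f y|).
Proof. by move=> cf; apply: catcomp cf; exact: (@norm_continuous R R^o). Qed.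
Lemma cat_sqrt f x : continuous_at x f -> continuous_at x (fun y => Num.sqrt (f y)).
Proof. by move=> cf; apply: catcomp cf; exact: sqrt_continuous. Qed.
Lemma cat_cos f x : continuous_at x f -> continuous_at x (fun y => cos (f y)).
Proof. by move=> cf; apply: catcomp cf; exact: continuous_cos. Qed.
Lemma cat_sin f x : continuous_at x f -> continuous_at x (fun y => sin (f y)).
Proof. by move=> cf; apply: catcomp cf; exact: continuous_sin. Qed.
Lemma cat_pair {U V : topologicalType} (f : T -> U) (g : T -> V) x :
  continuous_at x f -> continuous_at x g -> continuous_at x (fun y => (f y, g y)).
Proof. by move=> cf cg; exact: cvg_pair. Qed.
Lemma cat_fst {U V : topologicalType} (f : T -> U * V) x :
  continuous_at x f -> continuous_at x (fun y => (f y).1).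
Proof. by move=> cf; apply: catcomp cf; exact: cvg_fst. Qed.
Lemma cat_snd {U V : topologicalType} (f : T -> U * V) x :
  continuous_at x f -> continuous_at x (fun y => (f y).2).
Proof. by move=> cf; apply: catcomp cf; exact: cvg_snd. Qed.
Lemma cat_sum (I : Type) (r : seq I) (f : I -> T -> R) x :
  (forall i, continuous_at x (f i)) ->
  continuous_at x (fun y => \sum_(i <- r) f i y).
Proof.
move=> cf; elim: r => [|i r IH].
  rewrite (_ : (fun y => _) = (fun _ => 0)); first exact: cat_cst.
  by apply/funext => y; rewrite big_nil.
rewrite (_ : (fun y => _) = (fun y => f i y + \sum_(i <- r) f i y)); first exact: catD.
by apply/funext => y; rewrite big_cons.
Qed.
End Continuity.

Ltac conthyp := first [ assumption
  | match goal with H : continuous _ |- _ => solve [exact: H] end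
  | match goal with H : forall _, continuous _ |- _ => solve [exact: H] end
  | match goal with H : forall _ _, continuous _ |- _ => solve [exact: H] end ].
Ltac cont1 := lazymatch goal with
  | |- continuous_at _ (fun y => y) => apply: cat_id
  | |- continuous_at _ (fun y => @?f y + @?g y) => apply: (catD (f := f) (g := g))
  | |- continuous_at _ (fun y => - @?f y) => apply: (catN (f := f))
  | |- continuous_at _ (fun y => @?f y * @?g y) => apply: (catM (f := f) (g := g))
  | |- continuous_at _ (fun y => @?f y ^+ ?n) => apply: (catX (f := f))
  | |- continuous_at _ (fun y => Num.max (@?f y) (@?g y)) =>
      apply: (cat_max (f := f) (g := g))
  | |- continuous_at _ (fun y => Num.min (@?f y) (@?g y)) =>
      apply: (cat_min (f := f) (g := g))
  | |- continuous_at _ (fun y => `|@?f y|) => apply: (cat_norm (f := f))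
  | |- continuous_at _ (fun y => Num.sqrt (@?f y)) => apply: (cat_sqrt (f := f))
  | |- continuous_at _ (fun y => cos (@?f y)) => apply: (cat_cos (f := f))
  | |- continuous_at _ (fun y => sin (@?f y)) => apply: (cat_sin (f := f))
  | |- continuous_at _ (fun y => (@?f y, @?g y)) => apply: (cat_pair (f := f) (g := g))
  | |- continuous_at _ (fun y => (@?f y).1) => first [conthyp | apply: (cat_fst (f := f))]
  | |- continuous_at _ (fun y => (@?f y).2) => first [conthyp | apply: (cat_snd (f := f))]
  | |- continuous_at _ (fun y => \sum_(i <- _) _) => apply: cat_sum => ?
  | |- continuous_at _ (fun y => ?g (@?f y)) =>
      first [conthyp | apply: cat_cst | apply: (catcomp (k := g) (h := f)); [solve [conthyp]|]]
  | |- _ => first [apply: cat_cst | conthyp]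
  end.
Ltac cont := repeat cont1.

Section Within.
Context {T U V : topologicalType}.

Lemma within_comp (A : set T) (B : set U) (f : T -> U) (g : U -> V) h :
  {homo f : x / A x >-> B x} -> {within A, continuous f} ->
  {within B, continuous g} -> h =1 (fun x => g (f x)) ->
  {within A, continuous h}.
Proof.
move=> fAB /subspace_continuousP cf /subspace_continuousP cg /funext ->.
apply/subspace_continuousP => x Ax.
apply: (@cvg_comp _ _ _ f g _ (within B (nbhs (f x)))); last exact/cg/fAB.
move=> W /(cf x Ax); rewrite /nbhs /= /within /=; apply: filterS => y + Ay.
by move=> /(_ Ay); apply; exact: fAB.
Qed.

Lemma within_cont (A : set T) (f : T -> U) :
  (forall x, A x -> continuous_at (x : subspace A) (f : subspace A -> U)) ->
  {within A, continuous f}.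
Proof. by move=> h; rewrite continuous_subspace_in => x /set_mem /h. Qed.

Lemma within_pair (A : set T) (f : T -> U) (g : T -> V) :
  {within A, continuous f} -> {within A, continuous g} ->
  {within A, continuous (fun x => (f x, g x))}.
Proof. by move=> cf cg x; apply: cat_pair; [exact: cf|exact: cg]. Qed.

(** A continuous map from a compact space to a Hausdorff space is closed, hence a quotient map onto
    its image. This is how maps defined through the discontinuous polar angle are shown to be
    continuous. *)
Lemma compact_quotient (A : set T) (e : T -> U) (f : U -> V) :
  hausdorff_space U -> compact A -> {within A, continuous e} ->
  {within A, continuous (fun x => f (e x))} -> {within e @` A, continuous f}.
Proof.
move=> hU cA ce /continuous_closedP cfe; apply/continuous_closedP => D clD.
apply/closed_subspaceP.
have [W clW WE] := (closed_subspaceP _ _).1 (cfe D clD).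
exists (e @` (W `&` A)).
  apply: compact_closed => //; apply: continuous_compact.
    apply: continuous_subspaceW ce; exact: subIsetr.
  rewrite setIC; apply: compact_closedI => //.
rewrite WE eqEsubset; split=> [y [[x [fx Ax] <-] _]|y [fy [x Ax xy]]] /=.
  by split=> //; exists x.
split; last by exists x.
exists x => //; split=> //.
by have := fy; rewrite -xy.
Qed.

End Within.

(** The inverse [g] comes from choice, with [x0] as its value off [B]; it is continuous on [B] by
    [compact_quotient], since [g] after [f] is the identity of [A]. *)
Lemma homeo_on_compact {T U : topologicalType} (x0 : T) (A : set T) (B : set U)
    (f : T -> U) :
  hausdorff_space U -> compact A -> {within A, continuous f} ->
  {in A &, injective f} -> f @` A = B -> homeo_on A B f.
Proof.
move=> hU cA cf fi fAB.
have fP y : exists x, B y -> A x /\ f x = y.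
  have [By|nBy] := pselect (B y); last by exists x0.
  by move: (By); rewrite -fAB => -[x Ax xy]; exists x.
have [g gP] := choice fP.
have gf x : A x -> g (f x) = x.
  move=> Ax; have [|Ag fg] := gP (f x); first by rewrite -fAB; exists x.
  by apply: fi => //; exact/mem_set.
exists g; split=> //.
- rewrite -fAB; apply: compact_quotient => //.
  refine (@subspace_eq_continuous T A T (fun x => x) (fun x => g (f x)) _ _).
    by move=> x /set_mem Ax /=; rewrite gf.
  by apply: continuous_subspaceT => x; exact: cvg_id.
- by move=> x Ax; rewrite -fAB; exists x.
- by move=> y /gP[].
- by split=> [x /set_mem /gf//|y /set_mem /gP[]].
Qed.

(** * Isotopies of the 3-sphere *)

Section Isotopy.
Context {R : realType}.
Local Notation C := (R * R)%type.
Local Notation C2 := ((R * R) * (R * R))%type.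
Local Notation S3 := (@sphere3 R).

Lemma closed_level {T : topologicalType} (f : T -> R) (D : set R) :
  continuous f -> closed D -> closed (f @^-1` D).
Proof. by move=> cf; move/continuous_closedP : cf; apply. Qed.

Lemma sqr_le1 (x : R) : x ^+ 2 <= 1 -> -1 <= x <= 1.
Proof. by move=> h; rewrite -ler_norml -(@ler_pXn2r _ 2) ?nnegrE// real_normK ?num_real// expr1n. Qed.

Lemma compact_sphere3 : compact S3.
Proof.
pose I : set R := `[-1, 1]%classic.
have cI : compact I by exact: segment_compact.
rewrite (_ : S3 = ((I `*` I) `*` (I `*` I)) `&` S3).
  apply: compact_closedI; first by do !apply: compact_setX.
  apply: (@closed_level _ (fun z : C2 => z.1.1 ^+ 2 + z.1.2 ^+ 2 + (z.2.1 ^+ 2 + z.2.2 ^+ 2)) [set 1]).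
    by move=> z; cont.
  exact: closed_eq.
rewrite setIC; apply/esym/setIidPl => -[[a b] [c d]]; rewrite /sphere3 /I /= => h.
have := sqr_ge0 a; have := sqr_ge0 b; have := sqr_ge0 c; have := sqr_ge0 d => *.
by split; split; rewrite /= in_itv /=; apply: sqr_le1; lra.
Qed.

Lemma isotopic_refl (K : set C2) : isotopic K K.
Proof.
exists (fun _ z => z); split=> //.
- by apply: continuous_subspaceT => z; exact: cvg_snd.
- by move=> t _; exists id; split=> //; apply: continuous_subspaceT => x; exact: cvg_id.
- by rewrite image_id.
Qed.

Lemma isotopic_trans (K L M : set C2) : isotopic K L -> isotopic L M -> isotopic K M.
Proof.
move=> [H [cH hH H0 H1]] [G [cG hG G0 G1]].
have HS t z : t \in `[0, 1] -> S3 z -> S3 (H t z).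
  by move=> /hH[g [_ _ h _ _]] Sz; exact: h.
exists (fun t z => G t (H t z)); split.
- apply: (@within_comp _ _ _ _ (`[(0:R), 1]%classic `*` S3)
    (fun p : R * C2 => (p.1, H p.1 p.2)) (fun p : R * C2 => G p.1 p.2)) => //.
    by move=> [t z] [/= tI Sz]; split=> //=; exact: HS.
  apply: within_pair => //.
  by apply: continuous_subspaceT => z; exact: cvg_fst.
- move=> t tI; have [g [cHt cg h1 h2 [h3 h4]]] := hH t tI.
  have [k [cGt ck k1 k2 [k3 k4]]] := hG t tI.
  exists (fun z => g (k z)); split.
  + exact: (within_comp h1 cHt cGt).
  + exact: (within_comp k2 ck cg).
  + by move=> z /h1/k1.
  + by move=> z /k2/h2.
  + split=> z /set_mem Sz.
      by rewrite k3 ?h3 //; apply/mem_set => //; exact: h1.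
    by rewrite h4 ?k4 //; apply/mem_set => //; exact: k2.
- move=> z Sz; rewrite G0 ?H0 //.
- by rewrite -G1 -H1 -image_comp.
Qed.

(** Time is reversed after undoing the final homeomorphism. As [H 0] is the identity only on the
    sphere, [K] has to lie in it. *)
Lemma isotopic_sym (K L : set C2) : K `<=` S3 -> isotopic K L -> isotopic L K.
Proof.
move=> KS [H [cH hH H0 H1]].
have [g [cH1 cg h1 h2 [h3 h4]]] := hH 1 ltac:(by rewrite in_itv /= lexx ler01).
have I1 (t : R) : t \in `[0, 1] -> 1 - t \in `[0, 1] by rewrite !in_itv /=; lra.
exists (fun t z => H (1 - t) (g z)); split.
- apply: (@within_comp _ _ _ (`[(0:R), 1]%classic `*` S3) (`[(0:R), 1]%classic `*` S3)
    (fun p : R * C2 => (1 - p.1, g p.2)) (fun p : R * C2 => H p.1 p.2)) => //.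
    by move=> [t z] [/= tI Sz]; split=> /=; [exact: I1|exact: h2].
  apply: within_pair.
    apply: continuous_subspaceT => z; cont.
  apply: (within_comp (f := snd) _ _ cg) => //; first by move=> z [].
  by apply: continuous_subspaceT => z; exact: cvg_snd.
- move=> t /I1 /hH [k [ck1 ck2 k1 k2 [k3 k4]]].
  exists (fun z => H 1 (k z)); split.
  + exact: (within_comp h2 cg ck1).
  + exact: (within_comp k2 ck2 cH1).
  + by move=> z /h2/k1.
  + by move=> z /k2/h1.
  + split=> z /set_mem Sz.
      by rewrite k3 ?h4 //; apply/mem_set => //; exact: h2.
    by rewrite h3 ?k4 //; apply/mem_set => //; exact: k2.
- by move=> z Sz; rewrite subr0 h4.
- rewrite subrr -H1 eqEsubset; split=> [_ [_ [z Kz <-] <-]|z Kz].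
    by rewrite h3 ?H0 //; apply/mem_set/KS.
  exists (H 1 z); first by exists z.
  by rewrite h3 ?H0 //; apply/mem_set/KS.
Qed.

Definition swapC (z : C2) : C2 := (z.2, z.1).

Lemma swapCK : involutive swapC. Proof. by case. Qed.

Lemma swapC_sphere z : S3 z -> S3 (swapC z).
Proof. by rewrite /sphere3 /= addrC. Qed.

(** Conjugation of an isotopy by the exchange of coordinates. A strand winding around one axis
    circle can thus be treated as a strand running over an arc of angles of the other coordinate. *)
Lemma isotopic_swap (K L : set C2) :
  isotopic (swapC @` K) (swapC @` L) -> isotopic K L.
Proof.
move=> [H [cH hH H0 H1]].
have cs (A : set C2) : {within A, continuous swapC}.
  by apply: continuous_subspaceT => z; apply: cat_pair; [exact: cvg_snd|exact: cvg_fst].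
have sS := swapC_sphere.
exists (fun t z => swapC (H t (swapC z))); split.
- apply: (@within_comp _ _ _ _ S3 (fun p : R * C2 => H p.1 (swapC p.2)) swapC) => //.
    by move=> [t z] [/= /hH[g [_ _ h _ _]] Sz]; exact/h/sS.
  apply: (@within_comp _ _ _ _ (`[(0:R), 1]%classic `*` S3)
    (fun p : R * C2 => (p.1, swapC p.2)) (fun p : R * C2 => H p.1 p.2)) => //.
    by move=> [t z] [/= tI Sz]; split=> //=; exact: sS.
  by apply: continuous_subspaceT => z; rewrite /swapC; cont.
- move=> t /hH[g [h1 h2 h3 h4 [h5 h6]]].
  exists (fun z => swapC (g (swapC z))); split.
  + have c1 := @within_comp _ _ _ S3 S3 swapC (H t) _ sS (cs S3) h1 (fun=> erefl).
    apply: (@within_comp _ _ _ S3 S3 (fun z => H t (swapC z)) swapC _ _ c1 (cs S3) (fun=> erefl)).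
    by move=> z /sS/h3.
  + have c2 := @within_comp _ _ _ S3 S3 swapC g _ sS (cs S3) h2 (fun=> erefl).
    apply: (@within_comp _ _ _ S3 S3 (fun z => g (swapC z)) swapC _ _ c2 (cs S3) (fun=> erefl)).
    by move=> z /sS/h4.
  + by move=> z /sS/h3/sS.
  + by move=> z /sS/h4/sS.
  + by split=> z /set_mem/sS Sz; rewrite swapCK ?h5 ?h6 ?swapCK//; exact/mem_set.
- by move=> z /set_mem/sS Sz; rewrite H0 ?swapCK//; exact/mem_set.
- have : swapC @` (H 1 @` (swapC @` K)) = swapC @` (swapC @` L) by rewrite H1.
  rewrite !image_comp => ->; rewrite -[RHS]image_id; apply: eq_imagel => z _ /=.
  exact: swapCK.
Qed.

End Isotopy.

(** * Angles measured in turns, polar coordinates, radial normalization *)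

Section Coordinates.
Context {R : realType}.
Local Notation C := (R * R)%type.
Local Notation C2 := ((R * R) * (R * R))%type.
Local Notation S3 := (@sphere3 R).
Implicit Types (x y v : C) (z : C2) (u s t : R).

Definition turn u : C := (cos (2 * pi * u), sin (2 * pi * u)).

Lemma continuous_turn : continuous turn.
Proof. by move=> u; rewrite /turn; cont. Qed.

Lemma turn_norm u : (turn u).1 ^+ 2 + (turn u).2 ^+ 2 = 1.
Proof. exact: cos2Dsin2. Qed.

Lemma turnD1 u : turn (u + 1) = turn u.
Proof.
by rewrite /turn mulrDr mulr1 -[2 * pi]/(2%:R * pi) mulr_natl cosD2pi sinD2pi.
Qed.

Lemma turn0 : turn 0 = (1, 0).
Proof. by rewrite /turn mulr0 cos0 sin0. Qed.

Lemma turn1 : turn 1 = turn 0.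
Proof. by rewrite -[1]add0r turnD1. Qed.

Lemma turn_half u : turn (u + 2^-1) = (- (turn u).1, - (turn u).2).
Proof.
rewrite /turn (_ : 2 * pi * (u + 2^-1) = 2 * pi * u + pi); last by field.
by rewrite cosDpi sinDpi.
Qed.

(** Equal points make the cosine of the difference of angles 1, so the sine of half that difference
    vanishes, whereas sine is positive on (0, pi). *)
Lemma turn_eq u s : 0 <= u < 1 -> 0 <= s < 1 -> turn u = turn s -> u = s.
Proof.
move=> u01 s01 [ec es]; apply/eqP; apply: contraT => us.
have pi0 := pi_gt0 R.
have c1 : cos (2 * pi * (u - s)) = 1.
  by rewrite mulrBr cosB ec es -!expr2 cos2Dsin2.
have s0 : sin (pi * (u - s)) = 0.
  have : cos (2 * pi * (u - s)) = cos ((pi * (u - s)) *+ 2).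
    by congr cos; rewrite mulr2n; ring.
  rewrite c1 cos_mulr2n cos2sin2 => h.
  by apply/eqP; rewrite -sqrf_eq0; apply/eqP; lra.
have [us0|us0|us0] := ltgtP u s.
- have : 0 < sin (pi * (s - u)) by apply: sin_gt0_pi; nra.
  by rewrite (_ : pi * (s - u) = - (pi * (u - s))) ?sinN ?s0; [lra|ring].
- have : 0 < sin (pi * (u - s)) by apply: sin_gt0_pi; nra.
  by rewrite s0 ltxx.
- by rewrite us0 eqxx in us.
Qed.

Lemma turn_eq01 u s : 0 <= u <= 1 -> 0 <= s <= 1 -> turn u = turn s ->
  [\/ u = s, u = 0 /\ s = 1 | u = 1 /\ s = 0].
Proof.
move=> u01 s01 us.
have [u1|u1] := eqVneq u 1; have [s1|s1] := eqVneq s 1.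
- by rewrite u1 s1; constructor.
- rewrite u1 turn1 in us *; constructor 3; split=> //; apply/esym/turn_eq => //; lra.
- rewrite s1 turn1 in us *; constructor 2; split=> //; apply/turn_eq => //; lra.
- by constructor; apply: turn_eq => //; lra.
Qed.

Lemma turn_surj v : v.1 ^+ 2 + v.2 ^+ 2 = 1 -> exists2 u, 0 <= u < 1 & v = turn u.
Proof.
case: v => a b /= ab; have a1 : -1 <= a <= 1 by apply: sqr_le1; have := sqr_ge0 b; lra.
have pi0 := pi_gt0 R.
have aI : a \in `[(-1), 1] by rewrite in_itv.
have ca := acosK aI; have sa := sin_acos a1.
have b2 : 1 - a ^+ 2 = b ^+ 2 by lra.
rewrite b2 sqrtr_sqr in sa.
have [b0|b0] := leP 0 b.
  exists (acos a / (2 * pi)).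
    rewrite divr_ge0 ?acos_ge0 //=; last by lra.
    by rewrite ltr_pdivrMr; have := acos_lepi a1; lra.
  rewrite /turn mulrCA divff ?mulr1 ?ca ?sa ?ger0_norm //; lra.
exists (1 - acos a / (2 * pi)).
  have a0 : 0 < acos a.
    by apply: acos_gt0; move: a1; rewrite !lt_neqAle andbC => /andP[-> ->];
       rewrite !andbT; apply/eqP => e; move: ab; rewrite e; nra.
  rewrite subr_ge0 ler_pdivrMr ?ltrBlDr ?ltrDl ?divr_gt0 ?andbT //; try lra.
  by have := acos_lepi a1; lra.
rewrite /turn (_ : 2 * pi * _ = - acos a + pi *+ 2); last first.
  rewrite -mulr_natl; field; lra.
by rewrite cosD2pi sinD2pi cosN sinN ca sa ltr0_norm ?opprK.
Qed.

Definition scl (a : R) z : C2 := ((a * z.1.1, a * z.1.2), (a * z.2.1, a * z.2.2)).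
Definition nsq z : R := z.1.1 ^+ 2 + z.1.2 ^+ 2 + (z.2.1 ^+ 2 + z.2.2 ^+ 2).
Definition nrm z : C2 := scl (Num.sqrt (nsq z))^-1 z.

Lemma nsq_scl a z : nsq (scl a z) = a ^+ 2 * nsq z.
Proof. by rewrite /nsq /scl /=; ring. Qed.

Lemma nsq_ge0 z : 0 <= nsq z.
Proof. by rewrite !addr_ge0 ?sqr_ge0. Qed.

Lemma nsq_eq0 z : nsq z = 0 -> z = ((0, 0), (0, 0)).
Proof.
case: z => -[a b] [c d]; rewrite /nsq /= => h.
have := sqr_ge0 a; have := sqr_ge0 b; have := sqr_ge0 c; have := sqr_ge0 d.
move=> *; by repeat congr (_, _); apply/eqP; rewrite -sqrf_eq0; apply/eqP; lra.
Qed.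

Lemma nsq_gt0 z : z.2 != (0, 0) -> 0 < nsq z.
Proof.
move=> z0; rewrite lt_neqAle nsq_ge0 andbT eq_sym; apply: contraNneq z0.
by move/nsq_eq0 => ->.
Qed.

Lemma scl_scl a b z : scl a (scl b z) = scl (a * b) z.
Proof. by rewrite /scl /= !mulrA. Qed.

Lemma scl1 z : scl 1 z = z.
Proof. by case: z => -[a b] [c d]; rewrite /scl /= !mul1r. Qed.

Lemma nrm_sphere z : 0 < nsq z -> S3 (nrm z).
Proof.
move=> z0; rewrite /sphere3 /= -[LHS]/(nsq (nrm z)) nsq_scl exprVn sqr_sqrtr ?ltW //.
by rewrite mulVf // gt_eqF.
Qed.

Lemma nrm_scl a z : 0 < a -> nrm (scl a z) = nrm z.
Proof.
move=> a0; rewrite /nrm nsq_scl sqrtrM ?sqr_ge0 // sqrtr_sqr gtr0_norm // scl_scl.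
by rewrite invfM mulrAC mulVf ?mul1r // gt_eqF.
Qed.

Lemma nrm_id z : S3 z -> nrm z = z.
Proof. by rewrite /sphere3 /= -/(nsq z) /nrm => ->; rewrite sqrtr1 invr1 scl1. Qed.

Lemma nrm_inj z z' : 0 < nsq z -> 0 < nsq z' -> nrm z = nrm z' ->
  exists2 a, 0 < a & z' = scl a z.
Proof.
move=> z0 z'0 e; exists (Num.sqrt (nsq z') / Num.sqrt (nsq z)).
  by rewrite divr_gt0 ?sqrtr_gt0.
rewrite -scl_scl -/(nrm z) e /nrm scl_scl divff ?scl1 //.
by rewrite gt_eqF ?sqrtr_gt0.
Qed.

(** The embedding used for closures is the radial projection of the slice where the second
    coordinate has modulus one; a map commuting with positive dilations can be computed in that
    slice. *)
Lemma torus_embE x u : torus_emb x (turn u) = nrm (x, turn u).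
Proof.
rewrite /torus_emb /nrm /nsq /= turn_norm addrC /scl /=.
by rewrite ![_^-1 * _]mulrC.
Qed.

Lemma nsq_turn x u : 0 < nsq (x, turn u).
Proof. by rewrite /nsq /= turn_norm; have := sqr_ge0 x.1; have := sqr_ge0 x.2; lra. Qed.

Definition mag v := Num.sqrt (v.1 ^+ 2 + v.2 ^+ 2).

Lemma mag_ge0 v : 0 <= mag v. Proof. exact: sqrtr_ge0. Qed.

Lemma mag_sqr v : mag v ^+ 2 = v.1 ^+ 2 + v.2 ^+ 2.
Proof. by rewrite sqr_sqrtr // addr_ge0 ?sqr_ge0. Qed.

Lemma mag_eq0 v : mag v = 0 -> v = (0, 0).
Proof.
case: v => a b h; have := mag_sqr (a, b); rewrite h /= => e.
have := sqr_ge0 a; have := sqr_ge0 b => *.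
by congr (_, _); apply/eqP; rewrite -sqrf_eq0; apply/eqP; lra.
Qed.

Lemma mag_scl a v : 0 <= a -> mag (a * v.1, a * v.2) = a * mag v.
Proof.
move=> a0; rewrite /mag /= !exprMn -mulrDr sqrtrM ?sqr_ge0 // sqrtr_sqr.
by rewrite ger0_norm.
Qed.

Lemma mag_turn a u : 0 <= a -> mag (a * (turn u).1, a * (turn u).2) = a.
Proof. by move=> a0; rewrite mag_scl // /mag turn_norm sqrtr1 mulr1. Qed.

Lemma polar_ex v : exists u, 0 <= u < 1 /\
  v = (mag v * (turn u).1, mag v * (turn u).2).
Proof.
have [v0|v0] := eqVneq (mag v) 0.
  exists 0; rewrite lexx ltr01; split=> //.
  by rewrite {1}(mag_eq0 v0) v0 !mul0r.
have [|u u01 uE] := @turn_surj (v.1 / mag v, v.2 / mag v).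
  by rewrite /= !exprMn -mulrDl -mag_sqr exprVn mulfV // expf_neq0.
exists u; split=> //; rewrite -uE /= !mulrA ![mag v * _]mulrC !mulfK //.
by case: v {v0 uE}.
Qed.

(** The angle jumps at the positive real axis and is an arbitrary choice at the origin; whatever is
    defined with it must be insensitive to both. *)
Definition arg v : R := projT1 (cid (polar_ex v)).

Lemma arg01 v : 0 <= arg v < 1.
Proof. by rewrite /arg; case: cid => u []. Qed.

Lemma polarE v : v = (mag v * (turn (arg v)).1, mag v * (turn (arg v)).2).
Proof. by rewrite /arg; case: cid => u []. Qed.

Lemma arg_turn a u : 0 < a -> turn (arg (a * (turn u).1, a * (turn u).2)) = turn u.
Proof.
move=> a0; have := polarE (a * (turn u).1, a * (turn u).2).
rewrite mag_turn ?ltW //; move: (arg _) => t [h1 h2].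
have a0' : a != 0 by rewrite gt_eqF.
have e1 : (turn u).1 = (turn t).1 := mulfI a0' h1.
have e2 : (turn u).2 = (turn t).2 := mulfI a0' h2.
by rewrite /turn; congr (_, _).
Qed.

End Coordinates.

Ltac pring := rewrite [LHS]surjective_pairing [RHS]surjective_pairing /=; congr (_, _); ring.

(** * Displacements carried by strings *)

Section Push.
Context {R : realType}.
Local Notation C := (R * R)%type.
Local Notation C2 := ((R * R) * (R * R))%type.
Local Notation S3 := (@sphere3 R).
Implicit Types (x y v : C) (z : C2) (u s t : R).

(** The sup norm: bounds and Lipschitz estimates can be checked one coordinate at a time. *)
Definition mx (v : C) : R := Num.max `|v.1| `|v.2|.

Lemma mx_le v (c : R) : (mx v <= c) = (`|v.1| <= c) && (`|v.2| <= c).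
Proof. by rewrite /mx ge_max. Qed.

Lemma mx_ge0 v : 0 <= mx v.
Proof. by rewrite /mx le_max normr_ge0. Qed.

Lemma mx_le1 v : `|v.1| <= mx v. Proof. by rewrite /mx le_max lexx. Qed.
Lemma mx_le2 v : `|v.2| <= mx v. Proof. by rewrite /mx le_max lexx orbT. Qed.

Lemma mxD v w : mx (v + w) <= mx v + mx w.
Proof.
rewrite mx_le; apply/andP; split.
  by apply: le_trans (ler_normD _ _) _; apply: lerD; exact: mx_le1.
by apply: le_trans (ler_normD _ _) _; apply: lerD; exact: mx_le2.
Qed.

Lemma mxN v : mx (- v) = mx v.
Proof. by rewrite /mx /= !normrN. Qed.

Lemma mxB v w : `|mx v - mx w| <= mx (v - w).
Proof.
rewrite ler_norml; have := mxD (v - w) w; have := mxD (w - v) v.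
by rewrite !subrK -(mxN (w - v)) opprB => *; apply/andP; split; lra.
Qed.

Lemma mx_eq0 v : mx v = 0 -> v = 0.
Proof.
move=> h; have := mx_le1 v; have := mx_le2 v; rewrite h !normr_le0.
by case: v {h} => a b /= /eqP -> /eqP ->.
Qed.

Lemma mx_scl (a : R) v : 0 <= a -> mx (a * v.1, a * v.2) = a * mx v.
Proof. by move=> a0; rewrite /mx /= !normrM maxr_pMr // ger0_norm. Qed.

Lemma max0_lip (a b : R) : `|Num.max 0 a - Num.max 0 b| <= `|a - b|.
Proof.
have := normr_ge0 (a - b); have := ler_norm (a - b); have := ler_norm (b - a).
rewrite distrC => *; rewrite ler_norml.
by case: (leP 0 a) => ?; case: (leP 0 b) => ?; apply/andP; split; lra.
Qed.

Section Field.
Context (I : finType) (p d : I -> R -> C) (r : R).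

(* The degree-one homogenization, in the pair (x, rho), of a tent function of
   radius r centred at p i u. *)
Definition tent i x (rho u : R) : R :=
  Num.max 0 (rho - mx (x.1 - rho * (p i u).1, x.2 - rho * (p i u).2) / r).

Definition disp x (rho u : R) : C :=
  (\sum_i tent i x rho u * (d i u).1, \sum_i tent i x rho u * (d i u).2).

Hypothesis r0 : 0 < r.

Lemma tent_scl a i x rho u : 0 <= a ->
  tent i (a * x.1, a * x.2) (a * rho) u = a * tent i x rho u.
Proof.
move=> a0; rewrite /tent /= maxr_pMr // mulr0; congr Num.max.
rewrite mulrBr; congr (_ - _); rewrite mulrA -mx_scl //=; congr (mx _ / _).
by congr (_, _); ring.
Qed.

Lemma disp_scl a x rho u : 0 <= a ->
  disp (a * x.1, a * x.2) (a * rho) u = (a * (disp x rho u).1, a * (disp x rho u).2).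
Proof.
move=> a0; rewrite /disp /=; congr (_, _); rewrite mulr_sumr;
  by apply: eq_bigr => i _; rewrite tent_scl // mulrA.
Qed.

Lemma tent0 i x u : tent i x 0 u = 0.
Proof.
rewrite /tent sub0r; apply/max_idPl; rewrite oppr_le0 divr_ge0 ?mx_ge0 //.
exact: ltW.
Qed.

Lemma disp0 x u : disp x 0 u = 0.
Proof.
by rewrite /disp; congr (_, _); apply: big1 => i _; rewrite tent0 mul0r.
Qed.

Lemma tent_lip i x y rho u : `|tent i x rho u - tent i y rho u| <= mx (x - y) / r.
Proof.
apply: le_trans (max0_lip _ _) _.
rewrite (_ : _ - _ = (mx (y.1 - rho * (p i u).1, y.2 - rho * (p i u).2)
  - mx (x.1 - rho * (p i u).1, x.2 - rho * (p i u).2)) / r); last by ring.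
rewrite normrM (gtr0_norm (x := r^-1)) ?invr_gt0 //.
rewrite ler_pM2r ?invr_gt0 //; apply: le_trans (mxB _ _) _.
by rewrite -(mxN (x - y)) (_ : _ - _ = - (x - y)) //; pring.
Qed.

Lemma tent_bnd i x rho u : 0 <= rho -> 0 <= tent i x rho u <= rho.
Proof.
move=> rho0; rewrite /tent le_max lexx /= ge_max rho0 gerBl divr_ge0 ?mx_ge0 //.
exact: ltW.
Qed.

Lemma tent_far i x rho u :
  rho * r <= mx (x.1 - rho * (p i u).1, x.2 - rho * (p i u).2) ->
  tent i x rho u = 0.
Proof. by move=> h; apply/max_idPl; rewrite subr_le0 ler_pdivlMr. Qed.

Lemma tent_center i u : tent i (p i u) 1 u = 1.
Proof.
rewrite /tent !mul1r !subrr (_ : mx _ = 0) ?mul0r ?subr0.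
  by apply/max_idPr; exact: ler01.
by rewrite /mx /= normr0 maxxx.
Qed.

Context (eps : R).
Hypothesis (eps0 : 0 <= eps) (epsr : 2 * (#|I|%:R * eps) <= r).
Hypothesis d_small : forall i u, 0 <= u <= 1 -> mx (d i u) <= eps.

(** Each tent is 1/r-Lipschitz and multiplies a vector of norm at most [eps], so by [epsr] the sum
    over [I] has constant at most 1/2. A constant below 1 is what makes [shift] bijective. *)
Lemma disp_lip x y rho u : 0 <= u <= 1 ->
  2 * mx (disp x rho u - disp y rho u) <= mx (x - y).
Proof.
move=> u01.
have key (f : C -> R) : (forall v, `|f v| <= mx v) ->
    2 * `|\sum_i tent i x rho u * f (d i u) - \sum_i tent i y rho u * f (d i u)|
      <= mx (x - y).
  move=> fmx; rewrite -sumrB.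
  apply: (@le_trans _ _ (2 * \sum_(i : I) (mx (x - y) / r * eps))).
    rewrite ler_wpM2l //; apply: le_trans (ler_norm_sum _ _ _) _.
    apply: ler_sum => i _; rewrite -mulrBl normrM; apply: ler_pM => //.
      exact: tent_lip.
    exact: le_trans (fmx _) (d_small _ _).
  rewrite sumr_const -mulr_natl.
  rewrite (_ : _ * _ = mx (x - y) * ((2 * (#|I|%:R * eps)) / r)); last by ring.
  by rewrite ler_piMr ?mx_ge0 // ler_pdivrMr // mul1r.
have := key fst mx_le1; have := key snd mx_le2.
rewrite /disp {3}/mx => h1 h2; case: (leP `|(_ : C).1| _) => //.
Qed.

Lemma disp_bnd x rho u : 0 <= u <= 1 -> 0 <= rho ->
  mx (disp x rho u) <= #|I|%:R * (rho * eps).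
Proof.
move=> u01 rho0; rewrite mx_le; apply/andP; split.
  apply: le_trans (ler_norm_sum _ _ _) _; rewrite mulr_natl -sumr_const.
  apply: ler_sum => i _; rewrite normrM; apply: ler_pM => //.
    by have /andP[h1 h2] := tent_bnd i x u rho0; rewrite ger0_norm.
  exact: le_trans (mx_le1 _) (d_small _ _).
apply: le_trans (ler_norm_sum _ _ _) _; rewrite mulr_natl -sumr_const.
apply: ler_sum => i _; rewrite normrM; apply: ler_pM => //.
  by have /andP[h1 h2] := tent_bnd i x u rho0; rewrite ger0_norm.
exact: le_trans (mx_le2 _) (d_small _ _).
Qed.

Definition shift s x rho u : C :=
  (x.1 + s * (disp x rho u).1, x.2 + s * (disp x rho u).2).

Lemma shift_inj s x y rho u : 0 <= s <= 1 -> 0 <= u <= 1 ->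
  shift s x rho u = shift s y rho u -> x = y.
Proof.
move=> s01 u01 [e1 e2]; apply/eqP; rewrite -subr_eq0; apply/eqP/mx_eq0.
have := disp_lip x y rho u01; set D := _ - _ => h.
have xy : x - y = (- s * D.1, - s * D.2).
  rewrite /D [LHS]surjective_pairing /=; congr (_, _); rewrite mulNr mulrBr opprB.
    by apply/eqP; rewrite subr_eq addrAC eq_sym subr_eq e1 addrC.
  by apply/eqP; rewrite subr_eq addrAC eq_sym subr_eq e2 addrC.
have : mx (x - y) <= mx D.
  rewrite xy mx_le /= !normrM normrN.
  have s1 : `|s| <= 1 by rewrite ger0_norm; lra.
  apply/andP; split.
    by apply: le_trans (mx_le1 _); rewrite ler_piMl.
  by apply: le_trans (mx_le2 _); rewrite ler_piMl.
by have := mx_ge0 (x - y); lra.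
Qed.

(* A point minimizing the distance between its image and the target is sent to
   the target, since the displacement is a contraction. *)
Lemma shift_surj s y rho u : 0 <= s <= 1 -> 0 <= u <= 1 -> 0 <= rho ->
  exists x, shift s x rho u = y.
Proof.
move=> s01 u01 rho0; set M := #|I|%:R * (rho * eps).
(* The displacement has norm at most [M], so every preimage of [y], and also the point [x'] below,
   lies in this box. *)
pose B : set C := `[y.1 - M, y.1 + M]%classic `*` `[y.2 - M, y.2 + M]%classic.
pose g x := mx (shift s x rho u - y).
have M0 : 0 <= M by rewrite !mulr_ge0.
have sD x : `|s * (disp x rho u).1| <= M /\ `|s * (disp x rho u).2| <= M.
  have := disp_bnd x u01 rho0; rewrite mx_le -/M => /andP[h1 h2].
  have s1 : `|s| <= 1 by rewrite ger0_norm; lra.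
  by rewrite !normrM; split; [apply: le_trans h1|apply: le_trans h2]; rewrite ler_piMl.
have Bne : B !=set0 by exists y; split; rewrite /= in_itv /=; apply/andP; split; lra.
have Bc : compact B by apply: compact_setX; exact: segment_compact.
have [|x xB xmin] := @compact_EVT_min _ _ g B Bne Bc.
  by apply: continuous_subspaceT => x; rewrite /g /mx /shift /disp /tent /mx /=; cont.
(* One step of the contraction iteration from the minimizer [x]: [g x] is the distance from [x] to
   [x'], and [g x'] is at most half of it, so minimality forces [g x = 0]. *)
pose x' : C := (y.1 - s * (disp x rho u).1, y.2 - s * (disp x rho u).2).
have [h1 h2] := sD x; exists x.
have x'B : x' \in B.
  apply/mem_set; move: h1 h2; rewrite /x'; case: (disp x rho u) => a b /=.
  rewrite !ler_norml => /andP[a1 a2] /andP[b1 b2].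
  by split; rewrite /= in_itv /=; apply/andP; split; lra.
have /= gle := xmin _ x'B.
have e1 : g x = mx (x - x').
  by rewrite /g; congr mx; rewrite /shift /x'; pring.
have e2 : g x' <= mx (disp x' rho u - disp x rho u).
  rewrite /g (_ : _ - y = (s * (disp x' rho u - disp x rho u).1,
    s * (disp x' rho u - disp x rho u).2)).
    have [s0 s1] := andP s01.
    by rewrite mx_scl // ler_piMl ?mx_ge0.
  by rewrite /shift /x'; pring.
have := disp_lip x' x rho u01; rewrite -(mxN (x' - x)) opprB -e1 => e3.
have : mx (shift s x rho u - y) = 0.
  by apply/eqP; rewrite eq_le mx_ge0 andbT -/(g x); lra.
by move/mx_eq0/eqP; rewrite subr_eq0 => /eqP.
Qed.

End Field.
End Push.

(** * From a small displacement field to an isotopy of the sphere *)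

Section PushIsotopy.
Context {R : realType}.
Local Notation C := (R * R)%type.
Local Notation C2 := ((R * R) * (R * R))%type.
Local Notation S3 := (@sphere3 R).
Implicit Types (x y v : C) (z : C2) (u s t : R).

(** Times together with points of S^3 whose second coordinate is given in polar form. Here radius
    and angle are independent coordinates, on which the push is visibly continuous. *)
Lemma compact_polar : compact [set q : R * (C * (R * R)) |
  [/\ 0 <= q.1 <= 1, q.2.1.1 ^+ 2 + q.2.1.2 ^+ 2 + q.2.2.1 ^+ 2 = 1,
      0 <= q.2.2.1 <= 1 & 0 <= q.2.2.2 <= 1]].
Proof.
pose I : set R := `[-1, 1]%classic; pose J : set R := `[0, 1]%classic.
have cI : compact I by exact: segment_compact.
have cJ : compact J by exact: segment_compact.
set A := (X in compact X).
pose f (q : R * (C * (R * R))) := q.2.1.1 ^+ 2 + q.2.1.2 ^+ 2 + q.2.2.1 ^+ 2.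
rewrite (_ : A = (J `*` ((I `*` I) `*` (J `*` J))) `&` (f @^-1` [set 1])).
  apply: compact_closedI; first by do !apply: compact_setX.
  apply: closed_level; first by move=> q; rewrite /f; cont.
  exact: closed_eq.
rewrite eqEsubset; split=> [[s [[a b] [rho u]]]|[s [[a b] [rho u]]]]; rewrite /A /f /=.
  move=> [s01 e r01 u01]; split=> //; split; rewrite /= ?in_itv //=.
  have := sqr_ge0 a; have := sqr_ge0 b; have := sqr_ge0 rho => *.
  by split; split; rewrite /= ?in_itv //=; apply: sqr_le1; lra.
by rewrite /J /= => -[[+ [_ []]]]; rewrite /= !in_itv /=.
Qed.

Context (I : finType) (p d : I -> R -> C) (r eps : R).
Hypothesis r0 : 0 < r.
Hypothesis (eps0 : 0 <= eps) (epsr : 2 * (#|I|%:R * eps) <= r).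
Hypothesis d_small : forall i u, 0 <= u <= 1 -> mx (d i u) <= eps.
Hypothesis cd : forall i, continuous (d i).
Hypothesis cp : forall i, continuous (p i).
Hypothesis dmatch : forall x rho, 0 <= rho -> disp p d r x rho 0 = disp p d r x rho 1.

Let G s x v : C := shift p d r s x (mag v) (arg v).
Let H s z : C2 := nrm (G s z.1 z.2, z.2).

(** The choice of polar representation is immaterial: for radius 0 the displacement vanishes, and
    the angles 0 and 1 agree by [dmatch]. *)
Let GE s x rho u : 0 <= rho -> 0 <= u <= 1 ->
  G s x (rho * (turn u).1, rho * (turn u).2) = shift p d r s x rho u.
Proof.
move=> rho0 u01; rewrite /G /shift mag_turn //.
have [->|rho0'] := eqVneq rho 0; first by rewrite !disp0.
have rhop : 0 < rho by rewrite lt_neqAle eq_sym rho0'.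
set a := arg _; have := arg_turn u rhop; rewrite -/a => ea.
have a01 : 0 <= a <= 1 by have := arg01 (rho * (turn u).1, rho * (turn u).2); rewrite -/a; lra.
have [-> //|[-> ->]|[-> ->]] := turn_eq01 a01 u01 ea; by rewrite dmatch.
Qed.

Let GP s x v : exists rho u, [/\ 0 <= rho, 0 <= u <= 1,
  v = (rho * (turn u).1, rho * (turn u).2), G s x v = shift p d r s x rho u & rho = mag v].
Proof.
exists (mag v), (arg v); split=> //; first exact: mag_ge0; last exact: polarE.
by have := arg01 v; lra.
Qed.

Let G0v s x : G s x (0, 0) = x.
Proof.
have := @GE s x 0 0 (lexx _); rewrite !mul0r => ->; last by rewrite lexx ler01.
by rewrite /shift disp0 //= mulr0 !addr0 -surjective_pairing.
Qed.

Let G_scl s a x v : 0 <= a ->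
  G s (a * x.1, a * x.2) (a * v.1, a * v.2) = (a * (G s x v).1, a * (G s x v).2).
Proof.
move=> a0; have [rho [u [rho0 u01 -> -> _]]] := GP s x v.
rewrite /= !mulrA GE ?mulr_ge0 // /shift disp_scl //=; congr (_, _); ring.
Qed.

Let G_inj s v : 0 <= s <= 1 -> injective (fun x => G s x v).
Proof.
have a01 : 0 <= arg v <= 1 by have := arg01 v; lra.
by move=> s01 x y; exact: (shift_inj r0 epsr d_small s01 a01).
Qed.

Let G_surj s v y : 0 <= s <= 1 -> exists x, G s x v = y.
Proof.
have a01 : 0 <= arg v <= 1 by have := arg01 v; lra.
by move=> s01; exact: (shift_surj p r0 eps0 epsr d_small y s01 a01 (mag_ge0 v)).
Qed.

Let GnsqP s z : 0 <= s <= 1 -> 0 < nsq z -> 0 < nsq (G s z.1 z.2, z.2).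
Proof.
case: z => x v s01 z0 /=; have [v0|v0] := eqVneq v (0, 0).
  by move: z0; rewrite v0 G0v.
exact: nsq_gt0.
Qed.

Let S3P z : S3 z -> 0 < nsq z.
Proof. by rewrite /sphere3 /= -/(nsq z) => ->; exact: ltr01. Qed.

Let H_nrm s z : 0 <= s <= 1 -> 0 < nsq z -> H s (nrm z) = nrm (G s z.1 z.2, z.2).
Proof.
move=> s01 z0; set a := (Num.sqrt (nsq z))^-1.
have a0 : 0 < a by rewrite invr_gt0 sqrtr_gt0.
rewrite /H -[nrm z in LHS]/(scl a z) /=.
have := G_scl s z.1 z.2 (ltW a0) => ->.
exact: (@nrm_scl R a (G s z.1 z.2, z.2)).
Qed.

Let H_S3 s z : 0 <= s <= 1 -> S3 z -> S3 (H s z).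
Proof. by move=> s01 /S3P z0; apply/nrm_sphere/GnsqP. Qed.

(** Equal images come from vectors on one ray before normalization; by homogeneity and injectivity
    of [G] in its first argument the sources lie on one ray too, and a ray meets the sphere once. *)
Let H_inj s : 0 <= s <= 1 -> {in S3 &, injective (H s)}.
Proof.
move=> s01 z z' /set_mem Sz /set_mem Sz' e.
have := S3P Sz; have := S3P Sz' => z'0 z0.
have [a a0] := nrm_inj (GnsqP s01 z0) (GnsqP s01 z'0) e.
case: z z' Sz Sz' z0 z'0 {e} => x v [x' v'] Sz Sz' z0 z'0 e.
have e1 : G s x' v' = (a * (G s x v).1, a * (G s x v).2) := congr1 fst e.
have e2 : v' = (a * v.1, a * v.2) := congr1 snd e.
have e3 : x' = (a * x.1, a * x.2).
  by apply: (G_inj s01 (v := v')); rewrite e1 e2 (G_scl s x v (ltW a0)).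
have e4 : (x', v') = scl a (x, v) by rewrite e2 e3.
by rewrite -(nrm_id Sz) -(nrm_id Sz') e4 nrm_scl.
Qed.

Let H_surj s : 0 <= s <= 1 -> H s @` S3 = S3.
Proof.
move=> s01; rewrite eqEsubset; split=> [_ [z Sz <-]|[y v] Sy]; first exact: H_S3.
have [x xy] := G_surj v y s01.
have x0 : 0 < nsq (x, v).
  have [v0|v0] := eqVneq v (0, 0); last exact: (@nsq_gt0 R (x, v)).
  by have := S3P Sy; rewrite -xy v0 G0v.
exists (nrm (x, v)); first exact: nrm_sphere.
by rewrite H_nrm //= xy nrm_id.
Qed.

(** Pulled back along polar coordinates the map is given by a formula without [arg]; compactness of
    the parameter space then gives continuity on the sphere. *)
Let H_cont : {within `[(0 : R), 1]%classic `*` S3, continuous (fun q : R * C2 => H q.1 q.2)}.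
Proof.
pose A := [set q : R * (C * (R * R)) |
  [/\ 0 <= q.1 <= 1, q.2.1.1 ^+ 2 + q.2.1.2 ^+ 2 + q.2.2.1 ^+ 2 = 1,
      0 <= q.2.2.1 <= 1 & 0 <= q.2.2.2 <= 1]].
pose e (q : R * (C * (R * R))) : R * C2 :=
  (q.1, (q.2.1, (q.2.2.1 * (turn q.2.2.2).1, q.2.2.1 * (turn q.2.2.2).2))).
have <- : e @` A = `[(0 : R), 1]%classic `*` S3.
  rewrite eqEsubset; split=> [_ [[s [x [rho u]]] [/= s01 x1 r01 u01] <-]|[s [x v]]].
    split; first by rewrite /= in_itv.
    by rewrite /sphere3 /e; cbn [fst snd mkset]; rewrite !exprMn -mulrDr turn_norm mulr1.
  rewrite /sphere3 /= in_itv /= => -[s01 xv].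
  have [rho [u [rho0 u01 vE _ rE]]] := GP 0 x v.
  exists (s, (x, (rho, u))); last by rewrite /e /= vE.
  have r2 : x.1 ^+ 2 + x.2 ^+ 2 + rho ^+ 2 = 1 by rewrite rE mag_sqr.
  split=> //=; have /sqr_le1 : rho ^+ 2 <= 1; last by lra.
  by have := sqr_ge0 x.1; have := sqr_ge0 x.2; lra.
apply: compact_quotient; [exact: norm_hausdorff|exact: compact_polar| |].
  by apply: continuous_subspaceT => q; rewrite /e /turn; cont.
pose N (q : R * (C * (R * R))) : C2 := (shift p d r q.1 q.2.1 q.2.2.1 q.2.2.2,
    (q.2.2.1 * (turn q.2.2.2).1, q.2.2.1 * (turn q.2.2.2).2)).
refine (@subspace_eq_continuous _ A C2 (fun q => nrm (N q)) _ _ _).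
  move=> [s [x [rho u]]] /set_mem[s01 x1 r01 u01].
  have rho0 : 0 <= rho by case/andP: r01.
  by rewrite /N; cbn [fst snd]; rewrite -(GE s x rho0 u01).
apply: within_cont => q qA.
have N0 : Num.sqrt (nsq (N q)) != 0.
  case: q qA => s [x [rho u]] [s01 x1 r01 u01].
  rewrite gt_eqF // sqrtr_gt0 /N; cbn [fst snd]; rewrite -GE //; last by case/andP: r01.
  set v := (rho * (turn u).1, rho * (turn u).2); apply: (@GnsqP s (x, v) s01); apply: S3P.
  by rewrite /v /sphere3; cbn [fst snd mkset]; rewrite !exprMn -mulrDr turn_norm mulr1.
have cN : continuous (N : subspace A -> C2).
  apply: continuous_subspaceT => q1.
  by rewrite /N /shift /disp /tent /mx /turn /=; cont.
have cV : continuous_at (q : subspace A) (fun q : subspace A => (Num.sqrt (nsq (N q)))^-1).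
  by apply: catV => //; rewrite /nsq; cont.
by rewrite /nrm /scl; cont; apply: catcomp; try exact: cN; cont.
Qed.

Lemma push_isotopy : exists H : R -> C2 -> C2,
  [/\ {within `[(0 : R), 1]%classic `*` S3, continuous (fun q : R * C2 => H q.1 q.2)},
      forall t, t \in `[0, 1] -> homeo_on S3 S3 (H t),
      {in S3, H 0 =1 id},
      forall x u, 0 <= u <= 1 ->
        H 1 (nrm (x, turn u)) = nrm (x + disp p d r x 1 u, turn u) &
      forall z, S3 z -> z.2 = (0, 0) -> H 1 z = z].
Proof.
exists H; split.
- exact: H_cont.
- move=> t; rewrite in_itv /= => t01; apply: (homeo_on_compact ((0, 0), (0, 0))).
  + exact: norm_hausdorff.
  + exact: compact_sphere3.
  + have a1 : {homo (fun z => (t, z)) : z / S3 z >-> (`[(0 : R), 1]%classic `*` S3) z}.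
      by move=> z Sz; split; rewrite //= in_itv.
    have a2 : {within S3, continuous (fun z => (t, z))}.
      by apply: continuous_subspaceT => z; cont.
    by apply: (within_comp a1 a2 H_cont).
  + exact: H_inj.
  + exact: H_surj.
- move=> z /set_mem Sz; rewrite /H /G /shift !mul0r !addr0 -!surjective_pairing.
  exact: nrm_id.
- move=> x u u01; rewrite H_nrm ?ler01 ?lexx ?nsq_turn //=; congr nrm; congr (_, _).
  have := @GE 1 x 1 u ler01 u01; rewrite !mul1r => ->.
  by rewrite /shift !mul1r.
- by move=> [x v] Sz /= v0; rewrite /H /= v0 G0v -v0 nrm_id.
Qed.

End PushIsotopy.

(** * Isotopies from homotopies of disjoint strands *)

Section Moves.
Context {R : realType}.
Local Notation C := (R * R)%type.
Local Notation C2 := ((R * R) * (R * R))%type.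
Local Notation S3 := (@sphere3 R).
Implicit Types (x y v : C) (z : C2) (u s t : R).

Lemma fin_pos (K : finType) (P : K -> R -> Prop) :
  (forall k a b, 0 < b <= a -> P k a -> P k b) ->
  (forall k, exists2 a, 0 < a & P k a) -> exists2 a, 0 < a & forall k, P k a.
Proof.
move=> Pmon /(_ _)/cid2-/all_sig2[f f0 fP].
(* The inverse of [S] lies below every [f k] and remains positive when [K] is empty. *)
pose S := 1 + \sum_k (f k)^-1.
have S0 : 0 < S by rewrite ltr_pwDl // sumr_ge0 // => k _; rewrite invr_ge0 ltW.
exists S^-1 => [|k]; first by rewrite invr_gt0.
apply: Pmon (fP k); rewrite invr_gt0 S0 -[leRHS]invrK lef_pV2 ?posrE ?invr_gt0 //=.
rewrite /S (bigD1 k) //= addrCA lerDl addr_ge0 // sumr_ge0 // => i _.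
by rewrite invr_ge0 ltW.
Qed.

(** The class of 0 is open in [0, 1], and so is its complement, because nearby points are
    equivalent; connectedness does the rest. *)
Lemma unit_interval_chain (E : R -> R -> Prop) :
  (forall s, E s s) -> (forall s t, E s t -> E t s) ->
  (forall s t u, E s t -> E t u -> E s u) ->
  (forall s, 0 <= s <= 1 -> \forall t \near s, 0 <= t <= 1 -> E s t) -> E 0 1.
Proof.
move=> Er Es Et En.
pose A : set R := `[0, 1]%classic.
have h01 : 0 <= (0 : R) <= 1 by lra.
pose B := A `&` [set s | E 0 s].
suff : B = A.
  by move=> BA; have [] : B 1 by rewrite BA /A /= in_itv /= lexx ler01.
apply: (@segment_connected R 0 1).
- by exists 0; split; rewrite /A /= ?in_itv.
- exists (interior [set s | 0 <= s <= 1 -> E 0 s]); first exact: open_interior.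
  rewrite eqEsubset; split=> s [sA]; move: (sA); rewrite /A /= in_itv /= => s01.
    move=> Es0; split=> //; rewrite /interior /=.
    by apply: filterS (En s s01) => t st t01; apply: Et Es0 (st t01).
  by move=> /interior_subset /= /(_ s01).
- exists (~` interior [set s | 0 <= s <= 1 -> ~ E 0 s]).
    by rewrite closedC; exact: open_interior.
  rewrite eqEsubset; split=> s [sA]; move: (sA); rewrite /A /= in_itv /= => s01.
    by move=> Es0; split=> // /interior_subset /= /(_ s01).
  move=> ns; split=> //=; apply: contrapT => nE; apply: ns; rewrite /interior /=.
  by apply: filterS (En s s01) => t st t01 Et0; apply: nE; exact: Et Et0 (Es _ _ (st t01)).
Qed.

Lemma mx_pos x : x != 0 -> 0 < mx x.
Proof.
by move=> x0; rewrite lt_neqAle mx_ge0 andbT eq_sym; apply: contraNneq x0 => /mx_eq0 ->.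
Qed.

Lemma polar_nrm z : S3 z -> z.2 != (0, 0) ->
  exists x u, 0 <= u <= 1 /\ z = nrm (x, turn u).
Proof.
case: z => z1 v Sz /= v0; have [u [u01 vE]] := polar_ex v.
have m0 : 0 < mag v.
  by rewrite lt_neqAle mag_ge0 andbT eq_sym; apply: contraNneq v0 => /mag_eq0 ->.
exists ((mag v)^-1 * z1.1, (mag v)^-1 * z1.2), u; split; first by lra.
rewrite -(nrm_scl _ m0) /scl /= !mulrA !divff ?gt_eqF // !mul1r -vE.
by rewrite -surjective_pairing nrm_id.
Qed.

Section Strands.
Context (I : finType) (h : R -> I -> R -> C) (J : set R) (rest : set C2) (r1 : R).

(** The functions [h s i] live over the whole circle of angles, but only their parts over [J] belong
    to the link; [rest] is the part of the link that must not move. Closed braids have empty [rest]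
    and [J] equal to [0, 1]. *)
Definition strands s : set C2 :=
  [set z | exists i u, J u /\ z = nrm (h s i u, turn u)].

Hypothesis hc : forall i, continuous (fun q : R * R => h q.1 i q.2).
Hypothesis J01 : forall u, J u -> 0 <= u <= 1.
Hypothesis restS : rest `<=` S3.
Hypothesis r10 : 0 < r1.
Hypothesis hinj : forall s u i k, 0 <= s <= 1 -> 0 <= u <= 1 -> i != k ->
  h s i u != h s k u.
(* The pairs (h s i u, h t i u), i : I, are the same at u = 0 and u = 1 up to a
   permutation of the strands. *)
Hypothesis hmatch : forall s t (B : C -> C -> R), (forall a, B a a = 0) ->
  0 <= s <= 1 -> 0 <= t <= 1 ->
  \sum_i B (h s i 0) (h t i 0) = \sum_i B (h s i 1) (h t i 1).
Hypothesis hrest : forall x u i, 0 <= u <= 1 -> rest (nrm (x, turn u)) ->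
  (forall s t, h s i u = h t i u) \/
  (forall s, 0 <= s <= 1 -> r1 <= mx (x - h s i u)).

Lemma hcu s i : continuous (h s i).
Proof.
move=> u; have := @catcomp R _ _ (fun u => (s, u)) (fun q : R * R => h q.1 i q.2) u.
by apply; [exact: hc|cont].
Qed.

Lemma strands_sphere s : strands s `<=` S3.
Proof. by move=> _ [i [u [_ ->]]]; apply/nrm_sphere/nsq_turn. Qed.

Lemma separation s : 0 <= s <= 1 -> exists2 r, 0 < r &
  r <= r1 /\ forall u i k, 0 <= u <= 1 -> i != k -> r <= mx (h s i u - h s k u).
Proof.
move=> s01.
pose P (q : I * I) a := forall u, 0 <= u <= 1 -> q.1 != q.2 ->
  a <= mx (h s q.1 u - h s q.2 u).
have [q a b /andP[_ ba] Pa u u01 ik|[i k]|a a0 Pa] := @fin_pos _ P.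
- exact: le_trans ba (Pa _ u01 ik).
- have [->|ik] := eqVneq i k; first by exists 1 => // u _ /=; rewrite eqxx.
  have [|c c01 cmin] := @EVT_min R (fun u => mx (h s i u - h s k u)) 0 1 ler01.
    have ci := @hcu s i; have ck := @hcu s k.
    by apply: continuous_subspaceT => u; rewrite /mx /=; cont.
  exists (mx (h s i c - h s k c)).
    by apply: mx_pos; rewrite subr_eq0; apply: hinj => //; rewrite -in_itv.
  by move=> u u01 _; apply: cmin; rewrite in_itv.
exists (Num.min a r1); first by rewrite lt_min a0.
split=> [|u i k u01 ik]; first by rewrite ge_min lexx orbT.
by apply: le_trans (Pa (i, k) u u01 ik); rewrite ge_min lexx.
Qed.

(** Compactness of [0, 1] makes the continuity in time uniform in [u] (the tube lemma). *)
Lemma strands_near s (eps : R) : 0 <= s <= 1 -> 0 < eps ->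
  \forall t \near s, forall i u, 0 <= u <= 1 -> mx (h t i u - h s i u) <= eps.
Proof.
move=> s01 e0.
apply: (@filter_forall R I (fun i t => forall u, 0 <= u <= 1 ->
  mx (h t i u - h s i u) <= eps) (nbhs s)) => i.
have /compact_near_coveringP := @segment_compact R 0 1.
move=> /(_ R (nbhs s) (fun t u => mx (h t i u - h s i u) <= eps) (nbhs_filter s)) K.
have /K : forall u, `[0, 1]%classic u -> \forall u' \near u & t \near s,
    mx (h t i u' - h s i u') <= eps.
  move=> u _; pose f (q : R * R) := mx (h q.2 i q.1 - h s i q.1).
  have cf : continuous_at (u, s) f.
    have ci := @hcu s i.
    have c2 : continuous (fun q : R * R => h q.2 i q.1).
      move=> q; apply: (@catcomp _ _ _ (fun q : R * R => (q.2, q.1))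
        (fun q : R * R => h q.1 i q.2)); [exact: hc|cont].
    by rewrite /f /mx /=; cont.
  have f0 : f (u, s) = 0 by rewrite /f /= subrr /mx /= normr0 maxxx.
  have : \forall q \near (u, s), f q < eps.
    by apply: (@cvgr_lt R (R * R)%type (nbhs (u, s)) (nbhs_filter _) f (f (u, s)) cf eps); rewrite f0.
  by apply: filterS => -[u' t] /ltW.
by apply: filterS => t + u u01; apply; rewrite /= in_itv.
Qed.

(** The difference [h t - h s] is carried by tents of radius [r] centred at the strands of time [s].
    On a strand its own tent is 1 and, by the separation, all others vanish, so it lands exactly on
    its new position. *)
Lemma small_move s t r eps : 0 <= s <= 1 -> 0 <= t <= 1 -> 0 < r -> r <= r1 ->
  (forall u i k, 0 <= u <= 1 -> i != k -> r <= mx (h s i u - h s k u)) ->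
  0 <= eps -> 2 * (#|I|%:R * eps) <= r ->
  (forall i u, 0 <= u <= 1 -> mx (h t i u - h s i u) <= eps) ->
  isotopic (rest `|` strands s) (rest `|` strands t).
Proof.
move=> s01 t01 r0 rr1 sep e0 er near.
pose d i u := h t i u - h s i u.
have cd i : continuous (d i).
  move=> u; have cs := @hcu s i; have ct := @hcu t i.
  rewrite (_ : d i = fun u => ((h t i u).1 - (h s i u).1, (h t i u).2 - (h s i u).2)).
    by cont.
  by apply/funext => w; rewrite /d; pring.
have [x rho rho0|H [Hc Hh H0 Hmove Hfix]] := @push_isotopy R I (h s) d r eps r0 e0 er near cd (@hcu s).
  (* A summand of [disp] written as a function of the two positions of one strand, so that [hmatch]
     compares the sums at the angles 0 and 1. *)
  pose B (e : C -> R) (a b : C) :=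
    Num.max 0 (rho - mx (x.1 - rho * a.1, x.2 - rho * a.2) / r) * e (b - a).
  have B0 e : e 0 = 0 -> forall a, B e a a = 0.
    by move=> e0' a; rewrite /B subrr e0' mulr0.
  rewrite /disp /tent /d; congr (_, _).
    exact: (hmatch (B0 fst erefl) s01 t01).
  exact: (hmatch (B0 snd erefl) s01 t01).
exists H; split=> //.
have Hs i u : 0 <= u <= 1 -> H 1 (nrm (h s i u, turn u)) = nrm (h t i u, turn u).
  move=> u01; rewrite Hmove //; congr (nrm (_, _)).
  rewrite -[RHS](subrK (h s i u)) addrC; congr (_ + _).
  have key (f : C -> R) : \sum_k tent (h s) r k (h s i u) 1 u * f (d k u) = f (d i u).
    rewrite (bigD1 i) //= tent_center mul1r big1 ?addr0 // => k ki.
    rewrite tent_far ?mul0r // mul1r !mul1r; have := sep u i k u01.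
    by rewrite eq_sym => /(_ ki).
  by rewrite /disp !key -surjective_pairing.
have Hr z : rest z -> H 1 z = z.
  move=> rz; have Sz := restS rz.
  have [z0|/(polar_nrm Sz)[x [u [u01 zE]]]] := eqVneq z.2 (0, 0); first exact: Hfix.
  rewrite zE Hmove //; congr (nrm (_, _)).
  have key (f : C -> R) : f 0 = 0 -> \sum_k tent (h s) r k x 1 u * f (d k u) = 0.
    move=> f0; apply: big1 => k _; have := @hrest x u k u01; rewrite -zE => /(_ rz)[st|far].
      by rewrite /d (st t s) subrr f0 mulr0.
    rewrite tent_far ?mul0r // mul1r !mul1r.
    exact: le_trans rr1 (far s s01).
  by rewrite /disp !key // addr0.
rewrite eqEsubset; split=> [_ [z [rz|[i [u [Ju ->]]]] <-]|z [rz|[i [u [Ju ->]]]]].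
- by left; rewrite Hr.
- by right; exists i, u; split=> //; rewrite Hs //; exact: J01.
- by exists z; [left|rewrite Hr].
- exists (nrm (h s i u, turn u)); last by rewrite Hs //; exact: J01.
  by right; exists i, u.
Qed.

Theorem strands_isotopy : isotopic (rest `|` strands 0) (rest `|` strands 1).
Proof.
have sS s : rest `|` strands s `<=` S3.
  by move=> z [/restS|/strands_sphere].
apply: (@unit_interval_chain (fun s t => isotopic (rest `|` strands s) (rest `|` strands t))).
- by move=> s; exact: isotopic_refl.
- by move=> s t; apply: isotopic_sym.
- by move=> s t u; exact: isotopic_trans.
move=> s s01; have [r r0 [rr1 sep]] := separation s01.
(* The successor keeps the denominator positive even for an empty family of strands. *)
have n0 : 0 < 2 * #|I|.+1%:R :> R by rewrite mulr_gt0 // ltr0n.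
have e0 : 0 < r / (2 * #|I|.+1%:R) by rewrite divr_gt0.
have := strands_near s01 e0; apply: filterS => t near t01.
apply: (small_move s01 t01 r0 rr1 sep (ltW e0) _ near).
have N0 : 0 < #|I|.+1%:R :> R by rewrite ltr0n.
rewrite (_ : 2 * _ = r * (#|I|%:R / #|I|.+1%:R)); last by field; rewrite gt_eqF.
by apply: ler_piMr; [exact: ltW|rewrite ler_pdivrMr // mul1r ler_nat].
Qed.

End Strands.
End Moves.

(** * Closures of strings and of words *)

Section ClosedPaths.
Context {R : realType} {n : nat}.
Local Notation C := (R * R)%type.
Local Notation C2 := ((R * R) * (R * R))%type.
Local Notation S3 := (@sphere3 R).
Implicit Types (p q : 'I_n -> R -> C) (u s t : R) (w : bword n).

Definition cl p : set C2 :=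
  [set z | exists j u, 0 <= u <= 1 /\ z = nrm (p j u, turn u)].

Lemma cl_sphere p : cl p `<=` S3.
Proof. by move=> _ [j [u [_ ->]]]; apply/nrm_sphere/nsq_turn. Qed.

Lemma eq_cl p q : (forall j u, 0 <= u <= 1 -> p j u = q j u) -> cl p = cl q.
Proof.
by move=> pq; rewrite eqEsubset; split=> _ [j [u [u01 ->]]]; exists j, u; rewrite pq.
Qed.

Lemma cl_relabel p (g : 'S_n) : cl (fun j => p (g j)) = cl p.
Proof.
rewrite eqEsubset; split=> _ [j [u [u01 ->]]]; first by exists (g j), u.
by exists (g^-1%g j), u; rewrite permKV.
Qed.

Theorem cl_homotopy (h : R -> 'I_n -> R -> C) (g : 'S_n) :
  (forall j, continuous (fun q : R * R => h q.1 j q.2)) ->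
  (forall s u j k, 0 <= s <= 1 -> 0 <= u <= 1 -> j != k -> h s j u != h s k u) ->
  (forall s j, 0 <= s <= 1 -> h s j 1 = h s (g j) 0) ->
  isotopic (cl (h 0)) (cl (h 1)).
Proof.
move=> hc hi hg.
have E s : cl (h s) = set0 `|` strands h [set u | 0 <= u <= 1] s.
  by rewrite set0U.
rewrite !E; apply: (@strands_isotopy _ _ _ _ _ 1) => //.
move=> s t B _ s01 t01; rewrite (reindex_inj (@perm_inj _ g)) /=.
by apply: eq_bigr => j _; rewrite !hg.
Qed.

(** The straight-line homotopy. Collisions are expressed by the differences of two strings, so that
    they can be excluded by the sign of one coordinate. *)
Lemma cl_straight p q (g : 'S_n) :
  (forall j, continuous (p j)) -> (forall j, continuous (q j)) ->
  (forall j, p j 1 = p (g j) 0) -> (forall j, q j 1 = q (g j) 0) ->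
  (forall s u j k, 0 <= s <= 1 -> 0 <= u <= 1 -> j != k ->
     (1 - s) * ((p k u).1 - (p j u).1) + s * ((q k u).1 - (q j u).1) = 0 ->
     (1 - s) * ((p k u).2 - (p j u).2) + s * ((q k u).2 - (q j u).2) = 0 ->
     False) ->
  isotopic (cl p) (cl q).
Proof.
move=> cp cq pg qg ne.
pose h s j u : C := ((1 - s) * (p j u).1 + s * (q j u).1,
                     (1 - s) * (p j u).2 + s * (q j u).2).
have h0 : cl p = cl (h 0).
  apply: eq_cl => j u _; rewrite /h !subr0 !mul1r !mul0r !addr0.
  exact: surjective_pairing.
have h1 : cl q = cl (h 1).
  apply: eq_cl => j u _; rewrite /h !subrr !mul1r !mul0r !add0r.
  exact: surjective_pairing.
rewrite h0 h1; apply: (@cl_homotopy h g).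
- move=> j q'; have := cp j => cpj; have := cq j => cqj; rewrite /h; cont.
- move=> s u j k s01 u01 jk; apply/eqP => -[e1 e2]; apply: (ne s u j k) => //; lra.
- by move=> s j _; rewrite /h pg qg.
Qed.

End ClosedPaths.

Section StringPaths.
Context {R : realType} {n : nat}.
Local Notation C := (R * R)%type.
Implicit Types (j k : 'I_n) (a : bletter n) (w l y : bword n) (u s t : R).

Definition lswap a : 'S_n := tperm (lpos a.1) (rpos a.1).

Lemma lpos_neq_rpos a : lpos a.1 != rpos a.1.
Proof. by rewrite -val_eqE /= neq_ltn leqnn. Qed.

Lemma lswapP a j : lswap a j =
  if j == lpos a.1 then rpos a.1 else if j == rpos a.1 then lpos a.1 else j.
Proof.
rewrite /lswap; case: tpermP => [->|->|/eqP h1 /eqP h2]; rewrite ?eqxx //.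
  by rewrite eq_sym (negbTE (lpos_neq_rpos a)).
by rewrite (negbTE h1) (negbTE h2).
Qed.

Lemma letter_path_cont a j : continuous (letter_path a j : R -> C).
Proof.
by move=> t; rewrite /letter_path; cbv zeta; case: (j == lpos a.1); last case: (j == rpos a.1); cont.
Qed.

Lemma letter_path0 a j : letter_path a j (0 : R) = ((j : nat)%:R, 0).
Proof.
rewrite /letter_path mulr0 cos0 sin0; case: eqP => [->|_].
  by congr (_, _); rewrite /=; [field|ring].
by case: eqP => [->|//]; congr (_, _); rewrite /= -?natr1; [field|ring].
Qed.

Lemma letter_path1 a j : letter_path a j (1 : R) = ((lswap a j : nat)%:R, 0).
Proof.
rewrite /letter_path mulr1 cospi sinpi lswapP; case: eqP => _.
  by congr (_, _); rewrite /= -?natr1; [field|ring].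
by case: eqP => [_|//]; congr (_, _); rewrite /=; [field|ring].
Qed.

(* The pair of strings of the letter is at the ends of a diameter, the other
   strings have integer positions at distance at least 1/2 from its centre. *)
Lemma letter_path_inj a t : injective (fun j => letter_path a j t : C).
Proof.
pose c : R := (a.1 : nat)%:R + 2^-1.
have out j : j != lpos a.1 -> j != rpos a.1 -> forall v : R, (j : nat)%:R = c + v -> 1 < `|v|.
  rewrite -!val_eqE /= => h1 h2 v e.
  have [h|h] : (j < a.1)%N \/ (a.1.+2 <= j)%N by lia.
    have : (j : nat).+1%:R <= (a.1 : nat)%:R :> R by rewrite ler_nat.
    rewrite -natr1 => h'; rewrite ltr0_norm; move: e; rewrite /c; lra.
  have : (a.1 : nat).+2%:R <= (j : nat)%:R :> R by rewrite ler_nat.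
  by rewrite -!natr1 => h'; rewrite gtr0_norm; move: e; rewrite /c; lra.
have hc : `|2^-1 * cos (pi * t)| <= 2^-1 :> R.
  by rewrite normrM gtr0_norm ?invr_gt0 // ler_piMr ?cos_max.
have cs := cos2Dsin2 (pi * t).
set e : R := if a.2 then 1 else -1.
have nz : e != 0 by rewrite /e; case: ifP; rewrite ?oppr_eq0 oner_eq0.
have diam (x y : R) : x ^+ 2 + y ^+ 2 = 1 -> c - 2^-1 * x = c + 2^-1 * x ->
  - (e * 2^-1 * y) = e * 2^-1 * y -> False.
  clearbody e; move=> xy e1 e2; have x0 : x = 0 by lra.
  have /eqP : e * y = 0 by lra.
  rewrite mulf_eq0 (negbTE nz) /= => /eqP y0.
  by move: xy; rewrite x0 y0 expr0n addr0 => /eqP; rewrite eq_sym oner_eq0.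
have far : 1 < `|2^-1 * cos (pi * t)| -> False.
  by move=> h; have := lt_le_trans h hc; lra.
move=> j k; rewrite /letter_path -/c -/e.
have [->|jl] := eqVneq j (lpos a.1); have [->|kl] := eqVneq k (lpos a.1) => //.
- have [_|kr] := eqVneq k (rpos a.1); first by move=> -[e1 e2]; have [] := diam _ _ cs e1 e2.
  by move=> -[/esym/(out k kl kr)]; rewrite normrN => /far.
- have [_|kr] := eqVneq j (rpos a.1); first by move=> -[/esym e1 /esym e2]; have [] := diam _ _ cs e1 e2.
  by move=> -[/(out j jl kr)]; rewrite normrN => /far.
have [->|jr] := eqVneq j (rpos a.1); have [->|kr] := eqVneq k (rpos a.1) => //.
- by move=> -[/esym/(out k kl kr)/far].
- by move=> -[/(out j jl jr)/far].
- move=> -[/eqP]; rewrite eqr_nat => /eqP h; exact: val_inj.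
Qed.

Lemma letter_path_bnd a j t :
  0 <= (letter_path a j t : C).1 <= n%:R - 1 /\ `|(letter_path a j t : C).2| <= 2^-1.
Proof.
have hc := cos_max (pi * t); have hs := sin_max (pi * t).
have ha : (a.1 : nat).+2%:R <= n%:R :> R by rewrite ler_nat ltn_neqAle; have := rpos_subproof a.1; lia.
have a0 : 0 <= (a.1 : nat)%:R :> R by [].
rewrite -!natr1 in ha.
move: hc hs; rewrite !ler_norml => /andP[c1 c2] /andP[s1 s2].
rewrite /letter_path; case: eqP => _; [|case: eqP => _] => /=.
- split; first by lra.
  by case: (a.2); apply/andP; split; lra.
- split; first by lra.
  by case: (a.2); apply/andP; split; lra.
- split; last by lra.
  rewrite ler0n /=; have : (j : nat).+1%:R <= n%:R :> R by rewrite ler_nat.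
  by rewrite -natr1; lra.
Qed.

Lemma string_path0 w j : string_path w j (0 : R) = ((j : nat)%:R, 0).
Proof. by case: w => [//|a w] /=; rewrite ler01 letter_path0. Qed.

(** The test on time is traded for clamped times, for which continuity is structural: up to time 1
    the second summand vanishes, and afterwards the first is stuck at the end of the letter. *)
Lemma string_path_cons a w j t : string_path (a :: w) j t =
  letter_path a j (Num.min t 1) +
  (string_path w (lswap a j) (Num.max t 1 - 1) - ((lswap a j : nat)%:R, 0)).
Proof.
rewrite /=; have [t1|t1] := leP t 1.
  by rewrite subrr string_path0 subrr addr0.
by rewrite letter_path1 [RHS]addrC subrK.
Qed.

Lemma string_path_cont w j : continuous (string_path w j : R -> C).
Proof.
elim: w j => [|a w IH] j; first by move=> t; exact: cst_continuous.
rewrite (_ : string_path (a :: w) j = fun t => (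
  (letter_path a j (Num.min t 1)).1 +
   ((string_path w (lswap a j) (Num.max t 1 - 1)).1 - (lswap a j : nat)%:R),
  (letter_path a j (Num.min t 1)).2 +
   ((string_path w (lswap a j) (Num.max t 1 - 1)).2 - 0))); last first.
  by apply/funext => t; rewrite string_path_cons.
have IHj := IH (lswap a j); have cl := @letter_path_cont a j.
by move=> t; cont.
Qed.

Lemma bword_perm_cons a w : bword_perm (a :: w) = (lswap a * bword_perm w)%g.
Proof. by rewrite /bword_perm big_cons. Qed.

Lemma string_path_end w j t : (size w)%:R <= t ->
  string_path w j t = ((bword_perm w j : nat)%:R, 0).
Proof.
elim: w j t => [|a w IH] j t /=; first by rewrite /bword_perm big_nil perm1.
rewrite -natr1 => ht; have w0 : 0 <= (size w)%:R :> R by [].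
rewrite bword_perm_cons permM; case: (leP t 1) => t1; last by rewrite IH //; lra.
have w0' : (size w)%:R = 0 :> R by lra.
have -> : t = 1 by lra.
move/eqP: w0'; rewrite pnatr_eq0 size_eq0 => /eqP ->.
by rewrite letter_path1 /bword_perm big_nil perm1.
Qed.

Lemma string_path_inj w t : injective (fun j => string_path w j t : C).
Proof.
elim: w t => [|a w IH] t j k /=.
  by move=> -[/eqP]; rewrite eqr_nat => /eqP h; exact: val_inj.
by case: (leP t 1) => _; [exact: letter_path_inj|move/IH/perm_inj].
Qed.

Lemma string_path_bnd w j t :
  0 <= (string_path w j t : C).1 <= n%:R - 1 /\ `|(string_path w j t : C).2| <= 2^-1.
Proof.
elim: w j t => [|a w IH] j t /=.
  rewrite normr0 invr_ge0; split=> //; rewrite ler0n /=.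
  have : (j : nat).+1%:R <= n%:R :> R by rewrite ler_nat.
  by rewrite -natr1; lra.
by case: (leP t 1) => _; [exact: letter_path_bnd|exact: IH].
Qed.

Lemma string_path_cat l y j t : 0 <= t -> string_path (l ++ y) j t =
  if t <= (size l)%:R then string_path l j t
  else string_path y (bword_perm l j) (t - (size l)%:R).
Proof.
elim: l j t => [|a l IH] j t t0 /=.
  rewrite subr0 /bword_perm big_nil perm1; case: leP => // t0'.
  have -> : t = 0 by lra.
  exact: string_path0.
rewrite bword_perm_cons permM -natr1; case: (leP t 1) => t1.
  by rewrite (le_trans t1) // lerDr.
rewrite IH; last by lra.
rewrite lerBlDr (_ : t - 1 - (size l)%:R = t - ((size l)%:R + 1)) //; ring.
Qed.

Definition wpath w (phi : R -> R) j u : C := string_path w j (phi u).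

Lemma wpath_cont w (phi : R -> R) j : continuous phi -> continuous (wpath w phi j).
Proof.
move=> cphi u; apply: (@catcomp _ _ _ phi (string_path w j)); last exact: cphi.
exact: string_path_cont.
Qed.

(** At every single time the strings are distinct, so the two clocks may be interpolated linearly.
    Strings rest after time [size w], hence a clock may overshoot. *)
Lemma cl_reparam w (phi psi : R -> R) : continuous phi -> continuous psi ->
  phi 0 = 0 -> psi 0 = 0 -> (size w)%:R <= phi 1 -> (size w)%:R <= psi 1 ->
  isotopic (cl (wpath w phi)) (cl (wpath w psi)).
Proof.
move=> cphi cpsi phi0 psi0 phi1 psi1.
pose h s j u : C := string_path w j ((1 - s) * phi u + s * psi u).
have -> : cl (wpath w phi) = cl (h 0).
  by apply: eq_cl => j u _; rewrite /h subr0 mul1r mul0r addr0.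
have -> : cl (wpath w psi) = cl (h 1).
  by apply: eq_cl => j u _; rewrite /h subrr mul1r mul0r add0r.
apply: (@cl_homotopy _ _ h (bword_perm w)).
- move=> j q; have cs := @string_path_cont w j.
  apply: (@catcomp _ _ _ (fun q : R * R => (1 - q.1) * phi q.2 + q.1 * psi q.2) (string_path w j)); first exact: cs.
  by cont.
- by move=> s u j k _ _ jk; apply: contraNneq jk => /string_path_inj ->.
- move=> s j s01; rewrite /h phi0 psi0 !mulr0 addr0 string_path0 string_path_end //.
  by have [s0 s1] := andP s01; nra.
Qed.

Lemma closure_bwordE w :
  closure_bword w = cl (wpath w (fun u => (size w).+1%:R * u)) :> set (C * C).
Proof.
have N0 : 0 < (size w).+1%:R :> R by rewrite ltr0n.
rewrite eqEsubset; split=> [z [j [t [tI ->]]]|_ [j [u [u01 ->]]]].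
  move: tI; rewrite in_itv /= => /andP[t0 t1].
  exists j, (t / (size w).+1%:R); split.
    by apply/andP; split; [rewrite divr_ge0 // ltW|rewrite ler_pdivrMr // mul1r].
  have e : (size w).+1%:R * (t / (size w).+1%:R) = t by rewrite mulrC divfK // gt_eqF.
  rewrite -torus_embE /wpath e /turn.
  by rewrite !mulrA.
exists j, ((size w).+1%:R * u); split; last first.
  rewrite -torus_embE /turn /=; congr (torus_emb _ (cos _, sin _)); by field; rewrite gt_eqF.
have [u0 u1] := andP u01.
rewrite in_itv /=; apply/andP; split; first by apply: mulr_ge0 => //; exact: ltW.
by apply: ler_piMr => //; exact: ltW.
Qed.

(** A clock that runs through [l] on the first half of the circle and through [y] on the second,
    whatever their lengths. *)
Definition halves l y u : R :=
  (size l)%:R * Num.min (2 * u) 1 + (size y)%:R * Num.max (2 * u - 1) 0.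

Lemma halves_cont l y : continuous (halves l y).
Proof. by move=> u; rewrite /halves; cont. Qed.

Lemma closure_halves l y :
  isotopic (closure_bword (l ++ y) : set (C * C)) (cl (wpath (l ++ y) (halves l y))).
Proof.
rewrite closure_bwordE; apply: cl_reparam.
- by move=> u; cont.
- exact: halves_cont.
- by rewrite mulr0.
- rewrite /halves mulr0 min_l ?max_r ?mulr0 ?addr0 //; lra.
- by rewrite mulr1 ler_nat.
- by rewrite /halves size_cat natrD min_r ?max_l; lra.
Qed.

Lemma wpath_halves1 l y j u : 0 <= u -> u <= 2^-1 ->
  wpath (l ++ y) (halves l y) j u = string_path l j ((size l)%:R * (2 * u)).
Proof.
move=> u0 u1; rewrite /wpath /halves.
have -> : Num.min (2 * u) 1 = 2 * u by apply: min_l; lra.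
have -> : Num.max (2 * u - 1) 0 = 0 by apply: max_r; lra.
rewrite mulr0 addr0.
have h0 : 0 <= 2 * u by lra.
have h1 : (size l)%:R * (2 * u) <= (size l)%:R by apply: ler_piMr => //; lra.
by rewrite string_path_cat ?h1 // mulr_ge0.
Qed.

Lemma wpath_halves2 l y j u : 2^-1 <= u ->
  wpath (l ++ y) (halves l y) j u =
  string_path y (bword_perm l j) ((size y)%:R * (2 * u - 1)).
Proof.
move=> u1; rewrite /wpath /halves.
have -> : Num.min (2 * u) 1 = 1 by apply: min_r; lra.
have -> : Num.max (2 * u - 1) 0 = 2 * u - 1 by apply: max_l; lra.
rewrite mulr1.
have h : 0 <= (size y)%:R * (2 * u - 1) by apply: mulr_ge0 => //; lra.
rewrite string_path_cat ?addr_ge0 //; case: ifP => [e|_].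
  have h0 : (size y)%:R * (2 * u - 1) = 0 by lra.
  by rewrite h0 addr0 string_path0 string_path_end.
by congr string_path; ring.
Qed.

End StringPaths.

(** * Rotation of closed words *)

Section Rotation.
Context {R : realType} {n : nat}.
Local Notation C := (R * R)%type.
Implicit Types (j k : 'I_n) (a : bletter n) (w l y : bword n) (u s t : R).
Local Notation cb w := (closure_bword w : set (C * C)).

Lemma cb_sphere w : cb w `<=` @sphere3 R.
Proof. by rewrite closure_bwordE; exact: cl_sphere. Qed.

(* Two closed braids are joined by letting the time origin run over half the
   circle. *)
Lemma closure_rot l y : isotopic (cb (l ++ y)) (cb (y ++ l)).
Proof.
apply: isotopic_trans (closure_halves l y) _.
apply: isotopic_trans (isotopic_sym (@cb_sphere _) (closure_halves y l)).
pose g := bword_perm (l ++ y); pose P j u := wpath (l ++ y) (@halves R n l y) j u.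
have cP j : continuous (P j) by apply: wpath_cont; exact: halves_cont.
have P0 j : P j 0 = ((j : nat)%:R, 0).
  by rewrite /P -[LHS]/(wpath _ _ _ _) wpath_halves1 ?mulr0 ?string_path0 ?invr_ge0.
have P1 j : P j 1 = ((g j : nat)%:R, 0).
  rewrite /P -[LHS]/(wpath _ _ _ _) wpath_halves2; last by lra.
  by rewrite string_path_end /g ?bword_perm_cat ?permM //; lra.
(* The string [j] continued beyond time 1 along its successor [g j], so that the time origin can be
   moved. *)
pose X j u := P j (Num.min u 1) + (P (g j) (Num.max (u - 1) 0) - ((g j : nat)%:R, 0)).
have X1 j u : u <= 1 -> X j u = P j u.
  move=> u1; rewrite /X; have -> : Num.min u 1 = u by apply: min_l.
  have -> : Num.max (u - 1) 0 = 0 by apply: max_r; lra.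
  by rewrite P0 subrr addr0.
have X2 j u : 1 <= u -> X j u = P (g j) (u - 1).
  move=> u1; rewrite /X; have -> : Num.min u 1 = 1 by apply: min_r.
  have -> : Num.max (u - 1) 0 = u - 1 by apply: max_l; lra.
  by rewrite P1 addrC subrK.
have Pinj u : injective (fun j => P j u) by move=> j k; exact: string_path_inj.
pose h s j u := X j (u + s / 2).
have -> : cl (wpath (l ++ y) (@halves R n l y)) = cl (h 0).
  by apply: eq_cl => j u /andP[_ u1]; rewrite /h mul0r addr0 X1.
have <- : cl (h 1) = cl (wpath (y ++ l) (@halves R n y l)).
  (* After the half turn of the clock the string [j] is met at its position at the end of [l], which
     explains the relabelling. *)
  rewrite -[RHS](cl_relabel _ (bword_perm l)); apply: eq_cl => j u /andP[u0 u1].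
  rewrite /h mul1r; have [uh|uh] := leP u 2^-1.
    rewrite X1; last by lra.
    rewrite /P -[LHS]/(wpath _ _ _ _) wpath_halves2; last by lra.
    by rewrite wpath_halves1 // (_ : 2 * (u + 2^-1) - 1 = 2 * u) //; field.
  rewrite X2; last by lra.
  rewrite /P -[LHS]/(wpath _ _ _ _) wpath_halves1; [|lra|lra].
  rewrite wpath_halves2; last by lra.
  by rewrite /g bword_perm_cat permM (_ : 2 * (u + 2^-1 - 1) = 2 * u - 1) //; field.
apply: (@cl_homotopy _ _ h g).
- move=> j q; have c1 := cP j; have c2 := cP (g j).
  rewrite (_ : (fun q : R * R => h q.1 j q.2) = fun q : R * R => (
   (P j (Num.min (q.2 + q.1 / 2) 1)).1 +
     ((P (g j) (Num.max (q.2 + q.1 / 2 - 1) 0)).1 - (g j : nat)%:R),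
   (P j (Num.min (q.2 + q.1 / 2) 1)).2 +
     ((P (g j) (Num.max (q.2 + q.1 / 2 - 1) 0)).2 - 0))); first by cont.
  by apply/funext.
- move=> s u j k s01 u01 jk; apply: contraNneq jk; rewrite /h.
  have [v1|v1] := leP (u + s / 2) 1; first by rewrite !X1 // => /Pinj ->.
  by rewrite !X2 ?ltW // => /Pinj/perm_inj ->.
- move=> s j /andP[s0 s1]; rewrite /h X2; last by lra.
  by rewrite X1; [congr P; ring|lra].
Qed.

End Rotation.

(** * Replacing an initial piece of a closed braid *)

Section LocalMoves.
Context {R : realType} {n : nat}.
Local Notation C := (R * R)%type.
Implicit Types (j k : 'I_n) (a : bletter n) (w l y : bword n) (u s t : R).
Local Notation cb w := (closure_bword w : set (C * C)).

(** An arbitrary motion [p] with integer end positions, followed by the word [y]. A relation becomes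
    a homotopy of [p] with fixed ends, while [y] stays as it is. *)
Definition glue (p : 'I_n -> R -> C) (g : 'S_n) y j u : C :=
  p j (Num.min (2 * u) 1) +
  (string_path y (g j) ((size y)%:R * Num.max (2 * u - 1) 0) - ((g j : nat)%:R, 0)).

Lemma glue1 p (g : 'S_n) y j u : u <= 2^-1 -> glue p g y j u = p j (2 * u).
Proof.
move=> u1; rewrite /glue.
have -> : Num.min (2 * u) 1 = 2 * u by apply: min_l; lra.
have -> : Num.max (2 * u - 1) 0 = 0 by apply: max_r; lra.
by rewrite mulr0 string_path0 subrr addr0.
Qed.

Lemma glue2 p (g : 'S_n) y j u : p j 1 = ((g j : nat)%:R, 0) -> 2^-1 <= u ->
  glue p g y j u = string_path y (g j) ((size y)%:R * (2 * u - 1)).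
Proof.
move=> p1 u1; rewrite /glue.
have -> : Num.min (2 * u) 1 = 1 by apply: min_r; lra.
have -> : Num.max (2 * u - 1) 0 = 2 * u - 1 by apply: max_l; lra.
by rewrite p1 addrC subrK.
Qed.

Definition word_path l j t : C := string_path l j ((size l)%:R * t).

Lemma word_path0 l j : word_path l j 0 = ((j : nat)%:R, 0).
Proof. by rewrite /word_path mulr0 string_path0. Qed.

Lemma word_path1 l j : word_path l j 1 = ((bword_perm l j : nat)%:R, 0).
Proof. by rewrite /word_path mulr1 string_path_end. Qed.

Lemma word_path_cont l j : continuous (word_path l j).
Proof.
move=> t; apply: (@catcomp _ _ _ (fun t => (size l)%:R * t) (string_path l j)); last by cont.
exact: string_path_cont.
Qed.

Lemma closure_glue l y :
  isotopic (cb (l ++ y)) (cl (glue (word_path l) (bword_perm l) y)).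
Proof.
apply: isotopic_trans (closure_halves l y) _.
have -> : cl (wpath (l ++ y) (@halves R n l y)) = cl (glue (word_path l) (bword_perm l) y).
  apply: eq_cl => j u /andP[u0 u1]; have [uh|uh] := leP u 2^-1.
    by rewrite wpath_halves1 // glue1.
  by rewrite wpath_halves2 ?ltW // glue2 ?ltW // word_path1.
exact: isotopic_refl.
Qed.

Lemma glue_homotopy (p : R -> 'I_n -> R -> C) (g : 'S_n) y :
  (forall j, continuous (fun q : R * R => p q.1 j q.2)) ->
  (forall s t j k, 0 <= s <= 1 -> 0 <= t <= 1 -> j != k -> p s j t != p s k t) ->
  (forall s j, p s j 0 = ((j : nat)%:R, 0)) ->
  (forall s j, p s j 1 = ((g j : nat)%:R, 0)) ->
  isotopic (cl (glue (p 0) g y)) (cl (glue (p 1) g y)).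
Proof.
move=> pc pi p0 p1.
apply: (@cl_homotopy _ _ (fun s => glue (p s) g y) (g * bword_perm y)%g).
- move=> j q; rewrite (_ : (fun q : R * R => glue (p q.1) g y j q.2) = fun q => (
    (p q.1 j (Num.min (2 * q.2) 1)).1 + ((string_path y (g j)
       ((size y)%:R * Num.max (2 * q.2 - 1) 0)).1 - (g j : nat)%:R),
    (p q.1 j (Num.min (2 * q.2) 1)).2 + ((string_path y (g j)
       ((size y)%:R * Num.max (2 * q.2 - 1) 0)).2 - 0))); last exact/funext.
  have c1 : continuous (fun q : R * R => p q.1 j (Num.min (2 * q.2) 1)).
    move=> q'; apply: (@catcomp _ _ _ (fun q : R * R => (q.1, Num.min (2 * q.2) 1))
      (fun q => p q.1 j q.2)); [exact: pc|cont].
  have c2 := @string_path_cont R n y (g j).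
  by cont.
- move=> s u j k s01 /andP[u0 u1] jk; have [uh|uh] := leP u 2^-1.
    rewrite !glue1 //; apply: pi => //; lra.
  rewrite !glue2 ?ltW //; apply: contraNneq jk => /string_path_inj/perm_inj -> //.
- move=> s j s01; rewrite glue2 //; last by lra.
  rewrite glue1 ?mulr0 ?p0 ?invr_ge0 // string_path_end ?permM //; lra.
Qed.

Lemma closure_cancel a y : isotopic (cb ([:: a; bletter_inv a] ++ y)) (cb ([::] ++ y)).
Proof.
apply: isotopic_trans (closure_glue _ _) _.
apply: isotopic_trans (isotopic_sym (@cb_sphere _ _ _) (closure_glue _ _)).
have -> : bword_perm [:: a; bletter_inv a] = bword_perm [::] :> 'S_n.
  exact/bword_perm_eq/braid_eq_inv.
(* Go the fraction [1 - s] of the way along the letter and return: for [s = 0] this is the letter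
   followed by its inverse, which is the letter run backwards, and for [s = 1] it is the constant
   motion. *)
pose p s j t : C := letter_path a j ((1 - s) * Num.min (2 * t) (2 - 2 * t)).
have g1 : bword_perm [::] = 1%g :> 'S_n by rewrite /bword_perm big_nil.
rewrite g1; have E0 : forall j u, 0 <= u <= 1 ->
    glue (word_path [:: a; bletter_inv a]) 1 y j u = glue (p 0) 1 y j u.
  move=> j u /andP[u0 u1]; rewrite /glue; congr (_ + _).
  have [t t01 ->] : exists2 t, 0 <= t <= 1 & Num.min (2 * u) 1 = t.
    by exists (Num.min (2 * u) 1) => //; rewrite le_min ge_min lexx orbT ler01 andbT; lra.
  rewrite /word_path /p subr0 mul1r /=; have [t1|t1] := leP (2 * t) 1.
    by rewrite min_l //; lra.
  have -> : 2 * t - 1 <= 1 by lra.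
  have -> : Num.min (2 * t) (2 - 2 * t) = 2 - 2 * t by apply: min_r; lra.
  rewrite /letter_path -[tperm _ _ j]/(lswap a j) lswapP.
  have -> : pi * (2 * t - 1) = pi - pi * (2 - 2 * t) by ring.
  rewrite cosB sinB cospi sinpi mulN1r !mul0r addr0 sub0r mulN1r.
  set th := pi * _; have sgn : (if ~~ a.2 then 1 else -1) = - (if a.2 then 1 else -1) :> R.
    by case: (a.2); rewrite ?opprK.
  rewrite /= sgn; have lr := lpos_neq_rpos a.
  set e : R := if a.2 then 1 else -1; clearbody e; move: (cos th) (sin th) => ct st.
  have [_|jl] := eqVneq j (lpos a.1).
    by rewrite eq_sym (negbTE lr) eqxx; congr (_, _); ring.
  have [_|jr] := eqVneq j (rpos a.1); first by rewrite eqxx; congr (_, _); ring.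
  by rewrite (negbTE jl) (negbTE jr).
have E1 : forall j u, 0 <= u <= 1 -> glue (word_path [::]) 1 y j u = glue (p 1) 1 y j u.
  by move=> j u _; rewrite /glue /p subrr mul0r letter_path0.
rewrite (eq_cl E0) (eq_cl E1); apply: glue_homotopy.
- move=> j q; apply: (@catcomp _ _ _ (fun q : R * R => (1 - q.1) * Num.min (2 * q.2) (2 - 2 * q.2))
    (letter_path a j)); [exact: letter_path_cont|cont].
- by move=> s t j k _ _ jk; apply: contraNneq jk => /letter_path_inj ->.
- move=> s j; rewrite /p; have -> : Num.min (2 * 0) (2 - 2 * 0) = 0 :> R.
    by rewrite min_l; lra.
  by rewrite mulr0 letter_path0.
- move=> s j; rewrite perm1 /p; have -> : Num.min (2 * 1) (2 - 2 * 1) = 0 :> R.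
    by rewrite min_r; lra.
  by rewrite mulr0 letter_path0.
Qed.

(** In the projection to the first coordinate, strings that start further left stay below; the
    strings can then be stacked in layers ordered by their starting points. *)
Definition passes_under (p : 'I_n -> R -> C) := forall t j k, 0 <= t <= 1 ->
  (j < k)%N -> (p j t).1 = (p k t).1 -> (p j t).2 < (p k t).2.

(* The second coordinates may be replaced by j * t * (1 - t), which separates
   the strings for 0 < t < 1, whatever the first coordinates are. *)
Lemma glue_layered (p : 'I_n -> R -> C) (g : 'S_n) y : passes_under p ->
  (forall j, continuous (p j)) ->
  (forall j, p j 0 = ((j : nat)%:R, 0)) -> (forall j, p j 1 = ((g j : nat)%:R, 0)) ->
  isotopic (cl (glue p g y))
    (cl (glue (fun j t => ((p j t).1, (j : nat)%:R * (t * (1 - t)))) g y)).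
Proof.
move=> pu pc p0 p1.
pose h s j t : C := ((p j t).1, (1 - s) * (p j t).2 + s * ((j : nat)%:R * (t * (1 - t)))).
have <- : h 0 = p.
  apply/funext => j; apply/funext => t; rewrite /h subr0 mul1r mul0r addr0.
  exact/esym/surjective_pairing.
have -> : (fun j t => ((h 0 j t).1, (j : nat)%:R * (t * (1 - t)))) = h 1.
  by apply/funext => j; apply/funext => t; rewrite /h /= subrr mul1r mul0r add0r.
apply: glue_homotopy.
- by move=> j q; have c := pc j; rewrite /h; cont.
- suff key s t j k : 0 <= s <= 1 -> 0 <= t <= 1 -> (j < k)%N -> h s j t <> h s k t.
    move=> s t j k s01 t01; rewrite -val_eqE neq_ltn => /orP[jk|kj].
      by apply/eqP; exact: key.
    by rewrite eq_sym; apply/eqP; exact: key.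
  move=> s01 t01 jk [e1 e2]; have lt := pu t j k t01 jk e1.
  have jk' : (j : nat)%:R < (k : nat)%:R :> R by rewrite ltr_nat.
  (* For [s < 1] the original heights already differ. For [s = 1] the layers do so once 0 < t < 1,
     and the two end times are impossible because distinct strings have distinct integer positions
     there. *)
  have [s1|s1] := eqVneq s 1; last first.
    have /andP[s0 s1'] := s01; have s1'' : s < 1 by rewrite lt_neqAle s1.
    have /andP[t0 t1] := t01.
    have w0 : 0 <= t * (1 - t) by apply: mulr_ge0; lra.
    have A : 0 < (1 - s) * ((p k t).2 - (p j t).2) by apply: mulr_gt0; lra.
    have B : 0 <= s * (((k : nat)%:R - (j : nat)%:R) * (t * (1 - t))).
      by apply: mulr_ge0 => //; apply: mulr_ge0 => //; rewrite subr_ge0 ltW.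
    by lra.
  have t0 : 0 < t.
    have /andP[t0 _] := t01; rewrite lt_neqAle t0 andbT eq_sym; apply: contraTneq isT => te.
    by move: e1; rewrite te !p0 /=; lra.
  have t1 : t < 1.
    have /andP[_ t1] := t01; rewrite lt_neqAle t1 andbT; apply: contraTneq isT => te.
    move: e1; rewrite te !p1 /= => /eqP; rewrite eqr_nat => /eqP/val_inj/perm_inj jk2.
    by rewrite jk2 ltnn in jk.
  have w0 : 0 < t * (1 - t) by apply: mulr_gt0; lra.
  have : 0 < ((k : nat)%:R - (j : nat)%:R) * (t * (1 - t)) by rewrite mulr_gt0 // subr_gt0.
  by move: e2; rewrite s1; lra.
- by move=> s j; rewrite /h p0 /=; congr (_, _); ring.
- by move=> s j; rewrite /h p1 /=; congr (_, _); ring.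
Qed.

(** Once the strings lie in layers their first coordinates are free, so only the end positions
    matter: this is the geometric reason why a positive permutation braid is determined by its
    permutation. *)
Lemma glue_passes_under (p q : 'I_n -> R -> C) (g : 'S_n) y :
  passes_under p -> passes_under q ->
  (forall j, continuous (p j)) -> (forall j, continuous (q j)) ->
  (forall j, p j 0 = ((j : nat)%:R, 0)) -> (forall j, p j 1 = ((g j : nat)%:R, 0)) ->
  (forall j, q j 0 = ((j : nat)%:R, 0)) -> (forall j, q j 1 = ((g j : nat)%:R, 0)) ->
  isotopic (cl (glue p g y)) (cl (glue q g y)).
Proof.
move=> pu qu pc qc p0 p1 q0 q1.
apply: isotopic_trans (glue_layered y pu pc p0 p1) _.
apply: isotopic_trans (isotopic_sym (@cl_sphere _ _ _) (glue_layered y qu qc q0 q1)).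
pose h s j t : C := ((1 - s) * (p j t).1 + s * (q j t).1, (j : nat)%:R * (t * (1 - t))).
have E0 j u : 0 <= u <= 1 -> glue (fun j t => ((p j t).1, (j : nat)%:R * (t * (1 - t)))) g y j u = glue (h 0) g y j u.
  by move=> _; rewrite /glue /h subr0 mul1r mul0r addr0.
have E1 j u : 0 <= u <= 1 -> glue (fun j t => ((q j t).1, (j : nat)%:R * (t * (1 - t)))) g y j u = glue (h 1) g y j u.
  by move=> _; rewrite /glue /h subrr mul1r mul0r add0r.
rewrite (eq_cl E0) (eq_cl E1).
have h0 s j : h s j 0 = ((j : nat)%:R, 0) by rewrite /h p0 q0 /=; congr (_, _); ring.
have h1 s j : h s j 1 = ((g j : nat)%:R, 0) by rewrite /h p1 q1 /=; congr (_, _); ring.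
apply: glue_homotopy => //.
- by move=> j q'; have c := pc j; have c' := qc j; rewrite /h; cont.
- move=> s t j k s01 /andP[t0 t1]; apply: contra => /eqP e.
  have [te|tn0] := eqVneq t 0.
    by move: e; rewrite te !h0 => -[/eqP]; rewrite eqr_nat.
  have [te|tn1] := eqVneq t 1.
    by move: e; rewrite te !h1 => -[/eqP]; rewrite eqr_nat => /eqP/val_inj/perm_inj ->.
  move: e => -[_ /eqP]; rewrite (inj_eq (mulIf _)) ?eqr_nat //.
  by rewrite mulf_neq0 // subr_eq0 eq_sym.
Qed.

End LocalMoves.

(** * Braid relations *)

Section Crossings.
Context {n : nat}.
Implicit Types (i : 'I_n.-1) (w : seq 'I_n.-1) (j k : 'I_n).

Lemma val_swap i j : tperm (lpos i) (rpos i) j =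
  (if (j : nat) == i then i.+1 else if (j : nat) == i.+1 then i : nat else j) :> nat.
Proof.
have := lswapP (i, true) j; rewrite /lswap /= => ->.
by rewrite -!val_eqE /=; case: eqP => // _; case: eqP.
Qed.

Lemma meet_ltE i j k : (j < k)%N ->
  ([set j; k] == [set lpos i; rpos i])%SET = ((j : nat) == i) && ((k : nat) == i.+1).
Proof.
move=> jk; apply/eqP/andP => [e|[/eqP ji /eqP ki]].
  have : j \in [set lpos i; rpos i]%SET by rewrite -e set21.
  have : k \in [set lpos i; rpos i]%SET by rewrite -e set22.
  have : rpos i \in [set j; k]%SET by rewrite e set22.
  rewrite !inE -!val_eqE /=; lia.
have -> : j = lpos i by exact: val_inj.
by have -> : k = rpos i by exact: val_inj.
Qed.

Lemma crossings_sym w j k : crossings w j k = crossings w k j.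
Proof. by elim: w j k => [//|i w IH] j k /=; rewrite IH finset.setUC. Qed.

End Crossings.

Section Positive.
Context {R : realType} {n : nat}.
Local Notation C := (R * R)%type.
Implicit Types (i : 'I_n.-1) (w : seq 'I_n.-1) (j k : 'I_n) (t : R).
Local Notation sp w j t := (string_path (posword w) j t : C).

Lemma letter_path_lt i j k t : (j < k)%N -> ~~ (((j : nat) == i) && ((k : nat) == i.+1)) ->
  (letter_path (i, true) j t : C).1 < (letter_path (i, true) k t : C).1.
Proof.
move=> jk njk; rewrite /letter_path /= -!val_eqE /=.
have := cos_le1 (pi * t); have := cos_geN1 (pi * t); move: (cos _) (sin _) => c s c1 c2.
have H (a b : nat) : (a < b)%N -> a%:R + 1 <= b%:R :> R by move=> ab; rewrite natr1 ler_nat.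
have [ji|ji] := eqVneq (j : nat) i; have [ki|ki] := eqVneq (k : nat) i => /=.
- by move: jk; rewrite ji ki ltnn.
- have -> : ((k : nat) == i.+1) = false by move: njk; rewrite ji eqxx => /negbTE.
  have : (i.+1 < k)%N by move: jk njk ki; rewrite ji eqxx /=; lia.
  by move=> /H; rewrite /= -natr1; lra.
- have -> : ((j : nat) == i.+1) = false by lia.
  by have := H j i ltac:(lia); rewrite /=; lra.
have [ji'|ji'] := eqVneq (j : nat) i.+1; have [ki'|ki'] := eqVneq (k : nat) i.+1 => /=.
- by move: jk; rewrite ji' ki' ltnn.
- by have := H i.+1 k ltac:(lia); rewrite -natr1; lra.
- by have := H j i ltac:(lia); lra.
- by rewrite ltr_nat.
Qed.

Lemma string_path_lt w j k t : crossings w j k = 0%N -> (j < k)%N ->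
  (sp w j t).1 < (sp w k t).1.
Proof.
elim: w j k t => [|i w IH] j k t /=; first by rewrite ltr_nat.
move=> /eqP; rewrite addn_eq0 => /andP[+ /eqP cr] jk.
rewrite meet_ltE // eqb0 => njk; case: (leP t 1) => _; first exact: letter_path_lt.
apply: IH => //; move: njk jk; rewrite !val_swap.
do 4?[case: ifP => ?]; lia.
Qed.

(* Only the pair that crosses can have equal first coordinates, halfway through
   its crossing, where the string starting on the left passes below. *)
Lemma positive_under w j k t : (forall x y : 'I_n, x != y -> (crossings w x y <= 1)%N) ->
  0 <= t -> (j < k)%N -> (sp w j t).1 = (sp w k t).1 -> (sp w j t).2 < (sp w k t).2.
Proof.
elim: w j k t => [|i w IH] j k t /= cr t0 jk; first by move/eqP; rewrite eqr_nat => /eqP; lia.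
have crw x y : x != y -> (crossings w x y <= 1)%N.
  move=> xy; have := cr (tperm (lpos i) (rpos i) x) (tperm (lpos i) (rpos i) y).
  rewrite !tpermK (inj_eq (@perm_inj _ _)) => /(_ xy); lia.
have jk' : j != k by rewrite -val_eqE neq_ltn jk.
case: (leP t 1) => t1; last first.
  (* If the pair crosses at this letter, it never crosses again; its order is reversed from then on
     and the first coordinates cannot agree. *)
  have [/andP[/eqP ji /eqP ki]|njk] := boolP (((j : nat) == i) && ((k : nat) == i.+1)).
    have := cr j k jk'; rewrite meet_ltE // ji ki !eqxx /= add1n ltnS leqn0 => /eqP c0.
    have lt : (tperm (lpos i) (rpos i) k < tperm (lpos i) (rpos i) j)%N.
      by rewrite !val_swap ji ki eqxx eqn_leq ltnn /= eqxx.
    rewrite crossings_sym in c0; have h := string_path_lt (t - 1) c0 lt.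
    by move=> e; move: h; rewrite e ltxx.
  apply: IH => //; first by lra.
  move: njk jk; rewrite !val_swap.
  do 4?[case: ifP => ?]; lia.
have [/andP[/eqP ji /eqP ki]|njk] := boolP (((j : nat) == i) && ((k : nat) == i.+1)); last first.
  by move=> e; have := letter_path_lt t jk njk; rewrite e ltxx.
have -> : j = lpos i by exact: val_inj.
have -> : k = rpos i by exact: val_inj.
rewrite /letter_path /= eqxx eq_sym (negbTE (lpos_neq_rpos (i, true))) eqxx /= => e.
have c0 : cos (pi * t) = 0 :> R by lra.
have s0 : 0 <= sin (pi * t) by apply: sin_ge0_pi; have := pi_gt0 R; nra.
have := cos2Dsin2 (pi * t); rewrite c0 expr0n add0r => s1.
by nra.
Qed.

Lemma posword_cat (u v : seq 'I_n.-1) : posword (u ++ v) = posword u ++ posword v.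
Proof. exact: map_cat. Qed.

Lemma positive_passes_under w : (forall x y : 'I_n, x != y -> (crossings w x y <= 1)%N) ->
  passes_under (word_path (posword w) : 'I_n -> R -> C).
Proof.
move=> cr t j k /andP[t0 t1] jk; apply: positive_under => //; exact: mulr_ge0.
Qed.

(** Both sides of either braid relation are positive words in which pairs cross at most once, with
    equal permutations, so this one homotopy covers both relations. *)
Lemma closure_positive (u v : seq 'I_n.-1) (y : bword n) :
  (forall j k : 'I_n, j != k -> (crossings u j k <= 1)%N) ->
  (forall j k : 'I_n, j != k -> (crossings v j k <= 1)%N) ->
  bword_perm (posword u) = bword_perm (posword v) ->
  isotopic (closure_bword (posword u ++ y) : set (C * C)) (closure_bword (posword v ++ y)).
Proof.
move=> cu cv uv; apply: isotopic_trans (closure_glue _ _) _.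
apply: isotopic_trans (isotopic_sym (@cb_sphere _ _ _) (closure_glue _ _)).
rewrite uv; apply: glue_passes_under.
- exact: positive_passes_under.
- exact: positive_passes_under.
- by move=> j; exact: word_path_cont.
- by move=> j; exact: word_path_cont.
- by move=> j; exact: word_path0.
- by move=> j; rewrite word_path1 uv.
- by move=> j; exact: word_path0.
- by move=> j; rewrite word_path1.
Qed.

End Positive.

Section Relations.
Context {R : realType} {n : nat}.
Local Notation C := (R * R)%type.
Implicit Types (u v x y : bword n).
Local Notation cb w := (closure_bword w : set (C * C)).

Lemma wlog_crossings (w : seq 'I_n.-1) :
  (forall j k : 'I_n, (j < k)%N -> (crossings w j k <= 1)%N) ->
  forall j k : 'I_n, j != k -> (crossings w j k <= 1)%N.
Proof.
move=> h j k; rewrite -val_eqE neq_ltn => /orP[/h//|/h].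
by rewrite crossings_sym.
Qed.

Lemma meetE (i : 'I_n.-1) (j k : 'I_n) :
  ([set j; k] == [set lpos i; rpos i])%SET =
  ((j : nat) == i) && ((k : nat) == i.+1) || ((k : nat) == i) && ((j : nat) == i.+1).
Proof.
have [jk|jk|jk] := ltngtP j k.
- by rewrite meet_ltE //; lia.
- by rewrite finset.setUC meet_ltE //; lia.
have -> : j = k by exact: val_inj.
rewrite finset.setUid; apply/eqP; rewrite ifN; last by lia.
move/(congr1 (fun A : {set 'I_n} => #|A|)); rewrite cards1 cards2.
by rewrite (lpos_neq_rpos (i, true)).
Qed.

Lemma crossings_comm (i j : 'I_n.-1) : (i.+2 <= j)%N || (j.+2 <= i)%N ->
  forall x y : 'I_n, x != y -> (crossings [:: i; j] x y <= 1)%N.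
Proof.
move=> ij; apply: wlog_crossings => x y xy /=.
rewrite !meetE !val_swap addn0.
case: (eqVneq (x : nat) i) => ?; case: (eqVneq (y : nat) i.+1) => ?;
case: (eqVneq (x : nat) i.+1) => ?; case: (eqVneq (y : nat) i) => ? /=; lia.
Qed.

Lemma crossings_braid (i j : 'I_n.-1) : (j = i.+1 :> nat) \/ (i = j.+1 :> nat) ->
  forall x y : 'I_n, x != y -> (crossings [:: i; j; i] x y <= 1)%N.
Proof.
move=> ij; apply: wlog_crossings => x y xy /=.
rewrite !meetE !val_swap addn0.
case: (eqVneq (x : nat) i) => ?; case: (eqVneq (y : nat) i.+1) => ?;
case: (eqVneq (x : nat) i.+1) => ?; case: (eqVneq (y : nat) i) => ? /=;
case: (eqVneq _ (j : nat)) => ?; case: (eqVneq _ j.+1) => ? /=; do 8?[case: ifP => ?]; lia.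
Qed.

(** The context [x], [y] is what lets the induction pass through the congruence rule for
    concatenation. *)
Theorem closure_braid_eq u v : braid_eq u v ->
  forall x y, isotopic (cb (x ++ u ++ y)) (cb (x ++ v ++ y)).
Proof.
(* Rotation brings the relation to the front of the word, where the initial piece can be replaced,
   and then back. *)
have base l r : (forall y, isotopic (cb (l ++ y)) (cb (r ++ y))) ->
    forall x y, isotopic (cb (x ++ l ++ y)) (cb (x ++ r ++ y)).
  move=> h x y; apply: isotopic_trans (closure_rot _ _) _; rewrite -catA.
  apply: isotopic_trans (h _) _; rewrite catA; exact: closure_rot.
elim=> {u v}.
- by move=> u x y; exact: isotopic_refl.
- by move=> u v _ IH x y; apply: isotopic_sym (IH x y); exact: cb_sphere.
- by move=> u v w _ IH1 _ IH2 x y; apply: isotopic_trans (IH1 x y) (IH2 x y).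
- move=> u u' v v' _ IH1 _ IH2 x y; rewrite -!catA.
  apply: isotopic_trans (IH1 x (v ++ y)) _; rewrite !(catA x).
  exact: IH2.
- by move=> a; apply: base => y; exact: closure_cancel.
- move=> i j ij; apply: base => y.
  apply: (@closure_positive _ _ [:: i; j] [:: j; i]).
  + by apply: crossings_comm; rewrite ij.
  + by apply: crossings_comm; rewrite ij orbT.
  + exact/bword_perm_eq/braid_eq_comm.
- move=> i j ij; apply: base => y.
  apply: (@closure_positive _ _ [:: i; j; i] [:: j; i; j]).
  + by apply: crossings_braid; left.
  + by apply: crossings_braid; right.
  + exact/bword_perm_eq/braid_eq_braid.
Qed.

Corollary closure_of_eq u v : braid_eq u v -> isotopic (cb u) (cb v).
Proof. by move=> /closure_braid_eq/(_ [::] [::]); rewrite !cats0. Qed.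

End Relations.

(** * Positive permutation braids *)

Section PermutationBraids.
Context {n : nat}.
Implicit Types (i j : 'I_n.-1) (u v w : seq 'I_n.-1) (x y : 'I_n).
Local Notation perm_of w := (bword_perm (posword w)).

Definition simple_crossings w := forall x y, x != y -> (crossings w x y <= 1)%N.

Lemma simple_behead i w : simple_crossings (i :: w) -> simple_crossings w.
Proof.
move=> cr x y xy; have := cr (tperm (lpos i) (rpos i) x) (tperm (lpos i) (rpos i) y).
rewrite /= !tpermK (inj_eq (@perm_inj _ _)) => /(_ xy); lia.
Qed.

Lemma perm_ofE i w x : perm_of (i :: w) x = perm_of w (tperm (lpos i) (rpos i) x).
Proof. by rewrite /= bword_perm_cons permM. Qed.

Lemma crossings0_perm w x y : crossings w x y = 0%N -> (x < y)%N ->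
  (perm_of w x < perm_of w y)%N.
Proof.
elim: w x y => [|i w IH] x y; first by rewrite /bword_perm big_nil !perm1.
rewrite [crossings _ _ _]/= => /eqP; rewrite addn_eq0 => /andP[+ /eqP cr] xy.
rewrite meet_ltE // eqb0 => nxy; rewrite !perm_ofE; apply: IH => //.
by move: nxy xy; rewrite !val_swap; do 4?[case: ifP => ?]; lia.
Qed.

Lemma crossings1_perm w x y : simple_crossings w -> crossings w x y = 1%N -> (x < y)%N ->
  (perm_of w y < perm_of w x)%N.
Proof.
elim: w x y => [//|i w IH] x y cr; rewrite [crossings _ _ _]/= => + xy.
rewrite meet_ltE // !perm_ofE.
have [/andP[/eqP xi /eqP yi]|nxy] := boolP (_ && _).
  rewrite add1n => -[c0]; apply: crossings0_perm; first by rewrite crossings_sym.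
  by rewrite !val_swap xi yi eqxx eqn_leq ltnn /= eqxx.
rewrite add0n => c1; apply: IH => //; first exact: simple_behead cr.
by move: nxy xy; rewrite !val_swap; do 4?[case: ifP => ?]; lia.
Qed.

Lemma simple_descent i w : simple_crossings (i :: w) ->
  (perm_of (i :: w) (rpos i) < perm_of (i :: w) (lpos i))%N.
Proof.
move=> cr; apply: crossings1_perm => //.
have := cr (lpos i) (rpos i) (lpos_neq_rpos (i, true)).
by rewrite /= eqxx; lia.
Qed.

Lemma crossings_cat u v x y :
  crossings (u ++ v) x y = (crossings u x y + crossings v (perm_of u x) (perm_of u y))%N.
Proof.
elim: u x y => [|i u IH] x y; first by rewrite /bword_perm big_nil !perm1.
by rewrite !perm_ofE /= IH addnA.
Qed.

(** In a simple word two strings cross exactly when the permutation inverts them. *)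
Lemma crossings_perm u v x y : simple_crossings u -> simple_crossings v ->
  perm_of u = perm_of v -> x != y -> crossings u x y = crossings v x y.
Proof.
move=> cu cv uv; wlog xy : x y / (x < y)%N.
  move=> h; rewrite -val_eqE neq_ltn => /orP[xy|yx]; first by apply: h; rewrite // neq_ltn xy.
  by rewrite crossings_sym [RHS]crossings_sym; apply: h; rewrite // neq_ltn yx.
move=> nxy; have := cu x y nxy; have := cv x y nxy.
have c0 := @crossings0_perm; have c1 := @crossings1_perm.
case Eu: (crossings u x y) => [|[|//]]; case Ev: (crossings v x y) => [|[|//]] // _ _.
  by have := c0 u x y Eu xy; have := c1 v x y cv Ev xy; rewrite uv; lia.
by have := c0 v x y Ev xy; have := c1 u x y cu Eu xy; rewrite uv; lia.
Qed.

(** Besides equality in the braid group this records the length, which drives the induction of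
    [exchange], and the crossing numbers, which carry simplicity from one word to the other. *)
Definition similar u v := [/\ braid_eq (posword u) (posword v),
  size u = size v & forall x y, x != y -> crossings u x y = crossings v x y].

Lemma similar_refl u : similar u u.
Proof. by split=> //; exact: braid_eq_refl. Qed.

Lemma similar_trans u v w : similar u v -> similar v w -> similar u w.
Proof.
move=> [e1 s1 c1] [e2 s2 c2]; split; first exact: braid_eq_trans e1 e2.
- by rewrite s1.
- by move=> x y xy; rewrite c1 // c2.
Qed.

Lemma similar_cons i u v : similar u v -> similar (i :: u) (i :: v).
Proof.
move=> [e s c]; split=> [||x y xy] /=; last by rewrite c // (inj_eq perm_inj).
- exact: (@braid_eq_cat _ [:: (i, true)] _ _ _ (braid_eq_refl _) e).
- by rewrite s.
Qed.

Lemma similar_catr u v w : similar u v -> similar (u ++ w) (v ++ w).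
Proof.
move=> [e s c]; split=> [||x y xy]; last first.
- by rewrite !crossings_cat c // (bword_perm_eq e).
- by rewrite !size_cat s.
- by rewrite !posword_cat; exact: braid_eq_cat e (braid_eq_refl _).
Qed.

Lemma similar_comm i j w : (i.+2 <= j)%N || (j.+2 <= i)%N ->
  similar [:: i, j & w] [:: j, i & w].
Proof.
move=> ij; apply: (@similar_catr [:: i; j] [:: j; i] w); split=> //.
  by case/orP: ij => ij; [|apply: braid_eq_sym]; exact: braid_eq_comm.
move=> x y; apply: crossings_perm; [exact: crossings_comm|by apply: crossings_comm; rewrite orbC|].
by apply: bword_perm_eq; case/orP: ij => ij; [|apply: braid_eq_sym]; exact: braid_eq_comm.
Qed.

Lemma similar_braid i j w : (j = i.+1 :> nat) \/ (i = j.+1 :> nat) ->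
  similar [:: i, j, i & w] [:: j, i, j & w].
Proof.
move=> ij; apply: (@similar_catr [:: i; j; i] [:: j; i; j] w); split=> //.
  by case: ij => ij; [|apply: braid_eq_sym]; exact: braid_eq_braid.
move=> x y; apply: crossings_perm; [exact: crossings_braid|by apply: crossings_braid; case: ij; [right|left]|].
by apply: bword_perm_eq; case: ij => ij; [|apply: braid_eq_sym]; exact: braid_eq_braid.
Qed.

Lemma similar_perm u v : similar u v -> perm_of u = perm_of v.
Proof. by case=> /bword_perm_eq. Qed.

Lemma similar_simple u v : similar u v -> simple_crossings u -> simple_crossings v.
Proof. by move=> [_ _ c] cr x y xy; rewrite -c //; exact: cr. Qed.

Lemma tperm_far i j : (i.+2 <= j)%N || (j.+2 <= i)%N ->
  tperm (lpos i) (rpos i) (lpos j) = lpos j /\ tperm (lpos i) (rpos i) (rpos j) = rpos j.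
Proof.
by move=> ij; split; apply: val_inj; rewrite /= val_swap /=; do 2?[case: ifP => ?]; lia.
Qed.

(** The exchange property of the symmetric group, realized by braid relations: a descent of the
    permutation can be brought to the front. If the first letter [i] commutes with [j], the descent
    passes to the tail; if they are adjacent, the word is first brought to the form i j i ..., and
    then a braid relation applies. *)
Lemma exchange u j : simple_crossings u ->
  (perm_of u (rpos j) < perm_of u (lpos j))%N -> exists v, similar u (j :: v).
Proof.
move: {2}(size u).+1 (ltnSn (size u)) => m; elim: m u j => // m IH [|i u] j.
  by rewrite /bword_perm big_nil !perm1 /=; lia.
rewrite ltnS => su cr desc.
have [ij|ij] := eqVneq i j; first by exists u; rewrite ij; exact: similar_refl.
have cu := simple_behead cr; have di := simple_descent cr.
have [far|near] := boolP ((i.+2 <= j)%N || (j.+2 <= i)%N).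
  have [f1 f2] := tperm_far far.
  have [|v uv] := IH u j su cu; first by move: desc; rewrite !perm_ofE f1 f2.
  exists (i :: v); apply: similar_trans (similar_cons i uv) _.
  exact: similar_comm.
have adj : (j = i.+1 :> nat) \/ (i = j.+1 :> nat).
  by move: near ij; rewrite -val_eqE /=; lia.
(* Descents at both [i] and [j] mean that the order of three consecutive positions is reversed.
   Hence [u] still descends at [j], and what follows that [j] descends at [i]. *)
have key : (perm_of u (rpos j) < perm_of u (lpos j))%N /\
    forall v, similar u (j :: v) -> (perm_of v (rpos i) < perm_of v (lpos i))%N.
  move: desc di; rewrite !perm_ofE tpermL tpermR.
  case: adj => e.
    have lr : lpos j = rpos i by apply: val_inj; rewrite /= e.
    have a1 : tperm (lpos i) (rpos i) (rpos j) = rpos j.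
      by apply: val_inj; rewrite /= val_swap /= e; do 2?[case: ifP => ?]; lia.
    have a2 : tperm (lpos j) (rpos j) (lpos i) = lpos i.
      by apply: val_inj; rewrite /= val_swap /= e; do 2?[case: ifP => ?]; lia.
    rewrite a1 lr tpermR => d1 d2.
    have d3 : (perm_of u (rpos j) < perm_of u (rpos i))%N by exact: ltn_trans d1 d2.
    split=> // v /similar_perm uv; move: d1 d2 d3; rewrite uv !perm_ofE -lr tpermL tpermR a2.
    by [].
  have lr : lpos i = rpos j by apply: val_inj; rewrite /= e.
  have a1 : tperm (lpos i) (rpos i) (lpos j) = lpos j.
    by apply: val_inj; rewrite /= val_swap /= e; do 2?[case: ifP => ?]; lia.
  have a2 : tperm (lpos j) (rpos j) (rpos i) = rpos i.
    by apply: val_inj; rewrite /= val_swap /= e; do 2?[case: ifP => ?]; lia.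
  rewrite a1 -lr tpermL => d1 d2.
  have d3 : (perm_of u (lpos i) < perm_of u (lpos j))%N by exact: ltn_trans d2 d1.
  split=> // v /similar_perm uv; move: d1 d2 d3; rewrite uv !perm_ofE lr tpermL tpermR a2.
  by [].
have [desc' hv] := key; have [v uv] := IH u j su cu desc'.
have [e sz c] := uv; have cv : simple_crossings v.
  exact: simple_behead (similar_simple uv cu).
have [|v' vv'] := IH v i _ cv (hv v uv).
  by move: su sz => /=; lia.
exists [:: i, j & v']; apply: similar_trans (similar_cons i uv) _.
apply: similar_trans (similar_cons i (similar_cons j vv')) _.
exact: similar_braid.
Qed.

(** The first letter of [u] is a descent of the common permutation, so [exchange] makes [v] begin
    with it as well; the letter is then cancelled. *)
Theorem simple_unique u v : simple_crossings u -> simple_crossings v ->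
  perm_of u = perm_of v -> braid_eq (posword u) (posword v).
Proof.
elim: u v => [|i u IH] v cu cv uv.
  case: v cv uv => [|i v] cv uv; first exact: braid_eq_refl.
  have := simple_descent cv; rewrite -uv /bword_perm big_nil !perm1 /=; lia.
have [|v' vv'] := @exchange v i cv; first by rewrite -uv; exact: simple_descent.
have [e _ _] := vv'; apply: braid_eq_trans (braid_eq_sym e).
have cv' := simple_behead (similar_simple vv' cv).
apply: (@braid_eq_cat _ [:: (i, true)] _ _ _ (braid_eq_refl _)).
apply: IH => //; first exact: simple_behead cu.
have := uv; rewrite (similar_perm vv') /= !bword_perm_cons; exact: mulgI.
Qed.

End PermutationBraids.

(** * Fox colourings *)

Section FoxColourings.

(* The dihedral quandle of order 3 on the colours None, Some true, Some false. *)
Definition fox (x y : option bool) : option bool :=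
  match x, y with
  | None, Some b | Some b, None => Some (~~ b)
  | Some a, Some b => if a == b then Some a else None
  | None, None => None
  end.

(** The three quandle axioms give, respectively, the cancellation of inverse letters, the invariance
    of constant colourings and the braid relation. *)
Lemma foxK x y : fox (fox x y) y = x. Proof. by case: x y => [[]|] [[]|]. Qed.
Lemma foxx x : fox x x = x. Proof. by case: x => [[]|]. Qed.
Lemma foxD x y z : fox (fox x y) z = fox (fox x z) (fox y z).
Proof. by case: x y z => [[]|] [[]|] [[]|]. Qed.

Fixpoint fox_gen (e : bool) (i : nat) (s : seq (option bool)) : seq (option bool) :=
  match i, s with
  | 0, x :: y :: s' => if e then y :: fox x y :: s' else fox y x :: x :: s'
  | i'.+1, x :: s' => x :: fox_gen e i' s'
  | _, _ => s
  end.

Lemma size_fox_gen e i s : size (fox_gen e i s) = size s.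
Proof.
elim: i s => [|i IH] [|x s] //=; last by rewrite IH.
by case: s => [|y s] //=; case: e.
Qed.

Lemma fox_genK e i s : fox_gen (~~ e) i (fox_gen e i s) = s.
Proof.
elim: i s => [|i IH] [|x s] //=; last by rewrite IH.
by case: s => [|y s] //=; case: e => /=; rewrite foxK.
Qed.

Lemma fox_gen_comm i j s : (i.+2 <= j)%N ->
  fox_gen true j (fox_gen true i s) = fox_gen true i (fox_gen true j s).
Proof.
elim: i j s => [|i IH] [|j] [|x s] //= ij; last by congr (_ :: _); exact: IH.
by case: j ij => [//|j] _; case: s.
Qed.

Lemma fox_gen_braid i s : (i.+2 < size s)%N ->
  fox_gen true i (fox_gen true i.+1 (fox_gen true i s)) =
  fox_gen true i.+1 (fox_gen true i (fox_gen true i.+1 s)).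
Proof.
elim: i s => [|i IH] [|x s] //= si; last by congr (_ :: _); exact: IH.
by case: s si => [|y [|z s]] //= _; rewrite foxD.
Qed.

Lemma fox_gen_constant e i k (x : option bool) : fox_gen e i (nseq k x) = nseq k x.
Proof.
elim: i k => [|i IH] [|k] //=; last by rewrite IH.
by case: k => //= k; rewrite foxx; case: e.
Qed.

Context {n : nat}.
Implicit Types (u v w : bword n) (s : seq (option bool)).

Definition fox_act w s := foldl (fun s (a : bletter n) => fox_gen a.2 a.1 s) s w.

Lemma fox_act_cat u v s : fox_act (u ++ v) s = fox_act v (fox_act u s).
Proof. exact: foldl_cat. Qed.

Lemma size_fox_act w s : size (fox_act w s) = size s.
Proof. by elim: w s => [//|a w IH] s; rewrite /= IH size_fox_gen. Qed.

Lemma fox_act_eq u v s : braid_eq u v -> size s = n -> fox_act u s = fox_act v s.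
Proof.
move=> uv; elim: uv s => {u v}.
- by [].
- by move=> u v _ IH s sn; rewrite IH.
- by move=> u v w _ IH1 _ IH2 s sn; rewrite IH1 ?IH2.
- move=> u u' v v' _ IH1 _ IH2 s sn; rewrite !fox_act_cat IH1 //.
  by apply: IH2; rewrite size_fox_act.
- by move=> a s _; rewrite /fox_act /= fox_genK.
- by move=> i j ij s _; rewrite /fox_act /= fox_gen_comm.
- move=> i j ij s sn; rewrite /fox_act /= ij fox_gen_braid // sn -ij.
  exact: rpos_subproof.
Qed.

Lemma fox_act_constant w k x : fox_act w (nseq k x) = nseq k x.
Proof. by elim: w => [//|a w IH] /=; rewrite fox_gen_constant. Qed.

(* Constant colourings are fixed by all braids. *)
Lemma fox_conj u v x : braid_eq v (bword_inv x ++ u ++ x) ->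
  (forall s, size s = n -> fox_act u s = s -> exists c, s = nseq n c) ->
  forall s, size s = n -> fox_act v s = s -> exists c, s = nseq n c.
Proof.
move=> e hu s sn; rewrite (fox_act_eq e sn) !fox_act_cat => fs.
have [c ec] : exists c, fox_act (bword_inv x) s = nseq n c.
  apply: hu; first by rewrite size_fox_act.
  rewrite -[in RHS]fs -[RHS]fox_act_cat (fox_act_eq (braid_eq_mulwV x)) //.
  by rewrite !size_fox_act.
by exists c; rewrite -fs ec !fox_act_constant.
Qed.

Lemma braid_conjugate_of u v : braid_conjugate (braid_of u) (braid_of v) ->
  exists x, braid_eq v (bword_inv x ++ u ++ x).
Proof.
move=> [x]; have [w ->] : exists w, x = braid_of w.
  by eexists; rewrite -[LHS]braid_of_repr.
move=> e; exists w; apply/braid_ofP.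
by rewrite e conjgE -[RHS]braid_mul_of -braid_inv_of -braid_mul_of.
Qed.

Fixpoint colourings k : seq (seq (option bool)) :=
  if k is k'.+1 then [seq x :: s | x <- [:: None; Some true; Some false], s <- colourings k']
  else [:: [::]].

Lemma mem_colourings s : s \in colourings (size s).
Proof.
elim: s => [//|x s IH]; apply/allpairsP; exists (x, s) => /=; split=> //.
by case: x => [[]|].
Qed.

End FoxColourings.

(** * The words of the two braids *)

Section Words.
Context {m : nat}.
Implicit Types (s t : seq nat).

(** Concrete words are kept as lists of natural numbers, on which crossings, permutations and
    colourings can be evaluated; the bounds [all (fun i => i <= m)] guard against letters that
    [inord] would send to 0. *)
Definition gens s : seq 'I_m.+1 := [seq inord i | i <- s].
Definition word s : bword m.+2 := @posword m.+2 (gens s).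

Lemma gens_cat s t : gens (s ++ t) = gens s ++ gens t.
Proof. exact: map_cat. Qed.

Lemma word_cat s t : word (s ++ t) = word s ++ word t.
Proof. by rewrite /word gens_cat posword_cat. Qed.

Definition nswap (i x : nat) : nat :=
  if x == i then i.+1 else if x == i.+1 then i else x.

Fixpoint ncrossings s (x y : nat) : nat :=
  if s is i :: s' then
    ((x == i) && (y == i.+1) || (y == i) && (x == i.+1))
      + ncrossings s' (nswap i x) (nswap i y)
  else 0.

Lemma crossings_gens s (x y : 'I_m.+2) : all (fun i => i <= m)%N s ->
  @crossings m.+2 (gens s) x y = ncrossings s x y.
Proof.
elim: s x y => [//|i s IH] x y /= /andP[im sm].
by rewrite meetE IH // !val_swap inordK.
Qed.

Lemma val_word_perm s (x : 'I_m.+2) : all (fun i => i <= m)%N s ->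
  bword_perm (word s) x = foldl (fun x i => nswap i x) x s :> nat.
Proof.
elim: s x => [|i s IH] x /=; first by rewrite /bword_perm big_nil perm1.
move=> /andP[im sm]; rewrite /word /= bword_perm_cons permM -/(word s) IH //.
by rewrite /lswap val_swap inordK.
Qed.

Lemma fox_act_word s c : all (fun i => i <= m)%N s ->
  fox_act (word s) c = foldl (fun c i => fox_gen true i c) c s.
Proof.
by elim: s c => [//|i s IH] c /= /andP[im sm]; rewrite inordK // IH.
Qed.

Lemma ltn_ordP (k : nat) (P : nat -> nat -> bool) (x y : 'I_k) :
  all (fun i => all (P i) (iota 0 k)) (iota 0 k) -> P x y.
Proof. by move=> /allP/(_ x)/[!mem_iota]/(_ (ltn_ord x))/allP; apply; rewrite mem_iota /=. Qed.

(** A word to which no relation applies is returned unchanged, so every list of moves is sound and a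
    chain of relations is certified by evaluation. *)
Definition relate s : seq nat :=
  match s with
  | a :: b :: r =>
    if [&& (a.+2 <= b)%N || (b.+2 <= a)%N, (a <= m)%N & (b <= m)%N] then b :: a :: r
    else match r with
    | c :: r' =>
      if [&& (b == a.+1) || (a == b.+1), c == a, (a <= m)%N & (b <= m)%N]
      then b :: a :: b :: r' else s
    | [::] => s
    end
  | _ => s
  end.

(* [(true, k)] rotates a word by k letters, [(false, k)] relates at letter k. *)
Definition do_move s (q : bool * nat) : seq nat :=
  if q.1 then rot q.2 s else take q.2 s ++ relate (drop q.2 s).

Lemma relate_braid_eq s : exists t u v, [/\ word s = word t ++ v,
  word (relate s) = word u ++ v & braid_eq (word t) (word u)].
Proof.
have dflt : exists t u v, [/\ word s = word t ++ v, word s = word u ++ v & braid_eq (word t) (word u)].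
  by exists [::], [::], (word s); split=> //; exact: braid_eq_refl.
case: s dflt => [//|a [//|b r]] dflt; rewrite /relate.
case: ifP => [/and3P[ab am bm]|_].
  exists [:: a; b], [:: b; a], (word r); split=> //.
  case/orP: ab => ab; [|apply: braid_eq_sym]; apply: (@braid_eq_comm m.+2);
    by rewrite !inordK ?ltnS.
case: r dflt => [//|c r] dflt; case: ifP => [/and4P[ab /eqP-> am bm]|//].
exists [:: a; b; a], [:: b; a; b], (word r); split=> //.
case/orP: ab => /eqP ab; [|apply: braid_eq_sym]; apply: (@braid_eq_braid m.+2);
  by rewrite !inordK ?ltnS.
Qed.

Lemma isotopic_move (R : realType) s q :
  isotopic (closure_bword (word s) : set ((R * R) * (R * R))) (closure_bword (word (do_move s q))).
Proof.
case: q => [[] k]; rewrite /do_move /=.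
  by rewrite -{1}(cat_take_drop k s) /rot !word_cat; exact: closure_rot.
rewrite -{1}(cat_take_drop k s) !word_cat.
have [t [u [v [-> -> tu]]]] := relate_braid_eq (drop k s).
exact: closure_braid_eq.
Qed.

Lemma isotopic_moves (R : realType) s qs :
  isotopic (closure_bword (word s) : set ((R * R) * (R * R)))
    (closure_bword (word (foldl do_move s qs))).
Proof.
elim: qs s => [|q qs IH] s; first exact: isotopic_refl.
exact: isotopic_trans (isotopic_move R s q) (IH _).
Qed.

End Words.

(** Reduced words with letters numbered from 0; each of the two 6-cycles has nine inversions. *)
Definition beta_word := [:: 0; 1; 0; 2; 1; 0; 3; 2; 4]%N.
Definition gamma_word := [:: 1; 0; 2; 1; 3; 2; 1; 4; 3]%N.

Lemma beta_simple : @simple_crossings 6 (@gens 4 beta_word).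
Proof.
apply: wlog_crossings => x y _; rewrite crossings_gens //.
by apply: (ltn_ordP (P := fun x y => (ncrossings beta_word x y <= 1)%N)).
Qed.

Lemma gamma_simple : @simple_crossings 6 (@gens 4 gamma_word).
Proof.
apply: wlog_crossings => x y _; rewrite crossings_gens //.
by apply: (ltn_ordP (P := fun x y => (ncrossings gamma_word x y <= 1)%N)).
Qed.

Lemma beta_gamma_nonconj :
  ~ braid_conjugate (braid_of (@word 4 beta_word)) (braid_of (@word 4 gamma_word)).
Proof.
move=> /braid_conjugate_of[x e].
have e2 : braid_eq (word (gamma_word ++ gamma_word))
    (bword_inv x ++ word (beta_word ++ beta_word) ++ x).
  rewrite !word_cat; apply: braid_eq_trans (braid_eq_cat e e) _.
  rewrite -!catA; do 2 apply: braid_eq_cat (braid_eq_refl _) _.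
  rewrite catA -[X in braid_eq _ X]cat0s.
  exact: braid_eq_cat (braid_eq_mulwV x) (braid_eq_refl _).
have [|//||c] := @fox_conj _ _ _ _ e2 _
    [:: None; Some true; Some false; Some false; Some true; None].
- move=> s ss; rewrite fox_act_word // => /eqP fs.
  (* The square of [beta] is tested on all 729 colourings of six strings. *)
  have /allP/(_ s) : all (fun s =>
      (foldl (fun c i => fox_gen true i c) s (beta_word ++ beta_word) == s)
      ==> (s == nseq 6 (head None s))) (colourings 6) by vm_compute.
  by rewrite -{1}ss mem_colourings fs => /(_ isT) /eqP ->; exists (head None s).
- by rewrite fox_act_word.
- by case: c.
Qed.

Lemma val_cycle_fun (n : nat) (c : seq nat) (x : 'I_n.+1) :
  all (fun a => a.-1 <= n)%N c -> uniq [seq a.-1 | a <- c] -> cycle_fun c x = next [seq a.-1 | a <- c] x :> nat.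
Proof.
move=> cn cu; have e : map val [seq (inord a.-1 : 'I_n.+1) | a <- c] = [seq a.-1 | a <- c].
  by rewrite -map_comp; apply/eq_in_map => a /(allP cn) an /=; rewrite inordK.
have u : uniq [seq (inord a.-1 : 'I_n.+1) | a <- c].
  by apply: (@map_uniq _ _ val); rewrite e.
by have := next_map val_inj u x; rewrite e.
Qed.

Lemma braid_of_simple (b : braid 6) (s c : seq nat) : positive_permutation_braid b ->
  @simple_crossings 6 (@gens 4 s) -> all (fun i => i <= 4)%N s ->
  braid_perm b =1 cycle_fun c -> all (fun a => a.-1 <= 5)%N c ->
  uniq [seq a.-1 | a <- c] ->
  all (fun x => foldl (fun x i => nswap i x) x s == next [seq a.-1 | a <- c] x) (iota 0 6) ->
  b = braid_of (@word 4 s).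
Proof.
move=> [w -> cw] cs s4 hb c5 cu hs; apply/braid_ofP; apply: (simple_unique cw cs).
apply/permP => x; apply: val_inj => /=.
apply: etrans (esym (val_word_perm x s4)).
have /eqP -> : foldl (fun x i => nswap i x) x s == next [seq a.-1 | a <- c] x.
  by apply: (allP hs); rewrite mem_iota /=.
by rewrite -val_cycle_fun // -hb braid_perm_of.
Qed.

Lemma beta_eq (b : braid 6) : positive_permutation_braid b ->
  braid_perm b =1 cycle_fun [:: 1; 6; 5; 3; 2; 4]%N -> b = braid_of (@word 4 beta_word).
Proof. by move=> pb hb; apply: (braid_of_simple pb beta_simple _ hb). Qed.

Lemma gamma_eq (b : braid 6) : positive_permutation_braid b ->
  braid_perm b =1 cycle_fun [:: 1; 5; 2; 6; 4; 3]%N -> b = braid_of (@word 4 gamma_word).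
Proof. by move=> pb hb; apply: (braid_of_simple pb gamma_simple _ hb). Qed.

Section Chain.
Context {R : realType}.
Local Notation C := (R * R)%type.

Let w4 := [:: 1; 2; 1; 0; 1; 2; 3; 2]%N.
Let w4' := [:: 3; 1; 0; 2; 1; 3; 2; 1]%N.

(** The list of moves is a certificate. It contains relations only, so the braid of [beta_word]
    equals a stabilized one; for [gamma_word] one rotation by a letter is used. *)
Lemma beta_chain : isotopic (closure_bword (@word 4 beta_word) : set (C * C))
  (closure_bword (@word 4 (rcons w4 4))).
Proof.
exact: (@isotopic_moves 4 R beta_word
  [:: (false, 0); (false, 2); (false, 1); (false, 4); (false, 2)]%N).
Qed.

Lemma middle_chain : isotopic (closure_bword (@word 3 w4) : set (C * C))
  (closure_bword (@word 3 w4')).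
Proof.
exact: (@isotopic_moves 3 R w4
  [:: (true, 3); (false, 4); (false, 3); (false, 1); (false, 3); (false, 5); (true, 6)]%N).
Qed.

Lemma gamma_chain : isotopic (closure_bword (@word 4 (rcons w4' 4)) : set (C * C))
  (closure_bword (@word 4 gamma_word)).
Proof. exact: (@isotopic_moves 4 R (rcons w4' 4) [:: (true, 1)]%N). Qed.

End Chain.

(** * Markov stabilization *)

Section Clamp.
Context {R : realType}.
Local Notation C := (R * R)%type.
Implicit Types (x b r u s t : R).

Definition clamp x : R := Num.max 0 (Num.min x 1).

Lemma clamp0 x : x <= 0 -> clamp x = 0.
Proof. by move=> x0; rewrite /clamp min_l ?max_l //; lra. Qed.
Lemma clamp1 x : 1 <= x -> clamp x = 1.
Proof. by move=> x1; rewrite /clamp min_r ?max_r //; lra. Qed.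
Lemma clamp_id x : 0 <= x <= 1 -> clamp x = x.
Proof. by move=> x1; rewrite /clamp min_l ?max_r //; lra. Qed.
Lemma clamp01 x : 0 <= clamp x <= 1.
Proof.
have [x0|x0] := leP x 0; first by rewrite clamp0 //; lra.
have [x1|x1] := leP 1 x; first by rewrite clamp1 //; lra.
by rewrite clamp_id; lra.
Qed.

Definition pol r b : C := (r * (turn b).1, r * (turn b).2).

Lemma pol0 r : pol r 0 = (r, 0).
Proof. by rewrite /pol turn0 /= mulr1 mulr0. Qed.

Lemma polN r b : - pol r b = pol r (b + 2^-1).
Proof. by rewrite /pol turn_half /= !mulrN. Qed.

Lemma sin_turn_gt0 b : 0 < b < 2^-1 -> 0 < (turn b).2.
Proof. by move=> b0; rewrite /=; apply: sin_gt0_pi; have := pi_gt0 R; nra. Qed.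

Lemma sin_turn_ge0 b : 0 <= b < 2^-1 -> 0 <= (turn b).2.
Proof.
move=> b0; have [->|bn] := eqVneq b 0; first by rewrite turn0.
by apply/ltW/sin_turn_gt0; rewrite lt_neqAle eq_sym bn.
Qed.

Lemma sin_turn_lt0 b : - 2^-1 < b < 0 -> (turn b).2 < 0.
Proof.
move=> b0; have : 0 < (turn (- b)).2 by apply: sin_turn_gt0; lra.
by rewrite /= mulrN sinN oppr_gt0.
Qed.

Lemma sin_turn_le0 b : - 2^-1 < b <= 0 -> (turn b).2 <= 0.
Proof.
move=> b0; have [->|bn] := eqVneq b 0; first by rewrite turn0.
have bn0 : b < 0 by rewrite lt_neqAle bn; lra.
by apply/ltW/sin_turn_lt0; lra.
Qed.

(** Within this angle a string at radius at least n + 1 keeps its real part above n, and at radius n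
    above n - 1, so it swings clear of the others. The bound 1/4 settles the signs of sine and keeps
    1/2 - e and 1/2 + e inside (0, 1). *)
Lemma small_angle (n : nat) : exists2 e : R, 0 < e < 4^-1 &
  forall b, `|b| <= e -> n%:R < n.+1%:R * (turn b).1.
Proof.
pose f b : R := n.+1%:R * cos (2 * pi * b).
have cf : continuous_at 0 f by rewrite /f; cont.
have f0 : f 0 = n.+1%:R by rewrite /f mulr0 cos0 mulr1.
have : \forall b \near (0 : R), n%:R < f b.
  apply: (@cvgr_gt R R (nbhs (0 : R)) (nbhs_filter _) f (f 0) cf n%:R).
  by rewrite f0 ltr_nat.
move=> /nbhs_ballP[d /= d0 dP]; exists (Num.min (d / 2) 8^-1).
  have : 0 < Num.min (d / 2) 8^-1 by rewrite lt_min divr_gt0 // invr_gt0 ltr0n.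
  have : Num.min (d / 2) 8^-1 <= 8^-1 by rewrite ge_min lexx orbT.
  by lra.
move=> b; rewrite le_min => /andP[bd _]; apply: dP.
by rewrite /ball /= sub0r normrN; lra.
Qed.

Lemma rotate_inj (x y v : C) : v.1 ^+ 2 + v.2 ^+ 2 = 1 ->
  (x.1 * v.1 - x.2 * v.2, x.1 * v.2 + x.2 * v.1) =
  (y.1 * v.1 - y.2 * v.2, y.1 * v.2 + y.2 * v.1) -> x = y.
Proof.
case: x y v => a b [a' b'] [c d] /= cd [e1 e2]; congr (_, _).
  have -> : a = (a * c - b * d) * c + (a * d + b * c) * d.
    by rewrite -[LHS]mulr1 -cd; ring.
  by rewrite e1 e2 -[RHS]mulr1 -cd; ring.
have -> : b = (a * d + b * c) * c - (a * c - b * d) * d.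
  by rewrite -[LHS]mulr1 -cd; ring.
by rewrite e1 e2 -[RHS]mulr1 -cd; ring.
Qed.

(** A half turn of the plane. The swinging arc surrounds the angle 0, where the parameter of the
    circle is cut; after negation it surrounds 1/2. *)
Lemma cl_opp (n : nat) (p : 'I_n -> R -> C) (g : 'S_n) :
  (forall j, continuous (p j)) ->
  (forall u j k, 0 <= u <= 1 -> j != k -> p j u != p k u) ->
  (forall j, p j 1 = p (g j) 0) ->
  isotopic (cl p) (cl (fun j u => - p j u)).
Proof.
move=> cp ip gp.
pose h s j u : C := ((p j u).1 * (turn (s / 2)).1 - (p j u).2 * (turn (s / 2)).2,
  (p j u).1 * (turn (s / 2)).2 + (p j u).2 * (turn (s / 2)).1).
have -> : cl p = cl (h 0).
  apply: eq_cl => j u _; rewrite /h mul0r turn0 /= !mulr1 !mulr0 subr0 add0r.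
  exact: surjective_pairing.
have -> : cl (fun j u => - p j u) = cl (h 1).
  apply: eq_cl => j u _; have := turn_half (0 : R); rewrite add0r turn0 /= oppr0 => t2.
  by rewrite /h mul1r t2 /= !mulr0 subr0 add0r !mulrN1.
apply: (@cl_homotopy _ _ h g).
- by move=> j q; have c := cp j; rewrite /h /turn; cont.
- move=> s u j k _ u01 jk; apply: contraNneq (ip u j k u01 jk) => e.
  by apply/eqP; exact: rotate_inj (turn_norm (s / 2)) e.
- by move=> s j _; rewrite /h gp.
Qed.

Lemma swapC_nrm (z : C * C) : swapC (nrm z) = nrm (swapC z).
Proof. by rewrite /nrm /swapC /scl /= (_ : nsq (z.2, z.1) = nsq z) // /nsq addrC. Qed.

Lemma swap_cl (m : nat) (P : 'I_m -> R -> C) :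
  swapC @` cl (fun j u => - P j u) =
  [set z | exists j u, 0 <= u <= 1 /\ z = nrm (turn u, - P j u)].
Proof.
rewrite eqEsubset; split=> [_ [_ [j [u [u01 ->]]] <-]|_ [j [u [u01 ->]]]].
  by exists j, u; rewrite swapC_nrm.
by exists (nrm (- P j u, turn u)); [exists j, u|rewrite swapC_nrm].
Qed.

Lemma pol_inj (a b x y : R) : 0 < a -> 0 <= b -> 0 <= x <= 1 -> 0 < y < 1 ->
  pol a x = pol b y -> x = y.
Proof.
move=> a0 b0 x01 y01 e.
have ab : a = b.
  by rewrite -(@mag_turn _ a x (ltW a0)) -/(pol a x) e mag_turn.
have [E1 E2] : (turn x).1 = (turn y).1 /\ (turn x).2 = (turn y).2.
  have a1 : a * (turn x).1 = a * (turn y).1 by rewrite {2}ab; exact: (congr1 fst e).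
  have a2 : a * (turn x).2 = a * (turn y).2 by rewrite {2}ab; exact: (congr1 snd e).
  by split; [apply: (mulfI (lt0r_neq0 a0) a1)|apply: (mulfI (lt0r_neq0 a0) a2)].
have y01' : 0 <= y <= 1 by lra.
have xy : turn x = turn y by rewrite /turn; congr (_, _).
by have [//|[_ y1]|[_ y1]] := turn_eq01 x01 y01' xy; lra.
Qed.

Lemma nsq_turnl (x : C) u : 0 < nsq (turn u, x).
Proof.
case: x => a b; rewrite /nsq /= cos2Dsin2.
by have := sqr_ge0 a; have := sqr_ge0 b; lra.
Qed.

Lemma turn_dot s t : (turn s).1 * (turn t).1 + (turn s).2 * (turn t).2 <= 1 :> R.
Proof. by rewrite /= -cosB cos_le1. Qed.

End Clamp.

(** * Adding an idle last string *)

Section Widening.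
Context {R : realType} {n : nat}.
Local Notation C := (R * R)%type.
Implicit Types (w : bword n.+1) (a : bletter n.+1) (j : 'I_n.+1).

Definition wd j : 'I_n.+2 := lift ord_max j.
Arguments wd : simpl never.
Definition widen_letter a : bletter n.+2 := (lift ord_max a.1, a.2).
Definition widen w : bword n.+2 := map widen_letter w.

Lemma val_wd j : wd j = j :> nat. Proof. exact: lift_max. Qed.
Lemma val_widen_letter a : (widen_letter a).1 = a.1 :> nat. Proof. exact: lift_max. Qed.

Lemma wd_inj : injective wd. Proof. exact: lift_inj. Qed.

Lemma wdP (k : 'I_n.+2) : (exists j, k = wd j) \/ k = ord_max.
Proof. by case: (unliftP ord_max k) => [j ->|->]; [left; exists j|right]. Qed.

Lemma nat_ord_eq m (x y : 'I_m) : (x == y) = ((x : nat) == y).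
Proof. by rewrite -val_eqE. Qed.
Lemma lposE m (i : 'I_m.-1) : lpos i = i :> nat. Proof. by []. Qed.
Lemma rposE m (i : 'I_m.-1) : rpos i = i.+1 :> nat. Proof. by []. Qed.

Lemma lpos_widen a j : (wd j == lpos (widen_letter a).1) = (j == lpos a.1).
Proof. by rewrite !nat_ord_eq val_wd !lposE val_widen_letter. Qed.
Lemma rpos_widen a j : (wd j == rpos (widen_letter a).1) = (j == rpos a.1).
Proof. by rewrite !nat_ord_eq val_wd !rposE val_widen_letter. Qed.

Lemma lswap_widen a j : lswap (widen_letter a) (wd j) = wd (lswap a j).
Proof.
apply: ord_inj; rewrite /lswap [RHS]val_wd [LHS]val_swap val_swap val_wd.
by rewrite val_widen_letter.
Qed.

Lemma lswap_widen_max a : lswap (widen_letter a) ord_max = ord_max.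
Proof.
apply: ord_inj; rewrite /lswap val_swap val_widen_letter.
have := rpos_subproof a.1; move: (nat_of_ord a.1) => i h.
by rewrite -[nat_of_ord ord_max]/(n.+1); do 2?[case: ifP => ?]; lia.
Qed.

Lemma perm_widen w j : bword_perm (widen w) (wd j) = wd (bword_perm w j).
Proof.
elim: w j => [|a w IH] j; first by rewrite /bword_perm !big_nil !perm1.
by rewrite /= !bword_perm_cons !permM lswap_widen IH.
Qed.

Lemma perm_widen_max w : bword_perm (widen w) ord_max = ord_max.
Proof.
elim: w => [|a w IH]; first by rewrite /bword_perm !big_nil !perm1.
by rewrite /= !bword_perm_cons !permM lswap_widen_max IH.
Qed.

Lemma letter_path_widen a j t : letter_path (widen_letter a) (wd j) t = letter_path a j t :> C.
Proof. by rewrite /letter_path lpos_widen rpos_widen val_widen_letter val_wd. Qed.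

Lemma letter_path_widen_max a t : letter_path (widen_letter a) ord_max t = (n.+1%:R, 0) :> C.
Proof.
have := rpos_subproof a.1; have := val_widen_letter a.
move: (nat_of_ord a.1) => i v h.
have l : (ord_max == lpos (widen_letter a).1 :> 'I_n.+2) = false.
  by rewrite nat_ord_eq lposE v -[nat_of_ord ord_max]/(n.+1); lia.
have r : (ord_max == rpos (widen_letter a).1 :> 'I_n.+2) = false.
  by rewrite nat_ord_eq rposE v -[nat_of_ord ord_max]/(n.+1); lia.
by rewrite /letter_path l r.
Qed.

Lemma string_path_widen w j t : string_path (widen w) (wd j) t = string_path w j t :> C.
Proof.
elim: w j t => [|a w IH] j t.
  by rewrite -[LHS]/((wd j : nat)%:R, 0) val_wd.
rewrite [widen _]/= [LHS]/= [RHS]/=.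
by rewrite letter_path_widen -[tperm _ _ (wd j)]/(lswap (widen_letter a) (wd j)) lswap_widen IH.
Qed.

Lemma string_path_widen_max w t : string_path (widen w) ord_max t = (n.+1%:R, 0) :> C.
Proof.
elim: w t => [//|a w IH] t /=.
by rewrite letter_path_widen_max -[tperm _ _ ord_max]/(lswap (widen_letter a) ord_max)
  lswap_widen_max IH if_same.
Qed.

Lemma size_widen w : size (widen w) = size w. Proof. exact: size_map. Qed.

End Widening.

(** * The stabilizing homotopies *)

Section Stabilization.
Context {R : realType} {n : nat} (w : bword n.+1) (eta : R).
Local Notation C := (R * R)%type.
Local Notation N := (n%:R : R).
Hypothesis eta0 : 0 < eta < 4^-1.
Hypothesis eta_cos : forall b : R, `|b| <= eta -> N < n.+1%:R * (turn b).1.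
Implicit Types (j : 'I_n.+1) (k : 'I_n.+2) (u t s b v : R).

(* The word w is run through for u <= 1/2.  Then the string at position n, in
   polar coordinates (radius r, angle 2 pi b), goes out to radius n + 3, turns
   from b = - eta to b = eta and comes back.  In P2 this takes place in a tenth
   of the period; in P1 the turn takes eleven tenths and is shared by two
   strings, which produces the additional crossing. *)
Let tm u : R := 10 * u - 5.
(** Five stages, each of a unit of [t] or a tenth of the period: tilt to - eta, move out, turn to
    eta, move in, return to angle 0. The turn occupies 2 <= t <= 3, that is 7/10 <= u <= 8/10. *)
Let r2 t : R := N + 3 * (clamp (t - 1) - clamp (t - 3)).
Let b2 t : R := eta * (- clamp t + 2 * clamp (t - 2) - clamp (t - 4)).
Let r1 t : R := N + 3 * clamp (t - 1).
(** The slow turn at rate 2/11 takes eleven units: three by the top string, for t from 2 to 5, and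
    eight by the additional string, for t from -5 to 3. The handover is at the angle -5/11 of
    eta. *)
Let b1 t : R := eta * (- clamp t + 2 / 11 * Num.max 0 (t - 2)).
Let rY t : R := N + 3 * (1 - clamp (t - 3)).
Let bY t : R := eta * (-1 + 2 / 11 * (Num.min t 3 + 8) - clamp (t - 4)).
Let phi u : R := (size w)%:R * Num.min (2 * u) 1.
Let top (j : 'I_n.+1) : bool := bword_perm w j == ord_max.

Let P2 j u : C := if top j
  then string_path w j (phi u) + (pol (r2 (tm u)) (b2 (tm u)) - (N, 0))
  else string_path w j (phi u).

Let P1 k u : C := if unlift ord_max k is Some j then
    if top j then string_path w j (phi u) + (pol (r1 (tm u)) (b1 (tm u)) - (N, 0))
    else string_path w j (phi u)
  else pol (rY (tm u)) (bY (tm u)).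

Let sigma : bletter n.+2 := (ord_max, true).
Let P0 := wpath (widen w ++ [:: sigma]) (@halves R n.+2 (widen w) [:: sigma]).

Let N0 : 0 <= N. Proof. exact: ler0n. Qed.
Let P1wd j u : P1 (wd j) u =
  if top j then string_path w j (phi u) + (pol (r1 (tm u)) (b1 (tm u)) - (N, 0))
  else string_path w j (phi u).
Proof. by rewrite /P1 /wd liftK. Qed.
Let P1max u : P1 ord_max u = pol (rY (tm u)) (bY (tm u)).
Proof. by rewrite /P1 unlift_none. Qed.

Let phi1 u : u <= 2^-1 -> phi u = (size w)%:R * (2 * u).
Proof. by move=> uh; rewrite /phi min_l //; lra. Qed.

Let str2 j u : 2^-1 <= u -> string_path w j (phi u) = ((bword_perm w j : nat)%:R, 0) :> C.
Proof. by move=> uh; rewrite string_path_end // /phi min_r ?mulr1 //; lra. Qed.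

Let topE j : top j -> (bword_perm w j : nat)%:R = N. Proof. by move=> /eqP ->. Qed.

Let ntopE j : ~~ top j -> (bword_perm w j : nat)%:R + 1 <= N.
Proof.
move=> nt; rewrite natr1 ler_nat; have := ltn_ord (bword_perm w j).
rewrite ltnS leq_eqVlt => /orP[/eqP e|//]; move/negP: nt; case.
by apply/eqP/val_inj.
Qed.

Let cos_big b : `|b| <= eta -> 0 < (turn b).1 <= 1 /\ N - 1 < N * (turn b).1 /\ N < (N + 3) * (turn b).1.
Proof.
move=> /eta_cos; rewrite -natr1 => h; have c1 : (turn b).1 <= 1 by exact: cos_le1.
have c0 : 0 < (turn b).1.
  by have := le_lt_trans N0 h; rewrite pmulr_rgt0 //; lra.
by rewrite c0 c1; split=> //; move: h; rewrite !mulrDl; lra.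
Qed.

Let Pearly j u : u <= 2^-1 -> P1 (wd j) u = string_path w j ((size w)%:R * (2 * u))
  /\ P2 j u = string_path w j ((size w)%:R * (2 * u)).
Proof.
move=> uh; rewrite P1wd /P2 -phi1 //; have t0 : tm u <= 0 by rewrite /tm; lra.
have -> : r1 (tm u) = N by rewrite /r1 clamp0; lra.
have -> : r2 (tm u) = N by rewrite /r2 !clamp0; lra.
have -> : b1 (tm u) = 0.
  by rewrite /b1 clamp0 // max_l; [ring|lra].
have -> : b2 (tm u) = 0 by rewrite /b2 !clamp0; [ring|lra..].
by rewrite pol0 subrr addr0 !if_same.
Qed.

Let Plate j u : 2^-1 <= u -> top j ->
  P1 (wd j) u = pol (r1 (tm u)) (b1 (tm u)) /\ P2 j u = pol (r2 (tm u)) (b2 (tm u)).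
Proof.
by move=> uh tj; rewrite P1wd /P2 tj str2 // topE // ![(N, 0) + _]addrC !subrK.
Qed.

Let Pside j u : ~~ top j -> P1 (wd j) u = string_path w j (phi u)
  /\ P2 j u = string_path w j (phi u).
Proof. by move=> /negbTE tj; rewrite P1wd /P2 tj. Qed.

Let eta_scale (x : R) : `|x| <= 1 -> `|eta * x| <= eta.
Proof.
have [e0 _] := andP eta0.
by move=> x1; rewrite normrM (gtr0_norm e0); apply: ler_piMr => //; exact: ltW.
Qed.

Let eta_neg (x : R) : -1 <= x <= 0 -> - eta <= eta * x <= 0.
Proof.
have [e0 _] := andP eta0; move=> /andP[x1 x0]; apply/andP; split; last by nra.
by have : 0 <= eta * (x + 1); [apply: mulr_ge0; lra|lra].
Qed.

Let bY_bnd t : -5 <= t <= 5 -> `|bY t| <= eta.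
Proof.
move=> t5; apply: eta_scale.
have [t3|t3] := leP t 3.
  by rewrite clamp0 ?ler_norml; lra.
by have := clamp01 (t - 4); rewrite ler_norml; lra.
Qed.

Let b1_bnd t : t <= 5 -> - eta <= b1 t <= 0.
Proof.
move=> t5; rewrite /b1; have [t2|t2] := leP t 2.
  by rewrite max_l ?mulr0 ?addr0; [apply: eta_neg; have := clamp01 t; lra|lra].
by rewrite clamp1 ?max_r; [apply: eta_neg; lra|lra..].
Qed.

Let b2_bnd t : `|b2 t| <= eta.
Proof.
apply: eta_scale.
have := clamp01 t; have := clamp01 (t - 2); have := clamp01 (t - 4).
have [t2|t2] := leP t 2.
  by rewrite (@clamp0 _ (t - 2)) ?(@clamp0 _ (t - 4)) ?ler_norml; lra.
have [t4|t4] := leP t 4.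
  by rewrite (@clamp1 _ t) ?(@clamp0 _ (t - 4)) ?ler_norml; lra.
by rewrite (@clamp1 _ t) ?(@clamp1 _ (t - 2)) ?ler_norml; lra.
Qed.

Let pol_re r b : N <= r -> `|b| <= eta -> N - 1 < (pol r b).1.
Proof.
move=> rN /cos_big[/andP[c0 c1] [h _]]; rewrite /=; move: h c0 c1; rewrite /=.
by move: (cos _) => c *; nra.
Qed.

Let Ymax_early u : 0 <= u <= 2^-1 -> N < (P1 ord_max u).1.
Proof.
move=> uh; rewrite P1max.
have -> : rY (tm u) = N + 3 by rewrite /rY clamp0 /tm; lra.
have /cos_big[_ [_ h]] : `|bY (tm u)| <= eta by apply: bY_bnd; rewrite /tm; lra.
exact: h.
Qed.

Let late_re j u : 2^-1 <= u <= 1 -> top j ->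
  [/\ N - 1 < (P1 (wd j) u).1, N - 1 < (P1 ord_max u).1 & N - 1 < (P2 j u).1].
Proof.
move=> uh tj; have uh' : 2^-1 <= u by lra.
have [-> ->] := Plate uh' tj; rewrite P1max; split; apply: pol_re.
- by rewrite /r1; have := clamp01 (tm u - 1); lra.
- have t5 : tm u <= 5 by rewrite /tm; lra.
  by have := b1_bnd t5; rewrite ler_norml; lra.
- by rewrite /rY; have := clamp01 (tm u - 3); lra.
- by apply: bY_bnd; rewrite /tm; lra.
- rewrite /r2; have := clamp01 (tm u - 1); have := clamp01 (tm u - 3).
  have [t3|t3] := leP (tm u) 3; first by rewrite (@clamp0 _ (tm u - 3)); lra.
  by rewrite (@clamp1 _ (tm u - 1)); lra.
- exact: b2_bnd.
Qed.

(** The top string stays in the lower half plane and the additional one in the upper, one of them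
    strictly. This is the order of heights in the half turn of [sigma], so the linear homotopy keeps
    them apart. *)
Let late_im j u : 2^-1 <= u <= 1 -> top j -> (P1 (wd j) u).2 < (P1 ord_max u).2.
Proof.
move=> uh tj; have uh' : 2^-1 <= u by lra.
have [-> _] := Plate uh' tj; rewrite P1max.
have t5 : 0 <= tm u <= 5 by rewrite /tm; lra.
set t := tm u in t5 *; rewrite -/t; clearbody t.
have hb := @b1_bnd t ltac:(lra).
have hN := N0; have he := eta0.
have hr : 0 <= r1 t by rewrite /r1; have := clamp01 (t - 1); lra.
have x0 : (turn (b1 t)).2 <= 0 by apply: sin_turn_le0; lra.
have [t3|t3] := leP t 3.
  have y0 : 0 < (turn (bY t)).2.
    apply: sin_turn_gt0; rewrite /bY min_l // clamp0; last by lra.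
    by apply/andP; split; nra.
  have ry : rY t = N + 3 by rewrite /rY clamp0; lra.
  have X : (pol (r1 t) (b1 t)).2 <= 0 by rewrite [X in X <= _]/(_ * _) mulr_ge0_le0.
  have Y : 0 < (pol (rY t) (bY t)).2 by rewrite ry; apply: mulr_gt0 => //; lra.
  exact: le_lt_trans X Y.
have x0' : (turn (b1 t)).2 < 0.
  apply: sin_turn_lt0; rewrite /b1 clamp1 ?max_r; try lra.
  by apply/andP; split; nra.
have hr' : 0 < r1 t by rewrite /r1 clamp1; lra.
have y0 : 0 <= (turn (bY t)).2.
  apply: sin_turn_ge0; rewrite /bY min_r; last by lra.
  by have := clamp01 (t - 4) => ?; apply/andP; split; nra.
have X : (pol (r1 t) (b1 t)).2 < 0 by rewrite [X in X < _]/(_ * _) pmulr_rlt0.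
have Y : 0 <= (pol (rY t) (bY t)).2.
  by apply: mulr_ge0 => //; rewrite /rY; have := clamp01 (t - 3); lra.
exact: lt_le_trans X Y.
Qed.

Let P1wd0 j : P1 (wd j) 0 = ((j : nat)%:R, 0).
Proof.
have h : (0 : R) <= 2^-1 by rewrite invr_ge0.
by have [-> _] := Pearly j h; rewrite !mulr0 string_path0.
Qed.

Let P1max0 : P1 ord_max 0 = pol (N + 3) (eta * (-5 / 11)).
Proof.
rewrite P1max; have -> : rY (tm 0) = N + 3 by rewrite /rY /tm clamp0; lra.
suff -> : bY (tm 0) = eta * (-5 / 11) by [].
by rewrite /bY /tm clamp0 ?min_l; [field|lra..].
Qed.

Let P1wd1 j : P1 (wd j) 1 = if top j then pol (N + 3) (eta * (-5 / 11))
  else ((bword_perm w j : nat)%:R, 0).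
Proof.
have h : (2^-1 : R) <= 1 by lra.
case: ifP => tj; last by have [-> _] := Pside 1 (negbT tj); rewrite str2.
have [-> _] := Plate h tj.
have -> : r1 (tm 1) = N + 3 by rewrite /r1 /tm clamp1; lra.
suff -> : b1 (tm 1) = eta * (-5 / 11) by [].
by rewrite /b1 /tm clamp1 ?max_r; [field|lra..].
Qed.

Let P1max1 : P1 ord_max 1 = (N, 0).
Proof.
rewrite P1max; have -> : rY (tm 1) = N by rewrite /rY /tm clamp1; lra.
have -> : bY (tm 1) = 0 by rewrite /bY /tm clamp1 ?min_r; [field|lra..].
exact: pol0.
Qed.

Let g1 : 'S_n.+2 := bword_perm (widen w ++ [:: sigma]).

Let g1wd j : g1 (wd j) = if top j then ord_max else wd (bword_perm w j).
Proof.
rewrite /g1 bword_perm_cat permM perm_widen bword_perm_cons permM /bword_perm big_nil perm1.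
have bn := ltn_ord (bword_perm w j).
apply: ord_inj; rewrite /lswap val_swap val_wd; case: ifP => [/eqP e|].
  by case: ifP => [//|/negP nt]; case: nt; apply/eqP/ord_inj.
move=> /negP ne; have -> : (nat_of_ord (bword_perm w j) == (ord_max : 'I_n.+1).+1) = false.
  by apply/negbTE; rewrite neq_ltn bn.
case: ifP => [/eqP tj|_]; last by rewrite val_wd.
by case: ne; rewrite tj.
Qed.

Let g1max : g1 ord_max = wd ord_max.
Proof.
rewrite /g1 bword_perm_cat permM perm_widen_max bword_perm_cons permM /bword_perm big_nil perm1.
apply: ord_inj; rewrite /lswap val_swap val_wd -[nat_of_ord ord_max]/(n.+1) /=.
by rewrite gtn_eqF // eqxx.
Qed.

Let P1_close k : P1 k 1 = P1 (g1 k) 0.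
Proof.
have [[j ->]|->] := wdP k; last by rewrite P1max1 g1max P1wd0.
by rewrite P1wd1 g1wd; case: ifP => _; rewrite ?P1max0 ?P1wd0.
Qed.

Let cat_addC (T : topologicalType) (f g : T -> C) x : continuous_at x f ->
  continuous_at x g -> continuous_at x (fun y => f y + g y).
Proof.
move=> cf cg; rewrite (_ : (fun y => _) = fun y => ((f y).1 + (g y).1, (f y).2 + (g y).2)).
  by cont.
by apply/funext.
Qed.

Let spc j : continuous (fun u => string_path w j (phi u) : C).
Proof.
move=> u; apply: (@catcomp _ _ _ phi (string_path w j)); first exact: string_path_cont.
by rewrite /phi; cont.
Qed.

Let polc (r b : R -> R) : continuous r -> continuous b -> continuous (fun u => pol (r u) (b u)).
Proof. by move=> cr cb u; rewrite /pol /turn; cont. Qed.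

Let P1_cont k : continuous (P1 k).
Proof.
have [[j ->]|->] := wdP k; last first.
  rewrite (_ : P1 _ = fun u => pol (rY (tm u)) (bY (tm u))); last exact/funext.
  by apply: polc => u; rewrite /rY /bY /tm /clamp; cont.
have -> : P1 (wd j) = fun u => if top j
    then string_path w j (phi u) + (pol (r1 (tm u)) (b1 (tm u)) - (N, 0))
    else string_path w j (phi u).
  by apply/funext => u; exact: P1wd.
case: (top j); last exact: spc.
move=> u; apply: cat_addC; first exact: spc.
apply: cat_addC; last exact: cat_cst.
by apply: polc => {}u; rewrite /r1 /b1 /tm /clamp; cont.
Qed.

Let P2_cont j : continuous (P2 j).
Proof.
rewrite /P2; case: (top j); last exact: spc.
move=> u; apply: cat_addC; first exact: spc.
apply: cat_addC; last exact: cat_cst.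
by apply: polc => {}u; rewrite /r2 /b2 /tm /clamp; cont.
Qed.

(* The linear homotopy from the pair x, y to the pair x', y' collides at time s. *)
Let opposite s (x y x' y' : C) :=
  (1 - s) * (y.1 - x.1) + s * (y'.1 - x'.1) = 0 /\
  (1 - s) * (y.2 - x.2) + s * (y'.2 - x'.2) = 0.

Let opposite_sym s x y x' y' : opposite s x y x' y' -> opposite s y x y' x'.
Proof. by rewrite /opposite; lra. Qed.

Let opposite_re s x y x' y' : 0 <= s <= 1 -> x.1 < y.1 -> x'.1 < y'.1 ->
  ~ opposite s x y x' y'.
Proof.
move=> s01 xy xy' [e _]; have [sz|sn] := eqVneq s 0; first by rewrite sz in e; lra.
have s0 : 0 < s by rewrite lt_neqAle eq_sym sn; lra.
have A : 0 <= (1 - s) * (y.1 - x.1) by apply: mulr_ge0; lra.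
have B : 0 < s * (y'.1 - x'.1) by apply: mulr_gt0; lra.
by lra.
Qed.

Let P0wd_early j u : 0 <= u <= 2^-1 -> P0 (wd j) u = string_path w j ((size w)%:R * (2 * u)).
Proof. by move=> /andP[u0 u1]; rewrite /P0 wpath_halves1 // string_path_widen size_widen. Qed.

Let P0max_early u : 0 <= u <= 2^-1 -> P0 ord_max u = (n.+1%:R, 0).
Proof. by move=> /andP[u0 u1]; rewrite /P0 wpath_halves1 // string_path_widen_max. Qed.

Let P0_late k u : 2^-1 <= u <= 1 ->
  P0 k u = letter_path sigma (bword_perm (widen w) k) (2 * u - 1).
Proof.
by move=> /andP[u0 u1]; rewrite /P0 wpath_halves2 //= mul1r ifT //; lra.
Qed.

Let letter_sigma_side k t : (k < n)%N -> letter_path sigma k t = ((k : nat)%:R, 0) :> C.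
Proof.
move=> kn; rewrite /letter_path !nat_ord_eq lposE rposE -[nat_of_ord ord_max]/n.
by rewrite !ltn_eqF // ltnW.
Qed.

Let letter_sigma_left k t : (k : nat) = n ->
  letter_path sigma k t = (N + 2^-1 - 2^-1 * cos (pi * t), - (1 * 2^-1 * sin (pi * t))) :> C.
Proof.
by move=> kn; rewrite /letter_path !nat_ord_eq lposE -[nat_of_ord sigma.1]/n kn eqxx.
Qed.

Let letter_sigma_right k t : (k : nat) = n.+1 ->
  letter_path sigma k t = (N + 2^-1 + 2^-1 * cos (pi * t), 1 * 2^-1 * sin (pi * t)) :> C.
Proof.
move=> kn; rewrite /letter_path !nat_ord_eq lposE rposE -[nat_of_ord sigma.1]/n kn.
by rewrite gtn_eqF // eqxx.
Qed.

(** While [w] runs, the additional string stays to the right of all others. During [sigma] it is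
    separated from the top string by imaginary parts and from the remaining ones by real parts. *)
Let P01_wd_max s j u : 0 <= s <= 1 -> 0 <= u <= 1 ->
  ~ opposite s (P0 (wd j) u) (P0 ord_max u) (P1 (wd j) u) (P1 ord_max u).
Proof.
move=> s01 u01; have [uh|uh] := leP u 2^-1.
  have u0h : 0 <= u <= 2^-1 by lra.
  apply: opposite_re => //; last first.
    apply: le_lt_trans (Ymax_early u0h); have [-> _] := Pearly j uh.
    by have [/andP[_ h] _] := string_path_bnd w j ((size w)%:R * (2 * u)); rewrite -natr1 in h; lra.
  rewrite P0wd_early // P0max_early //.
  by have [/andP[_ h] _] := string_path_bnd w j ((size w)%:R * (2 * u)); move: h; rewrite /= -natr1; lra.
have uh1 : 2^-1 <= u <= 1 by lra.
have hc : -1 <= cos (pi * (2 * u - 1)) <= 1 by rewrite cos_geN1 cos_le1.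
rewrite (P0_late _ uh1) (P0_late ord_max uh1) perm_widen perm_widen_max.
rewrite (letter_sigma_right _ (erefl : nat_of_ord (ord_max : 'I_n.+2) = n.+1)).
case tj: (top j); last first.
  have nt := negbT tj; have lt := ntopE nt; have [-> _] := Pside u nt.
  have ltn : (bword_perm w j < n)%N.
    by rewrite -(ltr_nat R); lra.
  rewrite letter_sigma_side ?val_wd // str2; last by lra.
  apply: opposite_re => //=; first by lra.
  have [|_ h _] := @late_re ((bword_perm w)^-1%g ord_max) u uh1; last by lra.
  by rewrite /top permKV.
rewrite letter_sigma_left; last by rewrite val_wd (eqP tj).
move=> [e1 e2]; have im := late_im uh1 tj.
have s0 : 0 <= sin (pi * (2 * u - 1)).
  by apply: sin_ge0_pi; have := pi_gt0 R; nra.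
(* The imaginary difference is [(1 - s)] times a nonnegative number plus [s] times a positive one;
   what remains is the half turn itself. *)
have sz : s = 0 by move: e2; rewrite /=; nra.
move: e1 e2; rewrite sz /= => e1 e2.
by have := cos2Dsin2 (pi * (2 * u - 1)); nra.
Qed.

Let P01_wd_wd s i j u : 0 <= s <= 1 -> 0 <= u <= 1 -> i != j ->
  ~ opposite s (P0 (wd i) u) (P0 (wd j) u) (P1 (wd i) u) (P1 (wd j) u).
Proof.
move=> s01 u01 ij; have [uh|uh] := leP u 2^-1.
  have u0h : 0 <= u <= 2^-1 by lra.
  have [-> _] := Pearly i uh; have [-> _] := Pearly j uh; rewrite !P0wd_early //.
  move=> [e1 e2]; move/negP: ij; apply; apply/eqP.
  apply: (@string_path_inj R _ w ((size w)%:R * (2 * u))).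
  rewrite /= [LHS]surjective_pairing [RHS]surjective_pairing; congr (_, _); lra.
have uh1 : 2^-1 <= u <= 1 by lra.
have hc : -1 <= cos (pi * (2 * u - 1)) <= 1 by rewrite cos_geN1 cos_le1.
rewrite (P0_late (wd i) uh1) (P0_late (wd j) uh1) !perm_widen.
have key i' j' : ~~ top i' -> top j' -> ~ opposite s
    (letter_path sigma (wd (bword_perm w i')) (2 * u - 1))
    (letter_path sigma (wd (bword_perm w j')) (2 * u - 1)) (P1 (wd i') u) (P1 (wd j') u).
  move=> nt tj; have lt := ntopE nt; have [-> _] := Pside u nt.
  have ltn : (bword_perm w i' < n)%N by rewrite -(ltr_nat R); lra.
  rewrite letter_sigma_side ?val_wd // letter_sigma_left; last by rewrite val_wd (eqP tj).
  rewrite str2; last by lra.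
  apply: opposite_re => //=; first by lra.
  by have [h _ _] := @late_re j' u uh1 tj; lra.
case ti: (top i); case tj: (top j).
- by move/negP: ij => []; apply/eqP/(@perm_inj _ (bword_perm w)); rewrite (eqP ti) (eqP tj).
- by move=> /opposite_sym; apply: key; rewrite ?tj.
- by apply: key; rewrite ?ti.
have lti : (bword_perm w i < n)%N by rewrite -(ltr_nat R); have := ntopE (negbT ti); lra.
have ltj : (bword_perm w j < n)%N by rewrite -(ltr_nat R); have := ntopE (negbT tj); lra.
have [-> _] := Pside u (negbT ti); have [-> _] := Pside u (negbT tj).
have uh2 : 2^-1 <= u by lra.
rewrite !letter_sigma_side ?val_wd // !str2 //.
move=> [e1 _]; move/negP: ij; apply; apply/eqP/(@perm_inj _ (bword_perm w))/ord_inj/eqP.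
by rewrite -(eqr_nat R); apply/eqP; move: e1; rewrite /=; lra.
Qed.

Let P01 s k l u : 0 <= s <= 1 -> 0 <= u <= 1 -> k != l ->
  ~ opposite s (P0 k u) (P0 l u) (P1 k u) (P1 l u).
Proof.
move=> s01 u01; have [[i ->]|->] := wdP k; have [[j ->]|->] := wdP l.
- by rewrite (inj_eq wd_inj); exact: P01_wd_wd.
- by move=> _; exact: P01_wd_max.
- by move=> _ /opposite_sym; exact: P01_wd_max.
- by rewrite eqxx.
Qed.

Let P1_inj u k l : 0 <= u <= 1 -> k != l -> P1 k u != P1 l u.
Proof.
move=> u01 kl; apply/eqP => e; apply: (@P01 1 k l u) => //; first by lra.
by rewrite /opposite e; split; ring.
Qed.

Let step1 : isotopic (closure_bword (widen w ++ [:: sigma]) : set (C * C)) (cl P1).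
Proof.
apply: isotopic_trans (closure_halves _ _) _; apply: (@cl_straight _ _ _ _ g1).
- by move=> k; apply: wpath_cont; exact: halves_cont.
- exact: P1_cont.
- move=> k; rewrite [RHS]wpath_halves1 ?invr_ge0 // !mulr0 string_path0.
  rewrite /P0 /wpath string_path_end // /halves size_cat natrD min_r ?max_l ?mulr1; lra.
- exact: P1_close.
- by move=> s u k l s01 u01 kl e1 e2; exact: (P01 s01 u01 kl).
Qed.

Let P2_close j : P2 j 1 = P2 (bword_perm w j) 0.
Proof.
have h0 : (0 : R) <= 2^-1 by rewrite invr_ge0.
have h : (2^-1 : R) <= 1 by lra.
have [_ ->] := Pearly (bword_perm w j) h0; rewrite !mulr0 string_path0.
case tj: (top j); last by have [_ ->] := Pside 1 (negbT tj); rewrite str2.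
have [_ ->] := Plate h tj.
have -> : r2 (tm 1) = N by rewrite /r2 /tm !clamp1; lra.
have -> : b2 (tm 1) = 0 by rewrite /b2 /tm !clamp1; [ring|lra..].
by rewrite (eqP tj) pol0.
Qed.

Let P2_straight s i j u : 0 <= s <= 1 -> 0 <= u <= 1 -> i != j ->
  ~ opposite s (string_path w i (phi u)) (string_path w j (phi u)) (P2 i u) (P2 j u).
Proof.
move=> s01 u01 ij; have [uh|uh] := leP u 2^-1.
  have [_ ->] := Pearly i uh; have [_ ->] := Pearly j uh; rewrite !phi1 //.
  move=> [e1 e2]; move/negP: ij; apply; apply/eqP.
  apply: (@string_path_inj R _ w ((size w)%:R * (2 * u))).
  rewrite /= [LHS]surjective_pairing [RHS]surjective_pairing; congr (_, _); lra.
have uh1 : 2^-1 <= u <= 1 by lra.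
have uh2 : 2^-1 <= u by lra.
have key i' j' : ~~ top i' -> top j' -> ~ opposite s
    (string_path w i' (phi u)) (string_path w j' (phi u)) (P2 i' u) (P2 j' u).
  move=> nt tj; have lt := ntopE nt; have [_ ->] := Pside u nt.
  rewrite !str2 //; apply: opposite_re => //=; first by rewrite (topE tj); lra.
  by have [_ _ h] := @late_re j' u uh1 tj; lra.
case ti: (top i); case tj: (top j).
- by move/negP: ij => []; apply/eqP/(@perm_inj _ (bword_perm w)); rewrite (eqP ti) (eqP tj).
- by move=> /opposite_sym; apply: key; rewrite ?tj.
- by apply: key; rewrite ?ti.
have [_ ->] := Pside u (negbT ti); have [_ ->] := Pside u (negbT tj).
rewrite !str2 // => -[e1 _]; move/negP: ij; apply; apply/eqP/(@perm_inj _ (bword_perm w))/ord_inj/eqP.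
by rewrite -(eqr_nat R); apply/eqP; move: e1; rewrite /=; lra.
Qed.

Let P2_inj u i j : 0 <= u <= 1 -> i != j -> P2 i u != P2 j u.
Proof.
move=> u01 ij; apply/eqP => e; apply: (@P2_straight 1 i j u) => //; first by lra.
by rewrite /opposite e; split; ring.
Qed.

Let step3 : isotopic (closure_bword w : set (C * C)) (cl P2).
Proof.
rewrite closure_bwordE; apply: (@isotopic_trans _ _ (cl (wpath w phi))).
  apply: cl_reparam.
  - by move=> u; cont.
  - by move=> u; rewrite /phi; cont.
  - by rewrite mulr0.
  - by rewrite /phi mulr0 min_l ?mulr0 //; lra.
  - by rewrite mulr1 ler_nat.
  - by rewrite /phi min_r ?mulr1 //; lra.
apply: (@cl_straight _ _ _ _ (bword_perm w)).
- exact: spc.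
- exact: P2_cont.
- move=> j; rewrite /wpath str2; last by lra.
  by rewrite phi1 ?mulr0 ?mulr0 ?string_path0 // invr_ge0.
- exact: P2_close.
- by move=> s u i j s01 u01 ij e1 e2; exact: (P2_straight s01 u01 ij).
Qed.

(** [V1], [V2] and [V5] identify the two closed braids away from the turn; [V3], [V4] and [V6]
    describe the turn, at radius n + 3 with the angle affine in time. *)
Let V1 j u : ~~ top j -> P1 (wd j) u = P2 j u.
Proof. by move=> nt; have [-> ->] := Pside u nt. Qed.

Let V2 j u : top j -> u <= 7 / 10 -> P1 (wd j) u = P2 j u.
Proof.
move=> tj u7; have [uh|uh] := leP u 2^-1; first by have [-> ->] := Pearly j uh.
have [-> ->] := Plate (ltW uh) tj.
have -> : r1 (tm u) = r2 (tm u) by rewrite /r1 /r2 (@clamp0 _ (tm u - 3)) /tm; lra.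
have -> // : b1 (tm u) = b2 (tm u).
by rewrite /b1 /b2 max_l ?(@clamp0 _ (tm u - 2)) ?(@clamp0 _ (tm u - 4)) /tm; [ring|lra..].
Qed.

Let V3 j u : top j -> 7 / 10 <= u <= 1 ->
  P1 (wd j) u = pol (N + 3) (eta * (-1 + 2 / 11 * (10 * u - 7))).
Proof.
move=> tj u7; have uh : 2^-1 <= u by lra.
have [-> _] := Plate uh tj.
have -> : r1 (tm u) = N + 3 by rewrite /r1 clamp1 /tm; lra.
have -> // : b1 (tm u) = eta * (-1 + 2 / 11 * (10 * u - 7)).
by rewrite /b1 clamp1 ?max_r /tm; [congr (_ * _); ring|lra..].
Qed.

Let V4 u : 0 <= u <= 8 / 10 ->
  P1 ord_max u = pol (N + 3) (eta * (-1 + 2 / 11 * (10 * u + 3))).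
Proof.
move=> u8; rewrite P1max.
have -> : rY (tm u) = N + 3 by rewrite /rY clamp0 /tm; lra.
have -> // : bY (tm u) = eta * (-1 + 2 / 11 * (10 * u + 3)).
by rewrite /bY clamp0 ?min_l /tm; [congr (_ * _); ring|lra..].
Qed.

Let V5 j u : top j -> 8 / 10 <= u -> P1 ord_max u = P2 j u.
Proof.
move=> tj u8; have uh : 2^-1 <= u by lra.
have [_ ->] := Plate uh tj; rewrite P1max.
have -> : rY (tm u) = r2 (tm u).
  by rewrite /rY /r2 (@clamp1 _ (tm u - 1)) // /tm; lra.
have -> // : bY (tm u) = b2 (tm u).
by rewrite /bY /b2 min_r ?(@clamp1 _ (tm u)) ?(@clamp1 _ (tm u - 2)) /tm; lra.
Qed.

Let V6 j u : top j -> 7 / 10 <= u <= 8 / 10 ->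
  P2 j u = pol (N + 3) (eta * (-1 + 2 * (10 * u - 7))).
Proof.
move=> tj u7; have uh : 2^-1 <= u by lra.
have [_ ->] := Plate uh tj.
have -> : r2 (tm u) = N + 3 by rewrite /r2 clamp1 ?clamp0 /tm; lra.
have -> // : b2 (tm u) = eta * (-1 + 2 * (10 * u - 7)).
by rewrite /b2 clamp1 ?(@clamp0 _ (tm u - 4)) ?clamp_id /tm; lra.
Qed.

(** [cc v] is the fraction of the arc passed at the angle [v], and [th1], [th2] are the times in
    [P1], [P2] at which this angle is reached. They start at 7/10 and end at 18/10 and 8/10, which
    are equal modulo a period. *)
Let cc v : R := clamp ((v - 2^-1 + eta) / (2 * eta)).
Let th1 v := 7 / 10 + 11 / 10 * cc v.
Let th2 v := 7 / 10 + 1 / 10 * cc v.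
(* After the exchange of coordinates the helix is a strand over the arc of
   angles [1/2 - eta, 1/2 + eta], turning once too much around the axis; it is
   straightened inside the disc of radius 1 / (n + 3). *)
Let hh s (_ : unit) v : C :=
  ((N + 3)^-1 * ((1 - s) * (turn (th1 v)).1 + s * (turn (th2 v)).1),
   (N + 3)^-1 * ((1 - s) * (turn (th1 v)).2 + s * (turn (th2 v)).2)).
Let JJ : set R := [set v | 2^-1 - eta <= v <= 2^-1 + eta].
Let restP2 : set (C * C) := [set z | exists j u, [/\ 0 <= u <= 1,
  [\/ ~~ top j, u <= 7 / 10 | 8 / 10 <= u] & z = nrm (turn u, - P2 j u)]].

Let cc_in x : 0 <= x <= 1 -> cc (2^-1 + eta * (-1 + 2 * x)) = x.
Proof.
move=> x01; have e0 := eta0; rewrite /cc (_ : _ / _ = x) ?clamp_id //.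
by field; lra.
Qed.

Let hh_strand s v : nrm (hh s tt v, turn v) =
  nrm (((1 - s) * (turn (th1 v)).1 + s * (turn (th2 v)).1,
        (1 - s) * (turn (th1 v)).2 + s * (turn (th2 v)).2), pol (N + 3) v).
Proof.
rewrite -[RHS](@nrm_scl _ (N + 3)^-1) ?invr_gt0 // /scl /pol.
by cbn [fst snd]; rewrite ![_^-1 * (_ * _)]mulrA mulVf ?gt_eqF // !mul1r /turn.
Qed.

Let hh0 v : nrm (hh 0 tt v, turn v) = nrm (turn (th1 v), pol (N + 3) v).
Proof. by rewrite hh_strand !subr0 !mul1r !mul0r !addr0 -surjective_pairing. Qed.

Let hh1 v : nrm (hh 1 tt v, turn v) = nrm (turn (th2 v), pol (N + 3) v).
Proof. by rewrite hh_strand !subrr !mul1r !mul0r !add0r -surjective_pairing. Qed.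

Let topX : top ((bword_perm w)^-1%g ord_max). Proof. by rewrite /top permKV. Qed.

Let JJ_in x : 0 <= x <= 1 -> JJ (2^-1 + eta * (-1 + 2 * x)).
Proof. by move=> x01; have e0 := eta0; rewrite /JJ /=; apply/andP; split; nra. Qed.

Let swapP1 : swapC @` cl (fun k u => - P1 k u) = restP2 `|` strands hh JJ 0.
Proof.
have strand x : 0 <= x <= 1 -> strands hh JJ 0
    (nrm (turn (7 / 10 + 11 / 10 * x), - pol (N + 3) (eta * (-1 + 2 * x)))).
  move=> x01; exists tt, (2^-1 + eta * (-1 + 2 * x)); split; first exact: JJ_in.
  by rewrite hh0 polN [_ + 2^-1]addrC /th1 cc_in.
rewrite swap_cl eqEsubset; split=> [_ [k [u [u01 ->]]]|_ [[j [u [u01 ju ->]]]|[[] [v [vJ ->]]]]].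
- have [[j ->]|->] := wdP k.
    case tj: (top j); last first.
      by left; exists j, u; rewrite V1 ?tj //; split=> //; constructor.
    have [u7|u7] := leP u (7 / 10).
      by left; exists j, u; rewrite V2 //; split=> //; constructor.
    right; have x01 : 0 <= (10 * u - 7) / 11 <= 1 by lra.
    have := strand _ x01; rewrite (_ : 7 / 10 + _ = u); last by field.
    rewrite V3 //; last by lra.
    by rewrite (_ : 2 * ((10 * u - 7) / 11) = 2 / 11 * (10 * u - 7)) //; field.
  have [u8|u8] := leP (8 / 10) u.
    left; exists ((bword_perm w)^-1%g ord_max), u; rewrite (V5 topX u8).
    by split=> //; constructor 3.
  (* The additional string is the second lap of the helix, so its time [u] stands for [u + 1]. *)
  right; have x01 : 0 <= (10 * u + 3) / 11 <= 1 by lra.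
  have := strand _ x01; rewrite (_ : 7 / 10 + _ = u + 1) ?turnD1; last by field.
  rewrite V4; last by lra.
  by rewrite (_ : 2 * ((10 * u + 3) / 11) = 2 / 11 * (10 * u + 3)) //; field.
- case tj: (top j); last by exists (wd j), u; rewrite V1 ?tj.
  case: ju => [|u7|u8]; first by rewrite tj.
    by exists (wd j), u; rewrite V2.
  by exists ord_max, u; rewrite (V5 tj u8).
- have e0 := eta0; have [x x01 ->] : exists2 x, 0 <= x <= 1 & v = 2^-1 + eta * (-1 + 2 * x).
    move: vJ; rewrite /JJ /= => vJ.
    exists ((v - 2^-1 + eta) / (2 * eta)); last by field; lra.
    by apply/andP; split; [apply: divr_ge0; lra|rewrite ler_pdivrMr; lra].
  rewrite hh0 /th1 cc_in // [2^-1 + _]addrC -polN.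
  have [t1|t1] := leP (7 / 10 + 11 / 10 * x) 1.
    exists (wd ((bword_perm w)^-1%g ord_max)), (7 / 10 + 11 / 10 * x); split; first by lra.
    rewrite (V3 topX); last by lra.
    by have -> : -1 + 2 / 11 * (10 * (7 / 10 + 11 / 10 * x) - 7) = -1 + 2 * x by field.
  exists ord_max, (11 / 10 * x - 3 / 10); split; first by lra.
  rewrite V4; last by lra.
  have -> : turn (7 / 10 + 11 / 10 * x) = turn (11 / 10 * x - 3 / 10).
    by rewrite -[RHS]turnD1; congr turn; field.
  by have -> : -1 + 2 / 11 * (10 * (11 / 10 * x - 3 / 10) + 3) = -1 + 2 * x by field.
Qed.

Let swapP2 : swapC @` cl (fun j u => - P2 j u) = restP2 `|` strands hh JJ 1.
Proof.
rewrite swap_cl eqEsubset; split=> [_ [j [u [u01 ->]]]|_ [[j [u [u01 ju ->]]]|[[] [v [vJ ->]]]]].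
- case tj: (top j); last by left; exists j, u; split=> //; constructor; rewrite tj.
  have [u7|u7] := leP u (7 / 10); first by left; exists j, u; split=> //; constructor 2.
  have [u8|u8] := leP (8 / 10) u; first by left; exists j, u; split=> //; constructor 3.
  have x01 : 0 <= 10 * u - 7 <= 1 by lra.
  right; exists tt, (2^-1 + eta * (-1 + 2 * (10 * u - 7))); split; first exact: JJ_in.
  rewrite hh1 V6 //; last by lra.
  rewrite polN [_ + 2^-1]addrC /th2 cc_in //.
  by have -> : 7 / 10 + 1 / 10 * (10 * u - 7) = u by field.
- by exists j, u.
- have e0 := eta0; have [x x01 ->] : exists2 x, 0 <= x <= 1 & v = 2^-1 + eta * (-1 + 2 * x).
    move: vJ; rewrite /JJ /= => vJ.
    exists ((v - 2^-1 + eta) / (2 * eta)); last by field; lra.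
    by apply/andP; split; [apply: divr_ge0; lra|rewrite ler_pdivrMr; lra].
  rewrite hh1 /th2 cc_in // [2^-1 + _]addrC -polN.
  exists ((bword_perm w)^-1%g ord_max), (7 / 10 + 1 / 10 * x); split; first by lra.
  rewrite (V6 topX); last by lra.
  by have -> : -1 + 2 * (10 * (7 / 10 + 1 / 10 * x) - 7) = -1 + 2 * x by field.
Qed.

(** Away from the turn the strings remain within radius n + 2, except while the top one moves in or
    out along a ray of angle eta or - eta. Those rays meet the arc only at its ends, where the
    strand does not move. *)
Let rest_cases j u : 0 <= u <= 1 -> [\/ ~~ top j, u <= 7 / 10 | 8 / 10 <= u] ->
  mag (P2 j u) <= N + 2 \/
  exists r b, [/\ 0 <= r, (b = eta \/ b = - eta) & P2 j u = pol r b].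
Proof.
move=> u01 ju.
have str t : mag (string_path w j t) <= N + 2.
  have [/andP[x0 xN] y2] := string_path_bnd w j t; move: xN; rewrite -natr1 => xN.
  have hN := N0; have hN2 : 0 <= N + 2 by lra.
  rewrite -(@ler_pXn2r _ 2) ?nnegrE ?mag_ge0 // mag_sqr.
  move: y2; rewrite ler_norml; move: (string_path _ _ _) x0 xN => [x y] /= x0 xN y2.
  by nra.
case tj: (top j); last by left; have [_ ->] := Pside u (negbT tj); exact: str.
have [uh|uh] := leP u 2^-1; first by left; have [_ ->] := Pearly j uh; exact: str.
have [_ ->] := Plate (ltW uh) tj; have hN := N0.
have low : r2 (tm u) = N -> mag (pol (r2 (tm u)) (b2 (tm u))) <= N + 2.
  by move=> ->; rewrite mag_turn //; lra.
have [t1|t1] := leP (tm u) 1.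
  by left; apply: low; rewrite /r2 !clamp0; lra.
have [t4|t4] := leP 4 (tm u).
  by left; apply: low; rewrite /r2 !clamp1; lra.
right; exists (r2 (tm u)), (b2 (tm u)); case: ju => [|u7|u8]; first by rewrite tj.
  have t2 : tm u <= 2 by rewrite /tm; lra.
  split=> //.
    by rewrite /r2 (@clamp0 _ (tm u - 3)); have := clamp01 (tm u - 1); lra.
  by right; rewrite /b2 clamp1 ?clamp0; lra.
have t3 : 3 <= tm u by rewrite /tm; lra.
split=> //.
  by rewrite /r2 (@clamp1 _ (tm u - 1)); have := clamp01 (tm u - 3); lra.
by left; rewrite /b2 !(@clamp1 _ (_ u)) ?(@clamp1 _ (_ - 2)) ?(@clamp0 _ (_ - 4)); lra.
Qed.

Let cc_half v : (v = 2^-1 + eta -> cc v = 1) /\ (v = 2^-1 - eta -> cc v = 0).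
Proof.
have e0 := eta0; split=> ->; rewrite /cc.
  by rewrite (_ : _ / _ = 1) ?clamp1 //; field; lra.
by rewrite (_ : _ / _ = 0) ?clamp0 //; field; lra.
Qed.

(** At the ends of the arc the two times differ by 0 or by a full period, so the straightening is
    constant there. *)
Let hh_static s t v : cc v = 0 \/ cc v = 1 -> hh s tt v = hh t tt v.
Proof.
rewrite /hh /th1 /th2; case=> ->; first by rewrite !mulr0; congr (_, _); ring.
have -> : turn (7 / 10 + 11 / 10 * 1) = turn (7 / 10 + 1 / 10 * 1) :> C.
  by rewrite -[RHS]turnD1; congr turn; field.
by congr (_, _); ring.
Qed.

(** Exchanging coordinates inverts radii: strings within radius n + 2 become points of modulus at
    least 1/(n + 2), while the strand stays in the disc of radius 1/(n + 3). The factor 1/2 pays for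
    the passage to the sup norm. *)
Let gap : R := ((N + 2)^-1 - (N + 3)^-1) / 2.

Let gap_gt0 : 0 < gap.
Proof.
have := N0 => hN; rewrite /gap divr_gt0 // subr_gt0 ltf_pV2 ?posrE; lra.
Qed.

Let rest_far x v (i : unit) : 0 <= v <= 1 -> restP2 (nrm (x, turn v)) ->
  (forall s t, hh s i v = hh t i v) \/
  (forall s, 0 <= s <= 1 -> gap <= mx (x - hh s i v)).
Proof.
case: i => v01 [j [u [u01 ju]]] e.
have x0 : 0 < nsq (x, turn v) by exact: nsq_turn.
have y0 : 0 < nsq (turn u, - P2 j u).
  exact: nsq_turnl.
have [a a0 /pair_equal_spec[/= E1 E2]] := nrm_inj x0 y0 e.
have e0 := eta0; have hN := N0.
have [far|[r [b [r0 bE PE]]]] := rest_cases u01 ju; last first.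
  left => s t; apply: hh_static.
  have e3 : pol a v = pol r (b + 2^-1) by rewrite -polN -PE E2.
  have hb : 0 < b + 2^-1 < 1 by case: bE => ->; lra.
  have vE := pol_inj a0 r0 v01 hb e3.
  by have [c1 c0] := cc_half v; case: bE => bE; [right; apply: c1|left; apply: c0]; rewrite vE bE; ring.
right => s s01.
have aN : a <= N + 2.
  rewrite -(@mag_turn _ a v (ltW a0)) -E2 (_ : mag (- P2 j u) = mag (P2 j u)) //.
  by rewrite /mag /= !sqrrN.
have ai : (N + 2)^-1 <= a^-1 by rewrite lef_pV2 ?posrE //; lra.
(* Components along the direction of [x] are compared: [x] has component 1/a, and the strand, a
   convex combination of vectors of length 1/(n + 3), has at most that length. *)
set c := turn u in E1 *.
have d1 : x.1 * c.1 + x.2 * c.2 = a^-1.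
  have -> : x = (a^-1 * c.1, a^-1 * c.2).
    by rewrite E1 /= !mulrA mulVf ?gt_eqF // !mul1r -surjective_pairing.
  cbn [fst snd]; rewrite -!mulrA -mulrDr -!expr2.
  by rewrite /c turn_norm mulr1.
have d2 : (hh s tt v).1 * c.1 + (hh s tt v).2 * c.2 <= (N + 3)^-1.
  rewrite /hh [X in X <= _](_ : _ = (N + 3)^-1 * ((1 - s) * ((turn (th1 v)).1 * c.1 + (turn (th1 v)).2 * c.2)
    + s * ((turn (th2 v)).1 * c.1 + (turn (th2 v)).2 * c.2))); last by cbn [fst snd]; ring.
  have h1 := turn_dot (th1 v) u; have h2 := turn_dot (th2 v) u.
  apply: ler_piMr; first by rewrite invr_ge0 ltW.
  move: h1 h2; rewrite -/c; move: (_ + _ * c.2) (_ + _ * c.2) => p q h1 h2.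
  by have [s0 s1] := andP s01; nra.
have d3 : (x - hh s tt v).1 * c.1 + (x - hh s tt v).2 * c.2 <= 2 * mx (x - hh s tt v).
  have m1 := mx_le1 (x - hh s tt v); have m2 := mx_le2 (x - hh s tt v).
  have c1 : `|c.1| <= 1 by exact: cos_max.
  have c2 : `|c.2| <= 1 by exact: sin_max.
  have k (p q M : R) : `|p| <= M -> `|q| <= 1 -> p * q <= M.
    move=> pM q1; apply: le_trans (ler_norm _) _; rewrite normrM.
    by apply: le_trans pM; rewrite ler_piMr.
  by have := k _ _ _ m1 c1; have := k _ _ _ m2 c2; lra.
have d4 : (x - hh s tt v).1 * c.1 + (x - hh s tt v).2 * c.2 =
    (x.1 * c.1 + x.2 * c.2) - ((hh s tt v).1 * c.1 + (hh s tt v).2 * c.2).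
  by rewrite -[(x - _).1]/(x.1 - _) -[(x - _).2]/(x.2 - _); ring.
by rewrite /gap; lra.
Qed.

Let step2 : isotopic (cl (fun k u => - P1 k u)) (cl (fun j u => - P2 j u)).
Proof.
have e0 := eta0.
apply: isotopic_swap; rewrite swapP1 swapP2; apply: (@strands_isotopy _ _ _ _ _ gap).
- move=> i q; rewrite /hh /th1 /th2 /cc /turn /clamp; cont.
- by move=> u; rewrite /JJ /=; lra.
- move=> _ [j [u [_ _ ->]]]; exact/nrm_sphere/nsq_turnl.
- exact: gap_gt0.
- by move=> s u [] [].
- have c0 : cc 0 = 0.
    rewrite /cc clamp0 // sub0r mulr_le0_ge0 ?invr_ge0; lra.
  have c1 : cc 1 = 1.
    by rewrite /cc clamp1 // ler_pdivlMr; lra.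
  move=> s t B B0 _ _; apply: eq_bigr => -[] _.
  by rewrite (hh_static s t (or_introl c0)) (hh_static s t (or_intror c1)) !B0.
- exact: rest_far.
Qed.

Lemma stabilization_aux : isotopic (closure_bword w : set (C * C))
  (closure_bword (widen w ++ [:: sigma])).
Proof.
apply: isotopic_trans step3 _.
apply: isotopic_trans (cl_opp P2_cont P2_inj P2_close) _.
apply: (isotopic_trans (isotopic_sym (@cl_sphere _ _ _) step2)).
apply: (isotopic_trans _ (isotopic_sym (@cb_sphere _ _ _) step1)).
exact: isotopic_sym (@cl_sphere _ _ _) (cl_opp P1_cont P1_inj P1_close).
Qed.

End Stabilization.

Theorem closure_stabilization (R : realType) (n : nat) (w : bword n.+1) :
  isotopic (closure_bword w : set ((R * R) * (R * R)))
    (closure_bword (widen w ++ [:: (ord_max, true)])).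
Proof.
have [e e0 ec] := @small_angle R n; exact: stabilization_aux e0 ec.
Qed.

(** * Closures of cyclic words *)

Section Knots.
Context {R : realType}.
Local Notation C := (R * R)%type.
Local Notation C2 := ((R * R) * (R * R))%type.

Lemma turnDn (u : R) (k : nat) : turn (u + k%:R) = turn u.
Proof. by elim: k => [|k IH]; rewrite ?addr0 // -natr1 addrA turnD1. Qed.

Lemma nat_part (m : nat) (x : R) : 0 <= x < m%:R ->
  exists2 k : nat, (k < m)%N & k%:R <= x < k%:R + 1.
Proof.
elim: m => [|m IH] /andP[x0 xm]; first by lra.
have [xm'|mx] := ltP x m%:R.
  by have [|k km kx] := IH; [rewrite x0|exists k => //; exact: leqW].
by exists m => //; rewrite mx natr1.
Qed.

Lemma turn_image : turn @` `[(0 : R), 1]%classic = @sphere1 R.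
Proof.
rewrite eqEsubset; split=> [_ [u _ <-]|z zS]; first exact: turn_norm.
have [u u01 ->] := turn_surj zS; exists u => //=; rewrite in_itv /=; lra.
Qed.

Lemma compact_sphere1 : compact (@sphere1 R).
Proof.
rewrite -turn_image; apply: continuous_compact; last exact: segment_compact.
exact/continuous_subspaceT/continuous_turn.
Qed.

Lemma nrm_turn_inj (x x' : C) (u u' : R) :
  nrm (x, turn u) = nrm (x', turn u') -> x = x' /\ turn u = turn u'.
Proof.
move=> e; have [a a0 /pair_equal_spec[/= E1 E2]] := nrm_inj (nsq_turn x u) (nsq_turn x' u') e.
have a1 : a = 1.
  by have := @mag_turn R a u (ltW a0); rewrite -E2 /mag turn_norm sqrtr1.
by rewrite E1 E2 a1 !mul1r -!surjective_pairing.
Qed.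

Section Loop.
Implicit Types (u v : R).
Context (n : nat) (p : 'I_n.+1 -> R -> C) (g : 'S_n.+1) (j0 : 'I_n.+1).
Hypothesis pc : forall j, continuous (p j).
Hypothesis pinj : forall u j k, 0 <= u <= 1 -> j != k -> p j u != p k u.
Hypothesis pg : forall j, p j 1 = p (g j) 0.
Let o k : 'I_n.+1 := iter k g j0.
Hypothesis ouniq : uniq [seq o k | k <- iota 0 n.+1].

Let o_inj k l : (k < n.+1)%N -> (l < n.+1)%N -> o k = o l -> k = l.
Proof.
move=> kn ln e; have := ouniq; move/(uniqP (o 0)) => /(_ k l).
rewrite !inE size_map size_iota !(nth_map 0) ?size_iota // !nth_iota // !add0n.
by apply.
Qed.

Let o_surj j : exists2 k, (k < n.+1)%N & j = o k.
Proof.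
have [||_ e] := uniq_min_size ouniq (s2 := enum 'I_n.+1).
- by move=> i _; rewrite mem_enum.
- by rewrite size_enum_ord size_map size_iota.
have : j \in [seq o k | k <- iota 0 n.+1] by rewrite e mem_enum.
by move=> /mapP[k]; rewrite mem_iota => kn ->; exists k.
Qed.

Let o_period : o n.+1 = o 0.
Proof.
have [k kn e] := o_surj (o n.+1); case: k kn e => [//|k] kn e.
have /o_inj : o n = o k by apply: (@perm_inj _ g); exact: e.
by move=> /(_ (leqnn _) (ltnW kn)) nk; move: kn; rewrite -nk ltnn.
Qed.

(** The strings of the cycle run one after another, written as a telescoping sum of clamped pieces
    so that no junction has to be checked for continuity. *)
Let c v : C := p (o 0) 0 +
  \sum_(k < n.+1) (p (o k) (clamp (n.+1%:R * v - k%:R)) - p (o k) 0).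

Let c_piece k v : (k < n.+1)%N -> k%:R <= n.+1%:R * v <= k%:R + 1 ->
  c v = p (o k) (n.+1%:R * v - k%:R).
Proof.
move=> kn kv; rewrite /c.
pose F i := p (o i) (clamp (n.+1%:R * v - i%:R)) - p (o i) 0.
have -> : \sum_(i < n.+1) F i = \sum_(0 <= i < n.+1) F i by rewrite big_mkord.
rewrite (big_cat_nat (n := k)) //=; last exact: ltnW.
have -> : \sum_(k <= i < n.+1) F i = F k.
  rewrite big_ltn // big1_seq ?addr0 // => i.
  rewrite mem_index_iota => /andP[_ /andP[ki _]].
  have : k%:R + 1 <= i%:R :> R by rewrite natr1 ler_nat.
  by move=> h; rewrite /F clamp0 ?subrr //; lra.
have -> : \sum_(0 <= i < k) F i = p (o k) 0 - p (o 0) 0.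
  rewrite -(telescope_sumr (fun i => p (o i) 0)) //; apply: eq_big_nat => i /andP[_ ik].
  have : i%:R + 1 <= k%:R :> R by rewrite natr1 ler_nat.
  by move=> h; rewrite /F clamp1 ?pg //; lra.
rewrite /F clamp_id; last by lra.
by rewrite addrA [p (o 0) 0 + _]addrC subrK addrC subrK.
Qed.

Let L v : C2 := nrm (c v, turn (n.+1%:R * v)).

Let L_piece k v : (k < n.+1)%N -> k%:R <= n.+1%:R * v <= k%:R + 1 ->
  L v = nrm (p (o k) (n.+1%:R * v - k%:R), turn (n.+1%:R * v - k%:R)).
Proof.
move=> kn kv; rewrite /L (c_piece kn kv); congr (nrm (_, _)).
by rewrite -[RHS](turnDn _ k) subrK.
Qed.

Let Lper : L 0 = L 1.
Proof.
rewrite (@L_piece 0 0) //; last by rewrite mulr0 add0r lexx ler01.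
rewrite (@L_piece n 1) //; last by rewrite mulr1 -natr1 lexx lerDl ler01.
have -> : n.+1%:R * 1 - n%:R = 1 :> R by rewrite mulr1 -natr1; ring.
rewrite mulr0 subr0 turn1 pg; congr (nrm (p _ _, _)).
by rewrite -o_period.
Qed.

Let L_cont : continuous L.
Proof.
have cc : continuous c.
  move=> v; rewrite (_ : c = fun v => (
    (p (o 0) 0).1 + \sum_(k < n.+1) ((p (o k) (clamp (n.+1%:R * v - k%:R))).1 - (p (o k) 0).1),
    (p (o 0) 0).2 + \sum_(k < n.+1) ((p (o k) (clamp (n.+1%:R * v - k%:R))).2 - (p (o k) 0).2))).
    by rewrite /clamp; cont; have := pc (o i); apply.
  apply/funext => {}v; rewrite /c [LHS]surjective_pairing /=; congr (_ + _, _ + _).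
    by elim/big_ind2: _ => // x a y b <- <-.
  by elim/big_ind2: _ => // x a y b <- <-.
move=> v; rewrite /L /nrm.
have z0 : Num.sqrt (nsq (c v, turn (n.+1%:R * v))) != 0.
  by rewrite gt_eqF // sqrtr_gt0 nsq_turn.
have cV : continuous_at v (fun v => (Num.sqrt (nsq (c v, turn (n.+1%:R * v))))^-1).
  by apply: catV => //; rewrite /nsq /turn; cont.
by rewrite /scl /turn; cont.
Qed.

Let L_inj u v : 0 <= u < 1 -> 0 <= v < 1 -> L u = L v -> u = v.
Proof.
move=> u01 v01; have N0 : 0 < n.+1%:R :> R by rewrite ltr0n.
have part (x : R) : 0 <= x < 1 -> exists2 k, (k < n.+1)%N & k%:R <= n.+1%:R * x < k%:R + 1.
  move=> /andP[x0 x1]; apply: nat_part; rewrite mulr_ge0 //=.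
  by rewrite -[ltRHS]mulr1 ltr_pM2l.
have [k kn ku] := part u u01; have [l ln lv] := part v v01.
rewrite (L_piece kn); last by lra.
rewrite (L_piece ln); last by lra.
move=> /nrm_turn_inj[pe te].
have tt : n.+1%:R * u - k%:R = n.+1%:R * v - l%:R by apply: turn_eq => //; lra.
have okl : o k = o l.
  apply/eqP; apply: contraT => ne.
  have t01 : 0 <= n.+1%:R * u - k%:R <= 1 by lra.
  by have := pinj t01 ne; rewrite pe tt eqxx.
have kl := o_inj kn ln okl; apply: (mulfI (lt0r_neq0 N0)).
by move: tt; rewrite kl; lra.
Qed.

Theorem cl_knot : is_knot (cl p).
Proof.
have N0 : 0 < n.+1%:R :> R by rewrite ltr0n.
split; first exact: cl_sphere.
(* The jump of [arg] is absorbed by [L 0 = L 1], so [f] is continuous on the circle. *)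
pose f z := L (arg z); exists f.
have fturn u : 0 <= u <= 1 -> f (turn u) = L u.
  move=> u01; rewrite /f; have a01 : 0 <= arg (turn u) <= 1 by have := arg01 (turn u); lra.
  have at_ : turn (arg (turn u)) = turn u.
    by have := arg_turn u (@ltr01 R); rewrite !mul1r -surjective_pairing.
  have [->//|[-> ->]|[h _]] := turn_eq01 a01 u01 at_; first exact: Lper.
  by exfalso; have := arg01 (turn u); rewrite h; lra.
apply: (homeo_on_compact (0, 0)).
- exact: norm_hausdorff.
- exact: compact_sphere1.
- rewrite -turn_image; apply: compact_quotient; [exact: norm_hausdorff|exact: segment_compact| |].
    exact/continuous_subspaceT/continuous_turn.
  apply: (@subspace_eq_continuous _ _ _ L).
    by move=> u /set_mem /=; rewrite in_itv /= => /fturn.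
  exact: continuous_subspaceT.
- move=> z z' /set_mem/turn_surj[u u01 ->] /set_mem/turn_surj[u' u01' ->].
  have [h h'] : 0 <= u <= 1 /\ 0 <= u' <= 1 by lra.
  by rewrite !fturn // => /L_inj ->.
- rewrite -turn_image eqEsubset; split=> [_ [_ [u uI <-] <-]|_ [j [u [u01 ->]]]].
    move: uI; rewrite /= in_itv /= => uI; rewrite fturn //.
    have [u1|u1] := eqVneq u 1.
      rewrite u1 -Lper (@L_piece 0 0) //; last by rewrite mulr0 add0r lexx ler01.
      by exists (o 0), 0; rewrite mulr0 subr0 lexx ler01.
    have [|k kn ku] := @nat_part n.+1 (n.+1%:R * u).
      have /andP[u0 u1'] := uI; have ul : u < 1 by rewrite lt_neqAle u1.
      by rewrite mulr_ge0 //= -[ltRHS]mulr1 ltr_pM2l.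
    rewrite (L_piece kn); last by lra.
    by exists (o k), (n.+1%:R * u - k%:R); split=> //; lra.
  have [k kn ->] := o_surj j.
  pose v := (k%:R + u) / n.+1%:R.
  have vE : n.+1%:R * v = k%:R + u by rewrite /v mulrC divfK // gt_eqF.
  have kn' : k%:R + 1 <= n.+1%:R :> R by rewrite natr1 ler_nat.
  have k0 : 0 <= k%:R :> R by [].
  have v01 : 0 <= v <= 1.
    by apply/andP; split; [apply: divr_ge0; lra|rewrite /v ler_pdivrMr // mul1r; lra].
  exists (turn v); first by exists v; rewrite //= in_itv.
  rewrite fturn // (L_piece kn) vE; last by lra.
  by have -> : k%:R + u - k%:R = u by ring.
Qed.

End Loop.

Lemma closure_knot (n : nat) (w : bword n.+1) (j0 : 'I_n.+1) :
  uniq [seq iter k (bword_perm w) j0 | k <- iota 0 n.+1] ->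
  is_knot (closure_bword w : set C2).
Proof.
move=> u; rewrite closure_bwordE.
apply: (cl_knot (g := bword_perm w) _ _ _ u).
- by move=> j; apply: wpath_cont => v; cont.
- by move=> v j k _ jk; apply: contraNneq jk => /string_path_inj ->.
- move=> j; rewrite /wpath mulr0 string_path0 mulr1 string_path_end //.
  by rewrite ler_nat.
Qed.

End Knots.

(** * Assembly for the two words *)

Lemma widen_word (m : nat) (s : seq nat) : all (fun i => i <= m)%N s ->
  widen (@word m s) ++ [:: (ord_max, true)] = @word m.+1 (rcons s m.+1).
Proof.
move=> sm; rewrite -cats1 word_cat; congr (_ ++ _).
  rewrite /widen /word /gens /posword -!map_comp; apply/eq_in_map => i /(allP sm) im.
  rewrite /= /widen_letter /=; congr (_, _); apply: ord_inj.
  by rewrite -[LHS]/(nat_of_ord (lift ord_max (inord i))) lift_max !inordK // ltnS ltnW.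
rewrite /word /gens /=; congr [:: (_, _)]; apply: ord_inj.
by rewrite inordK.
Qed.

Lemma beta_gamma_isotopic (R : realType) :
  isotopic (closure_bword (@word 4 beta_word) : set ((R * R) * (R * R)))
    (closure_bword (@word 4 gamma_word)).
Proof.
apply: isotopic_trans (beta_chain) _.
rewrite -widen_word //.
apply: (isotopic_trans (isotopic_sym (@cb_sphere _ _ _) (closure_stabilization R _))).
apply: isotopic_trans middle_chain _.
apply: isotopic_trans (closure_stabilization R _) _.
by rewrite widen_word //; exact: gamma_chain.
Qed.

Lemma word_knot (R : realType) (w : bword 6) (s : seq nat) : braid_eq w (@word 4 s) ->
  all (fun i => i <= 4)%N s ->
  uniq [seq iter k (fun x => foldl (fun x i => nswap i x) x s) 0%N | k <- iota 0 6] ->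
  is_knot (closure_bword w : set ((R * R) * (R * R))).
Proof.
move=> ws s4 u; apply: (@closure_knot R 5 w ord0).
apply: (@map_uniq _ _ (@nat_of_ord 6)); rewrite -map_comp.
have -> : [seq (@nat_of_ord 6 \o (fun k => iter k (bword_perm w) ord0)) k | k <- iota 0 6] =
   [seq iter k (fun x => foldl (fun x i => nswap i x) x s) 0%N | k <- iota 0 6]; last by [].
apply: eq_map => k /=; rewrite (bword_perm_eq ws).
by elim: k => [//|k IH]; rewrite !iterS val_word_perm // IH.
Qed.

Unset Implicit Arguments.
Local Close Scope ring_scope.
Local Close Scope classical_set_scope.

Theorem theorem6 (R : realType) (beta gamma : braid 6)
    (hbeta : positive_permutation_braid beta)
    (hgamma : positive_permutation_braid gamma)
    (pbeta : braid_perm beta =1 cycle_fun [:: 1; 6; 5; 3; 2; 4])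
    (pgamma : braid_perm gamma =1 cycle_fun [:: 1; 5; 2; 6; 4; 3]) :
  (forall K L : set ((R * R) * (R * R)),
     is_closure beta K -> is_closure gamma L ->
     [/\ is_knot K, is_knot L & isotopic K L]) /\
  ~ braid_conjugate beta gamma.
Proof.
rewrite (beta_eq hbeta pbeta) (gamma_eq hgamma pgamma); split; last exact: beta_gamma_nonconj.
move=> _ _ [w /esym/braid_ofP wb ->] [v /esym/braid_ofP vg ->]; split.
- exact: word_knot wb _ _.
- exact: word_knot vg _ _.
(* The given closures come from arbitrary words of the two braids, so they are first compared with
   those of [beta_word] and [gamma_word]. *)
apply: isotopic_trans (closure_of_eq wb) _.
apply: isotopic_trans (beta_gamma_isotopic R) _.
exact: isotopic_sym (@cb_sphere _ _ _) (closure_of_eq vg).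
Qed.
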